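(* Consider the contextual dynamic pricing model and the pilot-corrected layered policy described in the context, run with horizon $T\ge 1$, confidence level $\delta\in(0,1)$, regularization $\lambda>0$, number of bins $N\ge1$, bin width $h=2B/N$, and pilot accuracy $\eta$. Suppose the bounded-valuation assumption, the surplus-dependent demand assumption, and the smoothness assumption $g\in\mathcal H(\beta,L_g;\mathcal I_g)$ ($\beta\ge 1$, $0<L_g<\infty$) hold, and let $0<\eta\le h$. Then, with probability at least $1-\delta$, $$ \begin{aligned} \mathrm{Reg}(T)\le{}& BD\min\left\{T,\ \frac{d\log(1+TC_x^2/d)}{\log(1+\eta^2/\gamma_T^2)}\right\} +64\,C_\omega B\bigl(D\sqrt{\iota_T}+\sqrt\lambda\bigr)\sqrt{NT\iota_T}\\ &+16\,C_\omega B T(h^\beta+\eta^2)\sqrt{\iota_T}+\bigl(8BD+L_{\mathrm{Rev}}\bigr)\sqrt T . \end{aligned} $$ Moreover, let $N=\lceil T^{1/(2\beta+1)}\rceil$, $h=2B/N$ and $\eta^2=\min\{h^2,h^\beta\}$. Then there is a finite constant $C>0$, depending only on the fixed problem primitives and not on $T$, such that with probability at least $1-\delta$, $$ \mathrm{Reg}(T)\le C\left[d(1+\gamma_T^2)\log\left(1+\frac{TC_x^2}{d}\right)+(1+\sqrt\lambda)\iota_T\right]T^{\frac{\beta+1}{2\beta+1}} . $$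
   Context: **Model.** Fix integers $d,T\ge1$, constants $B>0$, $B_\epsilon\in(0,B/2)$, $D>0$, $C_x,C_\theta<\infty$, a set $\mathcal X\subseteq\mathbb R^d$ with $\sup_{\bm x\in\mathcal X}\|\bm x\|_2\le C_x$, and $\Theta=\{\bm\theta\in\mathbb R^d:\|\bm\theta\|_2\le C_\theta\}$. In each period $t\in[T]=\{1,\dots,T\}$ the seller observes a covariate $\bm x_t\in\mathcal X$ (the covariate sequence is arbitrary, possibly dependent; no distributional assumption), uses internal randomization $U_t$, posts a price $p_t\in[0,B]$, and observes a quantity $y_t\in[0,D]$. $\mathcal F_{t-1}$ is the $\sigma$-field of all observations and policy randomization up to the end of period $t-1$; $\mathcal G_t=\mathcal F_{t-1}\vee\sigma(\bm x_t,U_t)$; $\mathcal F_t=\mathcal G_t\vee\sigma(y_t)$. The price and all labels chosen by the policy in period $t$ are $\mathcal G_t$-measurable. The latent valuation is $v_t=\bm x_t^\top\bm\theta_\star+\epsilon_t$ with unknown $\bm\theta_\star\in\Theta$; the shocks $\epsilon_t$ are i.i.d. with c.d.f. $F$ and mean zero, and $\epsilon_t$ is independent of $\mathcal G_t$ for every $t$. Almost surely, $y_t>0$ if and only if $v_t\ge p_t$. *Bounded valuations:* $|\epsilon_t|\le B_\epsilon$ a.s. and $\bm x^\top\bm\theta_\star\in[B_\epsilon,B-B_\epsilon]$ for all $\bm x\in\mathcal X$. *Surplus-dependent demand:* there is a measurable $q:\mathbb R\to[0,D]$ with $q(z)=0$ for $z<0$ or $z>B$ and $q(z)>0$ for $z\in[0,B]$,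 such that $\mathbb E[y_t\mid\mathcal G_t\vee\sigma(v_t)]=q(v_t-p_t)$ a.s. for every $t$. The induced link is $g(u)=\mathbb E[q(\epsilon_t-u)]$, $u\in\mathcal I_g:=[-B+B_\epsilon,B-B_\epsilon]$. Expected revenue is $\mathsf{Rev}(\bm x,p)=p\,g(p-\bm x^\top\bm\theta_\star)$; $p_t^\star$ is any maximizer of $\mathsf{Rev}(\bm x_t,\cdot)$ over $[0,B]$; $\mathrm{Reg}(T)=\sum_{t=1}^T\bigl(\mathsf{Rev}(\bm x_t,p_t^\star)-\mathsf{Rev}(\bm x_t,p_t)\bigr)$. **Hölder class.** For $\beta\ge1$ let $m=\varpi(\beta)$ be the largest nonnegative integer strictly smaller than $\beta$. $f\in\mathcal H(\beta,L;\mathcal I)$ means $f$ is $m$ times differentiable on the compact interval $\mathcal I$ and $|f^{(m)}(u)-f^{(m)}(u')|\le L|u-u'|^{\beta-m}$ on $\mathcal I$. The parameters $\beta,L_g$ are known to the policy. $g$ is extended from $\mathcal I_g$ to $[-B,B]$ by its endpoint Taylor polynomials of order $m$, and $C_g<\infty$ is a fixed constant, depending only on $B,B_\epsilon,D,\beta,L_g$, with $\max_{0\le k\le m}\sup_{[-B,B]}|g^{(k)}|\le C_g$. **Constants.** $\|\bm z\|_A=\sqrt{\bm z^\top A\bm z}$; $\Pi_I$ is projection onto the interval $I$; $\gamma_T=B\sqrt{d\log(1+TC_x^2/d)+2\log(4/\delta)}+C_\theta$; $S=\max\{1,\lceil\log_2\sqrt T\rceil\}$; $\iota_T=2\log(4SN/\delta)+[1+m(d+1)]\log(1+T/\lambda)$;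 $C_z=C_g\bigl[\sum_{k=0}^m\frac1{(k!)^2}+C_\theta^2\sum_{k=1}^m\frac1{(k!)^2}\bigr]^{1/2}$; $C_l=\max\bigl\{\frac{2^\beta L_g}{m!},\,C_g\sum_{k=2}^m\frac{(2^k-k-1)(2B)^{k-2}}{k!}\bigr\}$; $C_\psi^2=1+\sum_{k=1}^m[(2B)^k+Bk(2B)^{k-1}]^2+C_x^2\sum_{k=1}^m k^2(2B)^{2(k-1)}$; $C_\omega=\max\bigl\{1+\max\{C_\psi,C_z\}\sqrt{2\max\{1,C_\psi^2\}},\ C_l(1+\sqrt{2\max\{1,C_\psi^2\}})\bigr\}$; $L_{\mathrm{Rev}}=D+B\max\{L_g,C_g\}$. The ''fixed problem primitives'' are $B,B_\epsilon,D,C_x,C_\theta,\beta,L_g$ (hence also $C_g,C_z,C_l,C_\psi,C_\omega,L_{\mathrm{Rev}}$). **Outer policy.** Initialize $M_1=I_d$, $\bm b_1=\bm 0$, $\mathcal T^{\rm exp}=\emptyset$, $\Psi_{1,s}^j=\emptyset$ for $s\in[S],j\in[N]$. In period $t$, set $\widehat{\bm\theta}_t=M_t^{-1}\bm b_t$. If $\gamma_T\|\bm x_t\|_{M_t^{-1}}>\eta$ (pilot-exploration round, $t$ is put in $\mathcal T^{\rm exp}$): draw $p_t\sim\mathrm{Unif}[0,B]$ with fresh randomization, set $M_{t+1}=M_t+\bm x_t\bm x_t^\top$, $\bm b_{t+1}=\bm b_t+B\mathbf 1\{y_t>0\}\bm x_t$, and leave all $\Psi$'s unchanged. Otherwise (LDP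 round): run the layered rule below to get $(s_t,j_t,w_t,p_t)$ before observing $y_t$; leave $M,\bm b$ unchanged; set $\Psi_{t+1,s_t}^{j_t}=\Psi_{t,s_t}^{j_t}\cup\{t\}$ and leave the other $\Psi$'s unchanged. **Features and estimators.** $a_j=-B+2Bj/N$; $I_j=[a_{j-1},a_j)$ for $j<N$, $I_N=[a_{N-1},a_N]$; $\phi_j(u)=(1,u-a_{j-1},\dots,(u-a_{j-1})^m)^\top$ with componentwise derivative $\phi_j'$; $\mathbf X_j(\bm x,u)\in\mathbb R^{md}$ stacks the blocks $k(u-a_{j-1})^{k-1}\bm x$, $k=1,\dots,m$ (empty if $m=0$). On an LDP round, $\widehat u_t=\Pi_{[0,B]}(\bm x_t^\top\widehat{\bm\theta}_t)$, $\widehat p_t(w)=\widehat u_t+w$, and for $w\in I_j$ the feature $\psi_{t,j}(w)\in\mathbb R^{1+m(d+1)}$ stacks $\phi_j(w)+(\widehat p_t(w)-w)\phi_j'(w)$ and $-\mathbf X_j(\bm x_t,w)$. Put $\Lambda_{t,s}^j=\sum_{i\in\Psi_{t,s}^j}\psi_{i,j}(w_i)\psi_{i,j}(w_i)^\top$, $\widehat{\bm z}_{t,s}^j=(\lambda I+\Lambda_{t,s}^j)^{-1}\sum_{i\in\Psi_{t,s}^j}y_i\psi_{i,j}(w_i)$, $\widehat g_{t,s}^j(w)=\Pi_{[0,D]}(\psi_{t,j}(w)^\top\widehat{\bm z}_{t,s}^j)$, and, with $\ell=\|\psi_{t,j}(w)\|_{(\Lambda_{t,s}^j+\lambda I)^{-1}}$,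 $$r_{t,s}^j(w)=\min\bigl\{D,\ (C_\psi D\sqrt{\iota_T}+C_z\sqrt\lambda)\,\ell+C_l(h^\beta+\eta^2)\sqrt{|\Psi_{t,s}^j|}\,\ell+C_l(h^\beta+\eta^2)\bigr\},$$ with $r_{t,s}^j(w)=D$ if $\Psi_{t,s}^j=\emptyset$. Let $U_{t,s}^j(w)=\widehat p_t(w)\min\{D,\widehat g_{t,s}^j(w)+r_{t,s}^j(w)\}$ and $\operatorname{wid}_{t,s}^j(w)=\widehat p_t(w)r_{t,s}^j(w)$. **Layered rule.** $\mathcal W=\{-B+kT^{-1/2}:k=0,\dots,\lfloor2B\sqrt T\rfloor\}\cup\{0,B\}$; $\mathcal A_{t,1}=\{(j,w):j\in[N],\,w\in\mathcal W\cap I_j,\,0\le\widehat p_t(w)\le B\}$. Starting from $s=1$: (i) if $s=S$, choose $(j_t,w_t)\in\arg\max_{\mathcal A_{t,s}}U_{t,s}^j(w)$, set $s_t=s$ and stop; (ii) else if $\max_{\mathcal A_{t,s}}\operatorname{wid}_{t,s}^j(w)\le BD2^{-s}$ (precision check passes), set $\mathcal A_{t,s+1}=\{(j,w)\in\mathcal A_{t,s}:U_{t,s}^j(w)\ge\max_{\mathcal A_{t,s}}U_{t,s}^{j'}(w')-BD2^{1-s}\}$ and increase $s$ by one; (iii) else choose $(j_t,w_t)$ maximizing $U_{t,s}^j(w)$ over those $(j,w)\in\mathcal A_{t,s}$ with $\operatorname{wid}_{t,s}^j(w)>BD2^{-s}$, set $s_t=s$ and stop. Finally $p_t=\widehat p_t(w_t)$.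 Ties are broken arbitrarily (nonanticipatingly). *)

(* Defs.v *)
From HB Require Import structures.
From mathcomp Require Import all_boot all_order all_algebra.
From mathcomp Require Import all_classical all_reals all_analysis.

Set Implicit Arguments.
Unset Strict Implicit.
Unset Printing Implicit Defensive.

Import Order.TTheory GRing.Theory Num.Theory.
Import numFieldNormedType.Exports.

Local Open Scope classical_set_scope.
Local Open Scope ring_scope.

(** * Vectors, one-dimensional calculus on a compact interval, Hölder classes *)

Section Euclid.
Context {R : realType}.

(* The library norm on matrices is the sup norm, hence these definitions. *)
Definition wnorm n (A : 'M[R]_n) (z : 'cV[R]_n) : R :=
  Num.sqrt ((z^T *m A *m z) ord0 ord0).

Definition norm2 n (z : 'cV[R]_n) : R := wnorm 1%:M z.

Definition dotp n (x y : 'cV[R]_n) : R := (x^T *m y) ord0 ord0.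

Definition proj (a b x : R) : R := Num.min b (Num.max a x).

End Euclid.

Section Holder.
Context {R : realType}.
Implicit Types (a b u : R) (f : R -> R).

(* Difference quotients of f at u along points of [a, b] other than u, so that
   derivatives at the endpoints are one-sided. *)
Definition slopes a b f u : set_system R :=
  (fun v => (f v - f u) / (v - u)) @ within `[a, b] u^'.

Definition derivI a b f : R -> R := fun u => lim (slopes a b f u).

Definition derivnI a b k f : R -> R := iter k (derivI a b) f.

Definition varpi (beta : R) : nat := `|Num.ceil beta|%N.-1.

Lemma varpiP (beta : R) : 1 <= beta ->
  (varpi beta)%:R < beta /\ (forall k : nat, k%:R < beta -> (k <= varpi beta)%N).
Proof.
move=> b1; rewrite /varpi.
have /andP[] := ceil_itv beta.
have : 0 < Num.ceil beta by rewrite ceil_gt0 (lt_le_trans ltr01).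
case: (Num.ceil beta) => // -[//|n] _ /= lo hi.
rewrite (_ : n.+1%:Z - 1 = n%:Z) in lo; last by rewrite intS addrC addKr.
split; first by rewrite pmulrn.
move=> k kb; have := lt_le_trans kb hi.
by rewrite -pmulrn ltr_nat.
Qed.

Definition holder (beta L a b : R) f : Prop :=
  let m := varpi beta in
  (forall k u, (k < m)%N -> u \in `[a, b] ->
     cvg (slopes a b (derivnI a b k f) u)) /\
  (forall u u', u \in `[a, b] -> u' \in `[a, b] ->
     `|derivnI a b m f u - derivnI a b m f u'| <= L * `|u - u'| `^ (beta - m%:R)).

Definition taylorI (m : nat) a b f (c u : R) : R :=
  \sum_(k < m.+1) derivnI a b k f c / (k`!)%:R * (u - c) ^+ k.

Definition taylor_ext (m : nat) a b f : R -> R := fun u =>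
  if u < a then taylorI m a b f a u
  else if b < u then taylorI m a b f b u
  else f u.

End Holder.

(** * Problem primitives, tuning parameters and the derived constants *)

(* pCg is the fixed bound on the derivatives of the extended link; whether it is
   such a bound is a clause of [model_ok] below. *)
Record primitives (R : realType) := Primitives {
  pB : R;
  pBeps : R;
  pD : R;
  pCx : R;
  pCtheta : R;
  pbeta : R;
  pLg : R;
  pCg : R;
  pB_gt0 : 0 < pB;
  pBeps_itv : 0 < pBeps < pB / 2;
  pD_gt0 : 0 < pD;
  pbeta_ge1 : 1 <= pbeta;
  pLg_gt0 : 0 < pLg
}.

Record tuning (R : realType) (pr : primitives R) := Tuning {
  tT : nat;
  tdelta : R;
  tlambda : R;
  tN : nat;
  teta : R;
  tT_gt0 : (0 < tT)%N;
  tdelta_itv : 0 < tdelta < 1;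
  tlambda_gt0 : 0 < tlambda;
  tN_gt0 : (0 < tN)%N;
  teta_itv : 0 < teta <= 2 * pB pr / tN%:R
}.

Section Constants.
Context {R : realType} (pr : primitives R).
Local Notation B := (pB pr).
Local Notation D := (pD pr).
Local Notation Cx := (pCx pr).
Local Notation Ctheta := (pCtheta pr).
Local Notation Cg := (pCg pr).
Local Notation Lg := (pLg pr).

Definition mord : nat := varpi (pbeta pr).
Local Notation m := mord.

Definition Cz : R :=
  Cg * Num.sqrt (\sum_(0 <= k < m.+1) ((k`!)%:R ^+ 2)^-1
                 + Ctheta ^+ 2 * \sum_(1 <= k < m.+1) ((k`!)%:R ^+ 2)^-1).

Definition Cl : R :=
  Num.max (2 `^ pbeta pr * Lg / (m`!)%:R)
    (Cg * \sum_(2 <= k < m.+1)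
       (2 ^+ k - k%:R - 1) * (2 * B) ^+ (k - 2) / (k`!)%:R).

Definition Cpsi2 : R :=
  1 + \sum_(1 <= k < m.+1)
        ((2 * B) ^+ k + B * k%:R * (2 * B) ^+ (k - 1)) ^+ 2
    + Cx ^+ 2 * \sum_(1 <= k < m.+1) k%:R ^+ 2 * (2 * B) ^+ (2 * (k - 1)).

Definition Cpsi : R := Num.sqrt Cpsi2.

Definition Comega : R :=
  Num.max (1 + Num.max Cpsi Cz * Num.sqrt (2 * Num.max 1 Cpsi2))
          (Cl * (1 + Num.sqrt (2 * Num.max 1 Cpsi2))).

Definition LRev : R := D + B * Num.max Lg Cg.

Variables (d : nat) (tu : tuning pr).
Local Notation T := ((tT tu)%:R : R).

Definition gammaT : R :=
  B * Num.sqrt (d%:R * ln (1 + T * Cx ^+ 2 / d%:R) + 2 * ln (4 / tdelta tu))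
  + Ctheta.

Definition nlayers : nat :=
  maxn 1 `|Num.ceil (ln (Num.sqrt T) / ln 2)|%N.

Definition iotaT : R :=
  2 * ln (4 * nlayers%:R * (tN tu)%:R / tdelta tu)
  + (1 + m * (d + 1))%N%:R * ln (1 + T / tlambda tu).

Definition hbin : R := 2 * B / (tN tu)%:R.

Definition regret_bound : R :=
  B * D * Num.min T
    (d%:R * ln (1 + T * Cx ^+ 2 / d%:R) / ln (1 + teta tu ^+ 2 / gammaT ^+ 2))
  + 64 * Comega * B * (D * Num.sqrt iotaT + Num.sqrt (tlambda tu))
      * Num.sqrt ((tN tu)%:R * T * iotaT)
  + 16 * Comega * B * T * (hbin `^ pbeta pr + teta tu ^+ 2) * Num.sqrt iotaT
  + (8 * B * D + LRev) * Num.sqrt T.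

Definition regret_rate : R :=
  (d%:R * (1 + gammaT ^+ 2) * ln (1 + T * Cx ^+ 2 / d%:R)
   + (1 + Num.sqrt (tlambda tu)) * iotaT)
  * T `^ ((pbeta pr + 1) / (2 * pbeta pr + 1)).

Definition rate_tuning : Prop :=
  tN tu = `|Num.ceil (T `^ (2 * pbeta pr + 1)^-1)|%N
  /\ teta tu ^+ 2 = Num.min (hbin ^+ 2) (hbin `^ pbeta pr).

End Constants.

(** * The policy along one realized trajectory

   Periods are numbered 0, ..., T-1, so an object indexed by t (a pilot matrix,
   an index set, ...) is the one available at the beginning of that period and
   depends on the periods i < t.  Bins are numbered 0, ..., N-1, layers
   1, ..., S.  The labels tr_s, tr_j, tr_w of a pilot-exploration period are
   meaningless and never used. *)

Record trajectory (R : realType) (d N : nat) := Trajectory {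
  tr_x : nat -> 'cV[R]_d;
  tr_y : nat -> R;
  tr_p : nat -> R;
  tr_s : nat -> nat;
  tr_j : nat -> 'I_N;
  tr_w : nat -> R
}.

Section Policy.
Context {R : realType} (pr : primitives R) (tu : tuning pr) (d : nat).
Local Notation B := (pB pr).
Local Notation D := (pD pr).
Local Notation m := (mord pr).
Local Notation N := (tN tu).
Local Notation S := (nlayers tu).
Local Notation lam := (tlambda tu).
Local Notation bias := (hbin tu `^ pbeta pr + teta tu ^+ 2).
Local Notation dimf := (m.+1 + m * d)%N.

Definition knot (k : nat) : R := - B + 2 * B * k%:R / N%:R.

Definition in_bin (j : 'I_N) (u : R) : bool :=
  if j.+1 == N then knot j <= u <= knot j.+1 else knot j <= u < knot j.+1.

Definition phi (j : 'I_N) (u : R) : 'cV[R]_m.+1 :=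
  \col_k (u - knot j) ^+ k.

Definition dphi (j : 'I_N) (u : R) : 'cV[R]_m.+1 :=
  \col_k (k%:R * (u - knot j) ^+ k.-1).

(* [mxvec] is row-major: row k holds the block k.+1. *)
Definition Xblocks (j : 'I_N) (x : 'cV[R]_d) (u : R) : 'cV[R]_(m * d) :=
  (mxvec (\matrix_(k < m, i < d) (k.+1%:R * (u - knot j) ^+ k * x i ord0)))^T.

Definition in_grid (w : R) : Prop :=
  (exists2 k : nat, (k <= Num.truncn (2 * B * Num.sqrt (tT tu)%:R))%N &
     w = - B + k%:R * (Num.sqrt (tT tu)%:R)^-1)
  \/ w = 0 \/ w = B.

Definition explores (M : 'M[R]_d) (x : 'cV[R]_d) : bool :=
  teta tu < gammaT d tu * wnorm (invmx M) x.

Variable tr : trajectory R d N.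
Local Notation x := (tr_x tr).
Local Notation y := (tr_y tr).

Fixpoint pilot (t : nat) : 'M[R]_d * 'cV[R]_d :=
  if t is u.+1 then
    let: (M, b) := pilot u in
    if explores M (x u) then
      (M + x u *m (x u)^T, b + (B * (0 < y u)%R%:R) *: x u)
    else (M, b)
  else (1%:M, 0).

Definition explore (t : nat) : bool := explores (pilot t).1 (x t).

Definition theta_hat (t : nat) : 'cV[R]_d := invmx (pilot t).1 *m (pilot t).2.

Fixpoint Psi (t s : nat) (j : 'I_N) : seq nat :=
  if t is u.+1 then
    if [&& ~~ explore u, tr_s tr u == s & tr_j tr u == j]
    then rcons (Psi u s j) u else Psi u s j
  else [::].

Definition u_hat (t : nat) : R := proj 0 B (dotp (x t) (theta_hat t)).

Definition p_hat (t : nat) (w : R) : R := u_hat t + w.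

Definition feat (t : nat) (j : 'I_N) (w : R) : 'cV[R]_dimf :=
  col_mx (phi j w + (p_hat t w - w) *: dphi j w) (- Xblocks j (x t) w).

Definition gram (t s : nat) (j : 'I_N) : 'M[R]_dimf :=
  \sum_(i <- Psi t s j)
     feat i j (tr_w tr i) *m (feat i j (tr_w tr i))^T.

Definition rgram (t s : nat) (j : 'I_N) : 'M[R]_dimf := lam%:M + gram t s j.

Definition z_hat (t s : nat) (j : 'I_N) : 'cV[R]_dimf :=
  invmx (rgram t s j) *m
    \sum_(i <- Psi t s j) y i *: feat i j (tr_w tr i).

Definition g_hat (t s : nat) (j : 'I_N) (w : R) : R :=
  proj 0 D (dotp (feat t j w) (z_hat t s j)).

Definition radius (t s : nat) (j : 'I_N) (w : R) : R :=
  let l := wnorm (invmx (rgram t s j)) (feat t j w) in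
  if Psi t s j is [::] then D else
  Num.min D
    ((Cpsi pr * D * Num.sqrt (iotaT d tu) + Cz pr * Num.sqrt lam) * l
     + Cl pr * bias * Num.sqrt (size (Psi t s j))%:R * l
     + Cl pr * bias).

Definition ucb (t s : nat) (c : 'I_N * R) : R :=
  p_hat t c.2 * Num.min D (g_hat t s c.1 c.2 + radius t s c.1 c.2).

Definition wid (t s : nat) (c : 'I_N * R) : R :=
  p_hat t c.2 * radius t s c.1 c.2.

Definition initial_actions (t : nat) : set ('I_N * R) :=
  [set c | [/\ in_grid c.2, in_bin c.1 c.2 & 0 <= p_hat t c.2 <= B]].

Definition refine (t s : nat) (A : set ('I_N * R)) : set ('I_N * R) :=
  [set c | A c /\
     forall c', A c' -> ucb t s c' - B * D * (2 / 2 ^+ s) <= ucb t s c].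

(* Candidate set of layer s; only meaningful when the layers 1, ..., s-1 passed
   their precision check. *)
Fixpoint actions (t s : nat) : set ('I_N * R) :=
  if s is r.+1 then
    if r == 0%N then initial_actions t else refine t r (actions t r)
  else set0.

Definition precise (t s : nat) : Prop :=
  forall c, actions t s c -> wid t s c <= B * D / 2 ^+ s.

Definition argmax (C : Type) (A : set C) (f : C -> R) (c : C) : Prop :=
  A c /\ forall c', A c' -> f c' <= f c.

Definition layered_choice (t : nat) : Prop :=
  let s := tr_s tr t in
  let c := (tr_j tr t, tr_w tr t) in
  [/\ (1 <= s <= S)%N,
      (forall r, (1 <= r < s)%N -> precise t r) &
      if s == S then argmax (actions t s) (ucb t s) c
      else ~ precise t s /\
           argmax (actions t s `&` [set c | B * D / 2 ^+ s < wid t s c])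
                  (ucb t s) c].

Definition follows_policy : Prop :=
  forall t, (t < tT tu)%N -> ~~ explore t ->
    layered_choice t /\ tr_p tr t = p_hat t (tr_w tr t).

End Policy.

(** * The stochastic model *)

Section Sigma.
Context {dO : measure_display} {Om : measurableType dO} {R : realType}.
Implicit Types (P : probability Om R) (H : set_system Om).

Definition sjoin H1 H2 : set_system Om := <<s H1 `|` H2 >>.

Definition meas_wrt dE (E : measurableType dE) H (f : Om -> E) : Prop :=
  forall V, measurable V -> H (f @^-1` V).

Definition sigma_vec d (f : Om -> 'cV[R]_d) : set_system Om :=
  <<s \bigcup_i g_sigma_algebra_preimage (fun w => f w i ord0) >>.

(* Y is a version of the conditional expectation of X given H. *)
Definition is_cond_exp P H (X Y : Om -> R) : Prop :=
  [/\ meas_wrt H Y, P.-integrable setT (EFin \o Y) &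
      forall A, H A -> (\int[P]_(w in A) (X w)%:E = \int[P]_(w in A) (Y w)%:E)%E].

Definition with_prob_ge P (c : R) (Q : Om -> Prop) : Prop :=
  exists E, [/\ measurable E, (c%:E <= P E)%E & forall w, E w -> Q w].

End Sigma.

(* sU t is the randomization of the policy in period t; ss, sj, sw are the labels
   of the layered periods; spstar is an arbitrary selection of optimal prices. *)
Record system (R : realType) (d N : nat) (dO : measure_display)
    (Om : measurableType dO) (P : probability Om R)
    (dU : measure_display) (UT : measurableType dU) := System {
  sX : set 'cV[R]_d;
  stheta : 'cV[R]_d;
  sF : R -> R;
  sq : R -> R;
  sx : nat -> Om -> 'cV[R]_d;
  sU : nat -> {mfun Om >-> UT};
  seps : nat -> {RV P >-> R};
  sy : nat -> {RV P >-> R};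
  sp : nat -> Om -> R;
  ss : nat -> Om -> nat;
  sj : nat -> Om -> 'I_N;
  sw : nat -> Om -> R;
  spstar : nat -> Om -> R
}.

Section Model.
Context {R : realType} (pr : primitives R) (tu : tuning pr) (d : nat).
Context {dO : measure_display} {Om : measurableType dO} {P : probability Om R}.
Context {dU : measure_display} {UT : measurableType dU}.
Variable sys : system d (tN tu) P UT.
Local Notation B := (pB pr).
Local Notation Beps := (pBeps pr).
Local Notation D := (pD pr).
Local Notation T := (tT tu).
Local Notation N := (tN tu).
Local Notation m := (mord pr).
Local Notation x := (sx sys).
Local Notation y := (sy sys).
Local Notation p := (sp sys).
Local Notation eps := (seps sys).
Local Notation theta := (stheta sys).
Local Notation q := (sq sys).

(* past t: everything before period t; past_cov t: and the covariate of t;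
   info t: and the randomization of t. *)
Fixpoint past (t : nat) : set_system Om :=
  if t is u.+1 then
    sjoin (sjoin (sjoin (past u) (sigma_vec (x u)))
                 (g_sigma_algebra_preimage (sU sys u)))
          (g_sigma_algebra_preimage (y u))
  else [set set0; setT].

Definition past_cov (t : nat) : set_system Om :=
  sjoin (past t) (sigma_vec (x t)).

Definition info (t : nat) : set_system Om :=
  sjoin (past_cov t) (g_sigma_algebra_preimage (sU sys t)).

Definition valuation (t : nat) (w : Om) : R := dotp (x t w) theta + eps t w.

Definition realized (w : Om) : trajectory R d N :=
  {| tr_x := x ^~ w; tr_y := fun t => y t w; tr_p := p ^~ w;
     tr_s := ss sys ^~ w; tr_j := sj sys ^~ w; tr_w := sw sys ^~ w |}.

(* The shocks are identically distributed, so period 0 stands for any period. *)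
Definition link (u : R) : R := fine ('E_P[fun w => q (eps 0%N w - u)])%E.

Definition link_ext : R -> R :=
  taylor_ext m (- B + Beps) (B - Beps) link.

Definition Rev (z : 'cV[R]_d) (r : R) : R := r * link (r - dotp z theta).

Definition Reg (w : Om) : R :=
  \sum_(t < T) (Rev (x t w) (spstar sys t w) - Rev (x t w) (p t w)).

Record model_ok : Prop := ModelOk {
  dim_gt0 : (0 < d)%N;
  X_bounded : forall z, sX sys z -> norm2 z <= pCx pr;
  theta_in : norm2 theta <= pCtheta pr;

  x_in : forall t w, (t < T)%N -> sX sys (x t w);
  x_meas : forall t i, (t < T)%N -> measurable_fun setT (fun w => x t w i ord0);
  p_in : forall t w, (t < T)%N -> 0 <= p t w <= B;
  y_in : forall t w, (t < T)%N -> 0 <= y t w <= D;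
  p_info : forall t, (t < T)%N -> meas_wrt (info t) (p t);
  s_info : forall t k, (t < T)%N -> info t (ss sys t @^-1` [set k]);
  j_info : forall t k, (t < T)%N -> info t (sj sys t @^-1` [set k]);
  w_info : forall t, (t < T)%N -> meas_wrt (info t) (sw sys t);

  eps_cdf : forall t u, (t < T)%N -> cdf (eps t) u = (sF sys u)%:E;
  eps_iid : forall V : nat -> set R, (forall t, measurable (V t)) ->
    (P (\bigcap_(t < T) (eps t @^-1` V t)) = \prod_(t < T) P (eps t @^-1` V t))%E;
  eps_mean : forall t, (t < T)%N -> ('E_P[eps t] = 0)%E;
  eps_indep : forall t E V, (t < T)%N -> info t E -> measurable V ->
    P (eps t @^-1` V `&` E) = (P (eps t @^-1` V) * P E)%E;

  sale : forall t, (t < T)%N ->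
    {ae P, forall w, 0 < y t w <-> p t w <= valuation t w};

  eps_bounded : forall t, (t < T)%N -> {ae P, forall w, `|eps t w| <= Beps};
  value_bounded : forall z, sX sys z -> Beps <= dotp z theta <= B - Beps;

  q_meas : measurable_fun setT q;
  q_in : forall z, 0 <= q z <= D;
  q_out : forall z, z < 0 \/ B < z -> q z = 0;
  q_pos : forall z, 0 <= z <= B -> 0 < q z;
  demand : forall t, (t < T)%N ->
    is_cond_exp P
      (sjoin (info t) (g_sigma_algebra_preimage (valuation t)))
      (y t) (fun w => q (valuation t w - p t w));

  link_holder : holder (pbeta pr) (pLg pr) (- B + Beps) (B - Beps) link;
  link_ext_bound : forall k u, (k <= m)%N -> - B <= u <= B ->
    `|derivnI (- B) B k link_ext u| <= pCg pr;

  policy : forall w, follows_policy (realized w);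
  (* A fresh uniform draw: given the past and the current covariate, the price of
     a pilot-exploration period is uniform on [0, B]. *)
  pilot_price : forall t E V, (t < T)%N -> past_cov t E -> measurable V ->
    let X := E `&` [set w | explore (realized w) t] in
    P (X `&` p t @^-1` V) = (P X * uniform_prob (pB_gt0 pr) V)%E;

  pstar_max : forall t w, (t < T)%N ->
    argmax [set r | 0 <= r <= B] (Rev (x t w)) (spstar sys t w)
}.

End Model.

(* Main.v *)
From HB Require Import structures.
From mathcomp Require Import all_boot all_order all_algebra.
From mathcomp Require Import all_classical all_reals all_analysis.
From mathcomp Require Import measurable_realfun ring lra.
From Pilot Require Import Defs.

(** Normalized by the ranges B and D, the noises 1{y > 0} - x^T theta / B of the
    pilot rounds (centered because the pilot price is uniform) and
    y - g(p - x^T theta) of the LDP rounds are bounded by 1.  For such a noise xi and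
    a predictable direction a, let S be the sum of the xi a and V the regularized
    Gram matrix.  Then exp(S^T V^-1 S / 2) / sqrt(det V) is a supermartingale: with
    c = a^T V^-1 a and A = a^T V^-1 S / (1 + c), a new observation adds
    A xi + c xi^2 / (2 (1 + c)) - (1 + c) A^2 / 2 to the exponent and multiplies
    det V by 1 + c, while E exp(A xi) <= exp(A^2 / 2) and
    exp(c / (2 (1 + c))) <= sqrt(1 + c).  Ville's inequality and a union bound over
    the pilot and the S N regressions give ellipsoidal confidence sets, with no
    mixture argument.

    On the resulting event the pilot error is at most eta.  Since the extended link
    is Hölder, a Taylor expansion at the left knot of the bin shows that the demand is
    linear in the features up to C_l (h^beta + eta^2), so that the radii dominate the
    estimation errors.  A round decided in layer s then has regret at most 8 B D 2^-s,
    and the elliptical potential lemma bounds the number of rounds of a layer. *)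

Set Implicit Arguments.
Unset Strict Implicit.
Unset Printing Implicit Defensive.

Import Order.TTheory GRing.Theory Num.Theory.
Import numFieldNormedType.Exports.

Local Open Scope classical_set_scope.
Local Open Scope ring_scope.

(** * Positive definite matrices *)

(** The self-normalized inequality allows adaptively chosen directions, so the layers are not there
    to decouple observations. They make regret and width comparable: an action that reaches layer s
    has survived the checks of all coarser layers, so its regret against the best grid action is of
    order 2^-s, while a stop in a layer s < S certifies a radius above D 2^-s, and such rounds can
    be counted. The count fails once D 2^-s is below twice the approximation error; those layers are
    charged to the bias term instead.

    The features are linearized in the pilot error. Its first-order effect is absorbed by the theta
    blocks of the coefficient vector, so only eta^2 is left.

    The two kinds of regression need different filtrations. *)

Section LinearAlgebra.
Context {R : realType}.

Definition qform n (A : 'M[R]_n) (z : 'cV[R]_n) : R := (z^T *m A *m z) ord0 ord0.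

Definition spd n (A : 'M[R]_n) : Prop :=
  A^T = A /\ forall v : 'cV[R]_n, v != 0 -> 0 < qform A v.

Lemma wnormE n (A : 'M[R]_n) z : wnorm A z = Num.sqrt (qform A z).
Proof. by []. Qed.

Lemma dotpE n (x y : 'cV[R]_n) : dotp x y = \sum_i x i ord0 * y i ord0.
Proof. by rewrite /dotp mxE; apply: eq_bigr => i _; rewrite mxE. Qed.

Lemma dotpC n (x y : 'cV[R]_n) : dotp x y = dotp y x.
Proof. by rewrite !dotpE; apply: eq_bigr => i _; rewrite mulrC. Qed.

Lemma dotpDr n (x y z : 'cV[R]_n) : dotp x (y + z) = dotp x y + dotp x z.
Proof. by rewrite /dotp mulmxDr mxE. Qed.

Lemma dotpZr n a (x y : 'cV[R]_n) : dotp x (a *: y) = a * dotp x y.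
Proof. by rewrite /dotp -scalemxAr mxE. Qed.

Lemma dotpNr n (x y : 'cV[R]_n) : dotp x (- y) = - dotp x y.
Proof. by rewrite /dotp mulmxN mxE. Qed.

Lemma dotpDl n (x y z : 'cV[R]_n) : dotp (x + y) z = dotp x z + dotp y z.
Proof. by rewrite ![dotp _ z]dotpC dotpDr. Qed.

Lemma dotpZl n a (x y : 'cV[R]_n) : dotp (a *: x) y = a * dotp x y.
Proof. by rewrite ![dotp _ y]dotpC dotpZr. Qed.

Lemma dotpNl n (x y : 'cV[R]_n) : dotp (- x) y = - dotp x y.
Proof. by rewrite ![dotp _ y]dotpC dotpNr. Qed.

Lemma dotp_col_mx n1 n2 (a c : 'cV[R]_n1) (b d : 'cV[R]_n2) :
  dotp (col_mx a b) (col_mx c d) = dotp a c + dotp b d.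
Proof. by rewrite /dotp tr_col_mx mul_row_col mxE. Qed.

Lemma dotp0 n (x : 'cV[R]_n) : dotp x 0 = 0.
Proof. by rewrite /dotp mulmx0 mxE. Qed.

Lemma dotp_sumr n (x : 'cV[R]_n) I (r : seq I) (P : pred I) (F : I -> 'cV[R]_n) :
  dotp x (\sum_(i <- r | P i) F i) = \sum_(i <- r | P i) dotp x (F i).
Proof. by apply: (big_morph _ (dotpDr x) (dotp0 x)). Qed.

Lemma dotp_ge0 n (x : 'cV[R]_n) : 0 <= dotp x x.
Proof. by rewrite dotpE sumr_ge0 // => i _; rewrite -expr2 sqr_ge0. Qed.

Lemma dotp_eq0 n (x : 'cV[R]_n) : (dotp x x == 0) = (x == 0).
Proof.
apply/eqP/eqP => [|->]; last by rewrite dotp0.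
rewrite dotpE => /psumr_eq0P x0; apply/matrixP => i j; rewrite ord1 mxE.
by apply/eqP; rewrite -sqrf_eq0 expr2 x0// => k _; rewrite -expr2 sqr_ge0.
Qed.

Lemma dotp_mulmxr n (A : 'M[R]_n) x y : dotp x (A *m y) = dotp (A^T *m x) y.
Proof. by rewrite /dotp trmx_mul trmxK mulmxA. Qed.

Lemma qformE n (A : 'M[R]_n) z : qform A z = dotp z (A *m z).
Proof. by rewrite /qform /dotp mulmxA. Qed.

Lemma qform0 n (A : 'M[R]_n) : qform A 0 = 0.
Proof. by rewrite qformE mulmx0 dotp0. Qed.

Lemma norm2_sqr n (x : 'cV[R]_n) : norm2 x ^+ 2 = dotp x x.
Proof. by rewrite /norm2 wnormE qformE mul1mx sqr_sqrtr// dotp_ge0. Qed.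

Lemma norm2_ge0 n (x : 'cV[R]_n) : 0 <= norm2 x.
Proof. exact: sqrtr_ge0. Qed.

Lemma outer_mul n (x v : 'cV[R]_n) : x *m x^T *m v = dotp x v *: x.
Proof. by rewrite -mulmxA [x^T *m v]mx11_scalar mul_mx_scalar. Qed.

Lemma spd_scalar n (l : R) : 0 < l -> spd (l%:M : 'M[R]_n).
Proof.
move=> l0; split=> [|v v0]; first by rewrite tr_scalar_mx.
by rewrite qformE mul_scalar_mx dotpZr mulr_gt0// lt_neqAle dotp_ge0 eq_sym dotp_eq0 v0.
Qed.

Lemma spd_qform_ge0 n (A : 'M[R]_n) v : spd A -> 0 <= qform A v.
Proof.
by move=> [_ Ap]; have [->|/Ap/ltW//] := eqVneq v 0; rewrite qform0.
Qed.

Lemma spd_addouter n (A : 'M[R]_n) (x : 'cV[R]_n) : spd A -> spd (A + x *m x^T).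
Proof.
move=> [As Ap]; split=> [|v v0]; first by rewrite [LHS]raddfD /= trmx_mul trmxK As.
rewrite qformE mulmxDl dotpDr outer_mul dotpZr -qformE [dotp v x]dotpC -expr2.
by rewrite ltr_pwDl ?Ap// sqr_ge0.
Qed.

(** A row v of the kernel satisfies v A = 0, so its quadratic form vanishes and positivity forces v
    = 0. *)
Lemma spd_unitmx n (A : 'M[R]_n) : spd A -> A \in unitmx.
Proof.
move=> [As Ap]; rewrite -row_free_unit -kermx_eq0; apply/eqP/row_matrixP => i.
rewrite row0; apply/eqP; apply: contraT => v0.
have := Ap (row i (kermx A))^T.
rewrite trmx_eq0 => /(_ v0); rewrite /qform trmxK.
by rewrite -row_mul mulmx_ker row0 mul0mx mxE ltxx.
Qed.

Lemma spd_invmx n (A : 'M[R]_n) : spd A -> spd (invmx A).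
Proof.
move=> sA; have [As Ap] := sA; have uA := spd_unitmx sA.
split=> [|v v0]; first by rewrite trmx_inv As.
have := Ap (invmx A *m v); rewrite !qformE mulmxA mulmxV// mul1mx.
rewrite dotpC; apply; apply: contraNN v0 => /eqP v0.
by rewrite -[v](mulKVmx uA) v0 mulmx0.
Qed.

Lemma qformD n (A : 'M[R]_n) u v : A^T = A ->
  qform A (u + v) = qform A u + 2 * dotp u (A *m v) + qform A v.
Proof.
move=> As; rewrite !qformE mulmxDr !dotpDl !dotpDr.
have -> : dotp v (A *m u) = dotp u (A *m v) by rewrite dotp_mulmxr As dotpC.
by ring.
Qed.

Lemma qformZ n (A : 'M[R]_n) a u : qform A (a *: u) = a ^+ 2 * qform A u.
Proof. by rewrite !qformE -scalemxAr dotpZr dotpZl mulrA -expr2. Qed.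

(** The form is nonnegative at the component of u that is A-orthogonal to v; multiplying out gives
    the inequality. *)
Lemma spd_CauchySchwarz n (A : 'M[R]_n) u v : spd A ->
  dotp u (A *m v) ^+ 2 <= qform A u * qform A v.
Proof.
move=> sA; have [As Ap] := sA; have [->|v0] := eqVneq v 0.
  by rewrite mulmx0 dotp0 qform0 mulr0 expr0n.
have qv := Ap _ v0.
have := spd_qform_ge0 (u + (- (dotp u (A *m v) / qform A v)) *: v) sA.
rewrite qformD// -scalemxAr dotpZr qformZ.
set a := dotp _ _; set b := qform A u; set c := qform A v in qv *.
have -> : b + 2 * (- (a / c) * a) + (- (a / c)) ^+ 2 * c = (b * c - a ^+ 2) / c.
  by field; rewrite gt_eqF.
by rewrite pmulr_lge0 ?invr_gt0// subr_ge0.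
Qed.

(** The weighted norms of A and of its inverse are dual: this is Cauchy-Schwarz for the inverse, at
    A v and u. *)
Lemma dotp_le_wnorm n (A : 'M[R]_n) u v : spd A ->
  `|dotp u v| <= wnorm (invmx A) u * wnorm A v.
Proof.
move=> sA; have uA := spd_unitmx sA; have [As _] := sA.
rewrite -sqrtr_sqr !wnormE -sqrtrM ?spd_qform_ge0//; last exact: spd_invmx.
apply: ler_wsqrtr; have := spd_CauchySchwarz (A *m v) u (spd_invmx sA).
rewrite [qform _ (A *m v)]qformE mulKmx// [dotp (A *m v) v]dotpC -qformE.
have -> : dotp (A *m v) (invmx A *m u) = dotp u v.
  by rewrite dotp_mulmxr trmx_inv As mulKmx// dotpC.
by rewrite mulrC.
Qed.

Lemma wnorm_triangle n (A : 'M[R]_n) u v : spd A ->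
  wnorm A (u + v) <= wnorm A u + wnorm A v.
Proof.
move=> sA; have [As _] := sA.
have qu := spd_qform_ge0 u sA; have qv := spd_qform_ge0 v sA.
rewrite -(@ler_pXn2r _ 2)// ?nnegrE ?addr_ge0 ?sqrtr_ge0//.
rewrite sqrrD !wnormE !sqr_sqrtr// ?spd_qform_ge0// qformD//.
rewrite lerD2r lerD2l mulr_natl lerMn2r /= -sqrtrM//.
apply: le_trans (ler_norm _) _.
by rewrite -sqrtr_sqr ler_wsqrtr// spd_CauchySchwarz.
Qed.

Lemma wnormN n (A : 'M[R]_n) u : wnorm A (- u) = wnorm A u.
Proof. by rewrite !wnormE -scaleN1r qformZ sqrrN expr1n mul1r. Qed.

Lemma wnormZ n (A : 'M[R]_n) a u : wnorm A (a *: u) = `|a| * wnorm A u.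
Proof. by rewrite !wnormE qformZ sqrtrM ?sqr_ge0// sqrtr_sqr. Qed.

(** The Sherman-Morrison formula. A one-sided product check suffices, because the updated matrix is
    already known to be invertible. *)
Lemma invmx_addouter n (A : 'M[R]_n) (x : 'cV[R]_n) : spd A ->
  invmx (A + x *m x^T) = invmx A -
    (1 + qform (invmx A) x)^-1 *: (invmx A *m x *m x^T *m invmx A).
Proof.
move=> sA; have uA := spd_unitmx sA; have c0 := spd_qform_ge0 x (spd_invmx sA).
have uB := spd_unitmx (spd_addouter x sA).
set c := qform _ _ in c0 *.
suff e : (A + x *m x^T) *m (invmx A - (1 + c)^-1 *: (invmx A *m x *m x^T *m invmx A)) = 1%:M.
  by rewrite -[RHS](mulKmx uB) e mulmx1.
set Y := x *m x^T *m invmx A.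
have -> : invmx A *m x *m x^T *m invmx A = invmx A *m Y by rewrite /Y !mulmxA.
rewrite mulmxBr mulmxDl mulmxV// -/Y -scalemxAr mulmxDl mulKVmx//.
have -> : x *m x^T *m (invmx A *m Y) = c *: Y.
  have e : x *m x^T *m invmx A *m x = c *: x by rewrite -mulmxA outer_mul -qformE.
  by rewrite /Y !mulmxA e -!scalemxAl.
by rewrite -{2}[Y]scale1r -scalerDl scalerA mulVf ?gt_eqF ?ltr_pwDl// scale1r addrK.
Qed.

(** Sherman-Morrison turned into the increment of the self-normalized exponent, up to the factor
    1/2, when the observation [r] is made in the direction [x]. *)
Lemma qform_invmx_addouter n (A : 'M[R]_n) (x s : 'cV[R]_n) r : spd A ->
  let a := dotp x (invmx A *m s) in let c := qform (invmx A) x in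
  qform (invmx (A + x *m x^T)) (s + r *: x) =
  qform (invmx A) s + (2 * r * a + r ^+ 2 * c - a ^+ 2) / (1 + c).
Proof.
move=> sA a c; have c0 : 0 <= c by exact: spd_qform_ge0 (spd_invmx sA).
have [Is _] := spd_invmx sA.
have gA v w : dotp v ((invmx A *m x *m x^T *m invmx A) *m w)
    = dotp x (invmx A *m v) * dotp x (invmx A *m w).
  rewrite -!mulmxA [x^T *m _]mx11_scalar mul_mx_scalar -scalemxAr dotpZr mulrC.
  by rewrite dotp_mulmxr Is dotpC.
rewrite invmx_addouter// -/c qformE mulmxBl dotpDr dotpNr -qformE qformD// qformZ.
rewrite -scalemxAl dotpZr gA mulmxDr dotpDr -!scalemxAr !dotpZr -!qformE -/a -/c.
have -> : dotp s (invmx A *m x) = a by rewrite dotp_mulmxr Is dotpC.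
by field; rewrite gt_eqF ?ltr_pwDl.
Qed.

(** The matrices [L], [U] and [U'] are block triangular and satisfy L U = U' L; comparing
    determinants gives the rank-one case of Sylvester's identity. *)
Lemma det_1Douter n (u v : 'cV[R]_n) : \det (1%:M + u *m v^T) = 1 + dotp v u.
Proof.
pose L : 'M[R]_(1 + n) := block_mx 1%:M 0 u 1%:M.
pose U : 'M[R]_(1 + n) := block_mx 1%:M (- v^T) 0 (1%:M + u *m v^T).
pose U' : 'M[R]_(1 + n) := block_mx (1 + dotp v u)%:M (- v^T) 0 1%:M.
have e : L *m U = U' *m L.
  rewrite !mulmx_block !mul1mx !mul0mx !mulmx1 !mulmx0 !addr0 !add0r.
  congr block_mx; last by rewrite mulmxN addrCA addNr addr0.
  rewrite mulNmx [v^T *m u]mx11_scalar -/(dotp v u).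
  by rewrite raddfD addrK.
have := congr1 determinant e; rewrite !det_mulmx !det_lblock !det_ublock !det1 !mul1r !mulr1.
by rewrite det_scalar1.
Qed.

Lemma det_addouter n (A : 'M[R]_n) (x : 'cV[R]_n) : spd A ->
  \det (A + x *m x^T) = \det A * (1 + qform (invmx A) x).
Proof.
move=> sA; have uA := spd_unitmx sA.
have -> : A + x *m x^T = A *m (1%:M + (invmx A *m x) *m x^T).
  by rewrite mulmxDr mulmx1 !mulmxA mulmxV// mul1mx.
by rewrite det_mulmx det_1Douter qformE.
Qed.

(** Hadamard's inequality, by induction through the Schur complement of the top left entry: its
    determinant is the remaining factor, and its diagonal is below that of [C]. Positivity of the
    diagonal is carried along in order to multiply the bounds. *)
Lemma spd_det n (A : 'M[R]_n) : spd A ->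
  0 < \det A <= \prod_i A i i /\ forall i, 0 < A i i.
Proof.
elim: n A => [|n IHn] A sA.
  by rewrite det_mx00 big_ord0 ltr01 lexx; split=> // -[].
have [As Ap] := sA.
change 'M[R]_(1 + n) in A.
have {}Ap : forall v : 'cV[R]_(1 + n), v != 0 -> 0 < qform A v by exact: Ap.
pose a := ulsubmx A ord0 ord0; pose b := dlsubmx A; pose C := drsubmx A.
have Ae : A = block_mx a%:M b^T b C.
  by rewrite -[LHS]submxK -{1}As /b trmx_dlsub; congr block_mx; rewrite ?As -?mx11_scalar.
have qA (r : R) (v : 'cV[R]_n) : qform A (col_mx r%:M v) =
    a * r ^+ 2 + 2 * r * dotp b v + qform C v.
  rewrite qformE {1}Ae mul_block_col -scalar_mxM mul_mx_scalar.
  rewrite [b^T *m v]mx11_scalar -/(dotp b v) -raddfD dotp_col_mx.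
  rewrite dotpDr dotpZr -qformE [dotp v b]dotpC /dotp tr_scalar_mx -scalar_mxM mxE.
  by rewrite mulr1n; ring.
have a0 : 0 < a.
  have := Ap (col_mx (1%:M : 'cV_1) (0 : 'cV_n)); rewrite qA dotp0 qform0 mulr0 !addr0 expr1n mulr1.
  apply; rewrite col_mx_eq0 negb_and; apply/orP; left; apply/eqP => /matrixP/(_ ord0 ord0).
  by rewrite !mxE; apply/eqP; rewrite oner_eq0.
pose S := C - a^-1 *: (b *m b^T).
have CS : C^T = C by rewrite /C -[in LHS]As trmx_drsub trmxK.
have sS : spd S.
  split=> [|v v0]; first by rewrite [LHS]raddfB /= linearZ /= trmx_mul trmxK CS.
  (* This first coordinate minimizes the form of [A] over all extensions of [v]. *)
  have -> : qform S v = qform A (col_mx (- (dotp b v / a))%:M v).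
    rewrite qA !qformE mulmxBl -scalemxAl outer_mul dotpDr dotpNr !dotpZr [dotp v b]dotpC.
    by field; rewrite gt_eqF.
  by apply: Ap; rewrite col_mx_eq0 negb_and v0 orbT.
have dA : \det A = a * \det S.
  have -> : A = block_mx 1%:M 0 (a^-1 *: b) 1%:M *m block_mx a%:M b^T 0 S.
    rewrite mulmx_block !mul1mx !mul0mx !addr0 mul_mx_scalar scalerA.
    by rewrite divff ?gt_eqF// scale1r -scalemxAl addrC subrK -Ae.
  by rewrite det_mulmx det_lblock det_ublock !det1 !mul1r det_scalar1.
have [/andP[S0 SH] Sd] := IHn S sS.
have Aii i : A (rshift 1 i) (rshift 1 i) = C i i.
  by rewrite [LHS](congr1 (fun M : 'M[R]_(1 + n) => M (rshift 1 i) (rshift 1 i)) Ae) block_mxEdr.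
have A00 : A (lshift n ord0) (lshift n ord0) = a.
  by rewrite [LHS](congr1 (fun M : 'M[R]_(1 + n) => M (lshift n ord0) (lshift n ord0)) Ae) block_mxEul mxE.
have SC i : S i i <= C i i.
  rewrite !mxE big_ord1 !mxE gerBl.
  by rewrite mulr_ge0 ?invr_ge0 ?(ltW a0)// -expr2 sqr_ge0.
split.
  rewrite dA mulr_gt0//= (@big_split_ord _ _ _ 1 n) /= big_ord1 A00.
  rewrite ler_wpM2l ?(ltW a0)// (le_trans SH)//.
  by apply: ler_prod => i _; rewrite (ltW (Sd i)) Aii SC.
move=> i; case: (@split_ordP 1 n i) => j ->.
  by rewrite ord1 A00.
by rewrite Aii (lt_le_trans (Sd j)).
Qed.

(** Hadamard's inequality, followed by the arithmetic-geometric mean inequality on the diagonal. *)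
Lemma spd_det_le n (A : 'M[R]_n) (c : R) : (0 < n)%N -> spd A ->
  \tr A <= n%:R * c -> \det A <= c ^+ n.
Proof.
move=> n0 sA Ac; have [/andP[_ AH] Ad] := spd_det sA.
apply: le_trans AH _.
have := @leif_AGM _ _ predT (fun i => A i i) (fun i _ => ltW (Ad i)).
rewrite card_ord => -[+ _] => /le_trans; apply.
rewrite lerXn2r ?nnegrE ?ler_pdivrMr ?ltr0n//.
- by rewrite divr_ge0// sumr_ge0// => i _; rewrite ltW.
- have : 0 <= n%:R * c.
    by apply: le_trans Ac; apply: sumr_ge0 => i _; rewrite ltW.
  by rewrite pmulr_rge0 ?ltr0n.
- by rewrite mulrC.
Qed.

End LinearAlgebra.

(** * Elementary real inequalities *)

Section RealInequalities.
Context {R : realType}.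

Lemma sum_sqr_le I (r : seq I) (u : I -> R) :
  (\sum_(i <- r) u i) ^+ 2 <= (size r)%:R * \sum_(i <- r) u i ^+ 2.
Proof.
elim: r => [|i r IH]; first by rewrite !big_nil expr0n mul0r.
rewrite !big_cons /= -natr1.
move: IH; set S := \sum_(j <- r) u j; set Q := \sum_(j <- r) u j ^+ 2; set n : R := (size r)%:R => IH.
have Q0 : 0 <= Q by rewrite sumr_ge0// => j _; exact: sqr_ge0.
have n0 : 0 <= n by [].
(* Multiplied by n, this follows from the square of n u_i - S and the induction hypothesis. *)
suff : 2 * u i * S <= n * u i ^+ 2 + Q by nra.
have [n00|nN] := eqVneq n 0.
  have -> : S = 0 by apply/eqP; rewrite -sqrf_eq0 eq_le sqr_ge0 andbT; move: IH; rewrite n00 mul0r.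
  by rewrite n00 mul0r add0r mulr0.
have {}n0 : 0 < n by rewrite lt_neqAle eq_sym nN.
rewrite -(ler_pM2l n0); have := sqr_ge0 (n * u i - S); nra.
Qed.

Lemma sum_norm_le_sqrt I (r : seq I) (u : I -> R) :
  \sum_(i <- r) `|u i| <= Num.sqrt (size r)%:R * Num.sqrt (\sum_(i <- r) u i ^+ 2).
Proof.
rewrite -sqrtrM// -[leLHS]ger0_norm ?sumr_ge0// -sqrtr_sqr ler_wsqrtr//.
apply: le_trans (sum_sqr_le _ _) _.
by rewrite ler_wpM2l// ler_sum// => i _; rewrite real_normK ?num_real.
Qed.

Lemma ln_le_subr1 (x : R) : 0 < x -> ln x <= x - 1.
Proof.
by move=> x0; rewrite -ler_expR lnK ?posrE//; apply: le_trans (expR_ge1Dx _); rewrite subrKC.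
Qed.

(** Bernoulli's inequality for a real exponent, in logarithmic form. It moves the squared feature
    bound [Cpsi2] out of the logarithm, so that [iotaT] is free of it. *)
Lemma ln_1DM_le (c x : R) : 1 <= c -> 0 <= x -> ln (1 + c * x) <= c * ln (1 + x).
Proof.
move=> c1 x0; have c0 : 0 < c by lra.
have b0 : 0 < 1 + x by lra.
have z0 : 0 < 1 + c * x by nra.
have h1 : ln ((1 + c * x) / (1 + x)) <= (1 + c * x) / (1 + x) - 1.
  by apply: ln_le_subr1; rewrite divr_gt0.
have h2 : ln (1 / (1 + x)) <= 1 / (1 + x) - 1.
  by apply: ln_le_subr1; rewrite divr_gt0.
move: h1 h2; rewrite !ln_div ?posrE// ln1.
have -> : (1 + c * x) / (1 + x) - 1 = (c - 1) * (1 - 1 / (1 + x)) by field; lra.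
have : 0 <= c - 1 by lra.
move: (1 / (1 + x)) (ln (1 + x)) (ln (1 + c * x)) => a u v; nra.
Qed.

(** Truncating at 1 makes the elliptical potential lemma hold for every regularization, however
    small. *)
Lemma minr1_le_ln (x : R) : 0 <= x -> Num.min 1 x <= 2 * ln (1 + x).
Proof.
move=> x0; have x1 : 0 < 1 + x by lra.
have : ln (1 / (1 + x)) <= 1 / (1 + x) - 1 by apply: ln_le_subr1; rewrite divr_gt0.
rewrite ln_div ?posrE// ln1.
have e : 1 - 1 / (1 + x) = x / (1 + x) by field; lra.
have [x1'|x1'] := leP 1 x => h.
  have : 2^-1 <= x / (1 + x) by rewrite ler_pdivlMr//; lra.
  by lra.
have : x / 2 <= x / (1 + x) by rewrite ler_wpM2l// lef_pV2 ?posrE//; lra.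
by lra.
Qed.

End RealInequalities.

(** * Regularized Gram matrices and the elliptical potential *)

Section GramSeq.
Context {R : realType}.
Variables (n : nat) (l : R) (a : nat -> 'cV[R]_n).
Hypothesis l0 : 0 < l.

Definition gram_seq (t : nat) : 'M[R]_n := l%:M + \sum_(0 <= i < t) a i *m (a i)^T.

Lemma gram_seqS t : gram_seq t.+1 = gram_seq t + a t *m (a t)^T.
Proof. by rewrite /gram_seq big_nat_recr//= addrA. Qed.

Lemma gram_seq0 : gram_seq 0 = l%:M.
Proof. by rewrite /gram_seq big_geq// addr0. Qed.

Lemma gram_seq_spd t : spd (gram_seq t).
Proof.
elim: t => [|t IH]; last by rewrite gram_seqS; exact: spd_addouter.
by rewrite gram_seq0; exact: spd_scalar.
Qed.

(** The elliptical potential: 1 plus it is the ratio of the determinants at t + 1 and at t. *)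
Definition pot (t : nat) : R := qform (invmx (gram_seq t)) (a t).

Lemma pot_ge0 t : 0 <= pot t.
Proof. exact/spd_qform_ge0/spd_invmx/gram_seq_spd. Qed.

Lemma ln_det_gram t :
  ln (\det (gram_seq t) / l ^+ n) = \sum_(0 <= i < t) ln (1 + pot i).
Proof.
have L0 : 0 < l ^+ n by rewrite exprn_gt0.
elim: t => [|t IH].
  by rewrite big_geq// gram_seq0 det_scalar divff ?gt_eqF// ln1.
have [/andP[dt _] _] := spd_det (gram_seq_spd t).
rewrite big_nat_recr//= -IH gram_seqS (det_addouter _ (gram_seq_spd t)) -/(pot t).
rewrite mulrAC lnM ?posrE ?divr_gt0//.
by have := pot_ge0 t; lra.
Qed.

Lemma gram_tr K t : (forall i, (i < t)%N -> dotp (a i) (a i) <= K) ->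
  \tr (gram_seq t) <= n%:R * l + t%:R * K.
Proof.
elim: t => [|t IH] aK.
  by rewrite gram_seq0 mxtrace_scalar mul0r addr0 mulr_natl.
rewrite gram_seqS mxtraceD -natr1 mulrDl mul1r addrA lerD ?IH//.
  by move=> i it; apply: aK; exact: ltnW.
apply: le_trans (aK t (ltnSn t)); rewrite dotpE le_eqVlt; apply/orP; left; apply/eqP.
by apply: eq_bigr => i _; rewrite mxE big_ord1 mxE.
Qed.

Lemma ln_det_gram_le K t : (0 < n)%N -> (forall i, (i < t)%N -> dotp (a i) (a i) <= K) ->
  0 <= K -> ln (\det (gram_seq t) / l ^+ n) <= n%:R * ln (1 + t%:R * K / (n%:R * l)).
Proof.
move=> n0 aK K0; have L0 : 0 < l ^+ n by rewrite exprn_gt0.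
have nR : 0 < n%:R :> R by rewrite ltr0n.
have [/andP[dt _] _] := spd_det (gram_seq_spd t).
have c0 : 0 < 1 + t%:R * K / (n%:R * l).
  by rewrite ltr_pwDl// divr_ge0 ?mulr_ge0 ?(ltW nR) ?(ltW l0).
rewrite mulr_natl -lnXn// ler_ln ?posrE ?divr_gt0 ?exprn_gt0//.
rewrite ler_pdivrMr// -exprMn; apply: spd_det_le => //; first exact: gram_seq_spd.
apply: le_trans (gram_tr aK) _; rewrite le_eqVlt; apply/orP; left; apply/eqP.
by field; rewrite !gt_eqF.
Qed.

(** Every rank-one update decreases the inverse form, which is the case r = 0 of
    [qform_invmx_addouter]. *)
Lemma qform_invmx_gram_le t v : qform (invmx (gram_seq t)) v <= l^-1 * dotp v v.
Proof.
elim: t => [|t IH].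
  by rewrite gram_seq0 invmx_scalar qformE mul_scalar_mx dotpZr.
apply: le_trans IH; rewrite gram_seqS.
have := qform_invmx_addouter (a t) v 0 (gram_seq_spd t).
rewrite scale0r addr0 => ->; have c0 := pot_ge0 t.
rewrite gerDl -/(pot t) mulr0 mul0r expr0n mul0r add0r sub0r mulNr oppr_le0.
by rewrite divr_ge0 ?sqr_ge0//; lra.
Qed.

End GramSeq.

Section Ridge.
Context {R : realType}.
Variables (n : nat) (l : R) (I : eqType) (r : seq I) (f : I -> 'cV[R]_n).
Hypothesis l0 : 0 < l.
Let V := l%:M + \sum_(i <- r) f i *m (f i)^T.
Hypothesis sV : spd V.

Lemma qform_gram v : qform V v = l * dotp v v + \sum_(i <- r) dotp (f i) v ^+ 2.
Proof.
rewrite qformE /V mulmxDl dotpDr mul_scalar_mx dotpZr mulmx_suml dotp_sumr.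
congr (_ + _); apply: eq_bigr => i _.
by rewrite outer_mul dotpZr [dotp v _]dotpC expr2.
Qed.

Lemma dotp_invmx_le u v : `|dotp u (invmx V *m v)| <= wnorm (invmx V) u * wnorm (invmx V) v.
Proof.
rewrite !wnormE -sqrtrM ?spd_qform_ge0//; last exact: spd_invmx.
by rewrite -sqrtr_sqr ler_wsqrtr// spd_CauchySchwarz//; exact: spd_invmx.
Qed.

(** With u = V^-1 z, the form equals z.u = u^T V u, which is at least l |u|^2; the Cauchy-Schwarz
    bound of z.u by |z| |u| turns this into an upper bound. *)
Lemma wnorm_invmx_le z : wnorm (invmx V) z <= Num.sqrt l^-1 * norm2 z.
Proof.
have uV := spd_unitmx sV; set u := invmx V *m z.
rewrite /norm2 !wnormE -sqrtrM ?invr_ge0 ?(ltW l0)// ler_wsqrtr//.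
have qE : qform (invmx V) z = dotp z u by rewrite qformE.
have zE : qform 1%:M z = dotp z z by rewrite qformE mul1mx.
have lu : l * dotp u u <= dotp z u.
  have -> : dotp z u = qform V u by rewrite qformE mulKVmx// dotpC.
  by rewrite qform_gram lerDl sumr_ge0// => i _; exact: sqr_ge0.
have := spd_CauchySchwarz z u (spd_scalar n ltr01).
rewrite mul1mx !(qformE 1%:M) !mul1mx qE => cs.
have q0 : 0 <= dotp z u by rewrite -qE spd_qform_ge0//; exact: spd_invmx.
rewrite ler_pdivlMl//; have := dotp_ge0 z; have := dotp_ge0 u.
have [->|qN] := eqVneq (dotp z u) 0; first by rewrite mulr0.
have {}q0 : 0 < dotp z u by rewrite lt_neqAle eq_sym qN.
move=> u0 z0; rewrite -(ler_pM2r q0) -mulrA -expr2.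
apply: le_trans (ler_wpM2l (ltW l0) cs) _.
by rewrite mulrCA ler_wpM2l.
Qed.

(** The data vector is V z - l z plus a bias part plus a noise part; the three summands on the right
    are the noise, the regularization and the bias. *)
Lemma ridge_error (psi z : 'cV[R]_n) (y e xi : I -> R) (eb Z : R) :
  (forall i, i \in r -> y i = dotp (f i) z + e i + xi i) ->
  (forall i, i \in r -> `|e i| <= eb) ->
  norm2 z <= Z ->
  `|dotp psi (invmx V *m \sum_(i <- r) y i *: f i) - dotp psi z| <=
  wnorm (invmx V) psi * (wnorm (invmx V) (\sum_(i <- r) xi i *: f i)
     + Num.sqrt l * Z + eb * Num.sqrt (size r)%:R).
Proof.
move=> yE eE zZ; have uV := spd_unitmx sV; have sIV := spd_invmx sV.
set ll := wnorm (invmx V) psi.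
have ll0 : 0 <= ll by exact: sqrtr_ge0.
have -> : \sum_(i <- r) y i *: f i = V *m z - l *: z + \sum_(i <- r) e i *: f i
    + \sum_(i <- r) xi i *: f i.
  have -> : V *m z - l *: z = \sum_(i <- r) dotp (f i) z *: f i.
    rewrite /V mulmxDl mul_scalar_mx addrC addKr mulmx_suml.
    by apply: eq_bigr => i _; rewrite outer_mul.
  rewrite -!big_split /= big_seq [RHS]big_seq; apply: eq_bigr => i ir.
  by rewrite yE// !scalerDl.
rewrite !mulmxDr mulKmx// !dotpDr mulmxN dotpNr -scalemxAr dotpZr.
have -> : forall p q u v : R, p - q + u + v - p = v - q + u by move=> *; ring.
have [Is _] := sIV.
rewrite !mulrDr (le_trans (ler_normD _ _))// lerD//.
  rewrite (le_trans (ler_normB _ _))// lerD ?dotp_invmx_le//.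
  rewrite normrM (ger0_norm (ltW l0)).
  apply: le_trans (ler_wpM2l (ltW l0) (dotp_invmx_le _ _)) _.
  rewrite -/ll mulrCA ler_wpM2l//.
  apply: le_trans (ler_wpM2l (ltW l0) (wnorm_invmx_le z)) _.
  rewrite mulrA -{1}(sqr_sqrtr (ltW l0)) sqrtrV ?(ltW l0)// expr2 mulfK.
    by rewrite ler_wpM2l// sqrtr_ge0.
  by rewrite gt_eqF// sqrtr_gt0.
rewrite dotp_mulmxr Is dotp_sumr; set u := invmx V *m psi.
(* The biases are arbitrary, so they are paid for by the sum of |f_i . u|; the squares of these add
   up to at most u^T V u = ll^2, whence the root of the sample size. *)
have hu : \sum_(i <- r) dotp (f i) u ^+ 2 <= ll ^+ 2.
  rewrite /ll wnormE sqr_sqrtr ?spd_qform_ge0//.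
  have -> : qform (invmx V) psi = qform V u by rewrite !qformE mulKVmx// dotpC.
  by rewrite qform_gram lerDr mulr_ge0 ?dotp_ge0// ltW.
have hs : \sum_(i <- r) `|dotp (f i) u| <= Num.sqrt (size r)%:R * ll.
  apply: le_trans (sum_norm_le_sqrt _ _) _; rewrite ler_wpM2l ?sqrtr_ge0//.
  by rewrite -[leRHS]ger0_norm// -sqrtr_sqr ler_wsqrtr.
apply: (@le_trans _ _ (eb * \sum_(i <- r) `|dotp (f i) u|)).
  rewrite mulr_sumr (le_trans (ler_norm_sum _ _ _))// big_seq [leRHS]big_seq ler_sum// => i ir.
  by rewrite dotpZr normrM [dotp u _]dotpC ler_wpM2r// eE.
(* Only an observation shows that [eb] is nonnegative; without any, the sum is empty. *)
have [r0|r0] := eqVneq (size r) 0%N.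
  by rewrite (size0nil r0) big_nil !mulr0 sqrtr0 !mulr0.
rewrite mulrCA ler_wpM2l//; last by rewrite mulrC.
have [i ir] : exists i, i \in r by case: (r) r0 => // i r' _; exists i; rewrite mem_head.
exact: le_trans (eE i ir).
Qed.

End Ridge.

(** * Bounded random variables and sub-sigma-algebras *)

Section BoundedExpectation.
Context {dO : measure_display} {Om : measurableType dO} {R : realType}.
Variable P : probability Om R.

Definition bmeas (f : Om -> R) : Prop :=
  measurable_fun setT f /\ exists C : R, forall w, `|f w| <= C.

Definition mean (f : Om -> R) : R := Rintegral P setT f.

Lemma bmeas_integrable f : bmeas f -> P.-integrable setT (EFin \o f).
Proof.
move=> [mf [C fC]]; apply: measurable_bounded_integrable => //.
  exact: (le_lt_trans (probability_le1 P measurableT) (ltry 1)).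

by exists C; split=> [|x Cx w _]; [exact: num_real|exact: le_trans (fC w) (ltW Cx)].
Qed.

Lemma bmeas_cst c : bmeas (fun=> c).
Proof. by split; [exact: measurable_cst|exists `|c|]. Qed.

Lemma bmeasD f g : bmeas f -> bmeas g -> bmeas (fun w => f w + g w).
Proof.
move=> [mf [C fC]] [mg [K gK]]; split; first exact: measurable_funD.
by exists (C + K) => w; rewrite (le_trans (ler_normD _ _))// lerD.
Qed.

Lemma bmeasM f g : bmeas f -> bmeas g -> bmeas (fun w => f w * g w).
Proof.
move=> [mf [C fC]] [mg [K gK]]; split; first exact: measurable_funM.
by exists (C * K) => w; rewrite normrM ler_pM.
Qed.

Lemma bmeasN f : bmeas f -> bmeas (fun w => - f w).
Proof.
move=> [mf [C fC]]; split; first exact: (measurable_funN mf).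
by exists C => w; rewrite normrN.
Qed.

Lemma bmeasB f g : bmeas f -> bmeas g -> bmeas (fun w => f w - g w).
Proof. by move=> bf bg; apply: bmeasD => //; exact: bmeasN. Qed.

Lemma bmeas_indic A : measurable A -> bmeas (\1_A : Om -> R).
Proof.
move=> mA; split; first exact: measurable_indic.
by exists 1 => w; rewrite indicE; case: (_ \in _); rewrite ?normr1 ?normr0.
Qed.

Lemma bmeas_sum I (r : seq I) (F : I -> Om -> R) :
  (forall i, bmeas (F i)) -> bmeas (fun w => \sum_(i <- r) F i w).
Proof.
move=> bF; elim: r => [|i r IH].
  by under eq_fun do rewrite big_nil; exact: bmeas_cst.
by under eq_fun do rewrite big_cons; apply: bmeasD.
Qed.

Lemma meanD f g : bmeas f -> bmeas g ->
  mean (fun w => f w + g w) = mean f + mean g.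
Proof. by move=> bf bg; rewrite /mean RintegralD//; exact: bmeas_integrable. Qed.

Lemma meanB f g : bmeas f -> bmeas g ->
  mean (fun w => f w - g w) = mean f - mean g.
Proof. by move=> bf bg; rewrite /mean RintegralB//; exact: bmeas_integrable. Qed.

Lemma meanZ c f : bmeas f -> mean (fun w => c * f w) = c * mean f.
Proof. by move=> bf; rewrite /mean RintegralZl//; exact: bmeas_integrable. Qed.

Lemma mean_cst c : mean (fun=> c) = c.
Proof. by rewrite /mean Rintegral_cst// [X in fine X](probability_setT P) mulr1. Qed.

Lemma le_mean f g : bmeas f -> bmeas g -> (forall w, f w <= g w) -> mean f <= mean g.
Proof. by move=> bf bg fg; apply: le_Rintegral => //; exact: bmeas_integrable. Qed.

Lemma mean_sum I (r : seq I) (F : I -> Om -> R) : (forall i, bmeas (F i)) ->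
  mean (fun w => \sum_(i <- r) F i w) = \sum_(i <- r) mean (F i).
Proof.
move=> bF; elim: r => [|i r IH].
  by under eq_fun do rewrite big_nil; rewrite mean_cst big_nil.
under eq_fun do rewrite big_cons; rewrite meanD ?IH ?big_cons//.
exact: bmeas_sum.
Qed.

Lemma mean_norm_le f c : bmeas f -> (forall w, `|f w| <= c) -> `|mean f| <= c.
Proof.
move=> bf fc; rewrite ler_norml -{1}(mean_cst (- c)) -{2}(mean_cst c).
by apply/andP; split; apply: le_mean => //; try exact: bmeas_cst;
   move=> w; have := fc w; rewrite ler_norml => /andP[].
Qed.

Lemma mean_indic A : measurable A -> mean \1_A = fine (P A).
Proof. by move=> mA; rewrite /mean /Rintegral integral_indic// setIT. Qed.

Section SubSigmaAlgebra.
Variable H : set_system Om.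
Hypothesis sH : sigma_algebra setT H.
Hypothesis Hm : forall A, H A -> measurable A.

(** The conditional expectation of [xi] given H vanishes, stated through integrals over the sets of
    H. *)
Definition centered (xi : Om -> R) : Prop :=
  forall A, H A -> mean (fun w => xi w * \1_A w) = 0.

Lemma meas_wrt_measurable (V : Om -> R) : meas_wrt H V -> measurable_fun setT V.
Proof. by move=> HV _ B mB; rewrite setTI; exact: Hm (HV _ mB). Qed.

(* V is approximated within 1/n by a function with finitely many level sets, all
   in H. *)
Lemma centered_mul_ge0 (xi V : Om -> R) (C : R) : bmeas xi -> (forall w, `|xi w| <= 1) ->
  centered xi -> meas_wrt H V -> (forall w, 0 <= V w <= C) ->
  mean (fun w => xi w * V w) = 0.
Proof.
move=> bxi xi1 cxi HV VC.
have mV := meas_wrt_measurable HV.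
have bV : bmeas V.
  by split=> //; exists C => w; have /andP[V0 ?] := VC w; rewrite ger0_norm.
suff H1 n : `|mean (fun w => xi w * V w)| <= n.+1%:R^-1.
  apply/eqP; rewrite -normr_eq0 eq_le normr_ge0 andbT leNgt; apply/negP => m0.
  have := H1 (Num.truncn (`|mean (fun w => xi w * V w)|^-1)).
  rewrite leNgt => /negP; apply.
  by rewrite invf_plt ?posrE ?ltr0n// truncnS_gt.
(* Slices of height 1/(n+1); [K] of them cover [0, C]. *)
pose K := (Num.truncn (n.+1%:R * C)).+1.
pose A (k : nat) := V @^-1` [set` `[k%:R / n.+1%:R, k.+1%:R / n.+1%:R[].
have HA k : H (A k) by apply: HV; exact: measurable_itv.
have bA k : bmeas (\1_(A k) : Om -> R) by apply: bmeas_indic; exact: Hm.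
pose Vn w : R := \sum_(k < K) k%:R / n.+1%:R * \1_(A k) w.
have bVn : bmeas Vn.
  by apply: bmeas_sum => k; apply: bmeasM => //; exact: bmeas_cst.
have VVn w : `|V w - Vn w| <= n.+1%:R^-1.
  have /andP[V0 VC'] := VC w.
  have n0 : 0 < n.+1%:R :> R by rewrite ltr0n.
  have nV0 : 0 <= n.+1%:R * V w by rewrite mulr_ge0// ltW.
  have kK : (Num.truncn (n.+1%:R * V w) < K)%N.
    by rewrite ltnS le_truncn// ler_pM2l.
  have AE k : (w \in A k) = (k == Num.truncn (n.+1%:R * V w)).
    rewrite eq_sym truncn_eq//; apply/idP/idP; rewrite inE /A /= in_itv /=.
      by rewrite ler_pdivrMr// ltr_pdivlMr// ![_ * V w]mulrC.
    by rewrite ler_pdivrMr// ltr_pdivlMr// ![V w * _]mulrC.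
  have -> : Vn w = (Num.truncn (n.+1%:R * V w))%:R / n.+1%:R.
    rewrite /Vn (bigD1 (Ordinal kK))//= indicE AE eqxx mulr1 big1 ?addr0// => k kn.
    by rewrite indicE AE -[X in _ == X]/(nat_of_ord (Ordinal kK)) (inj_eq val_inj) (negbTE kn) mulr0.
  have /andP[t1 t2] := truncn_itv nV0.
  rewrite ger0_norm ?subr_ge0 ?ler_pdivrMr// 1?[V w * _]mulrC//.
  by rewrite lerBlDl -[X in _ + X]mul1r -mulrDl natr1 ler_pdivlMr// mulrC ltW.
have -> : mean (fun w => xi w * V w) = mean (fun w => xi w * (V w - Vn w)).
  have -> : mean (fun w => xi w * (V w - Vn w)) =
            mean (fun w => xi w * V w) - mean (fun w => xi w * Vn w).
    by rewrite -meanB; try exact: bmeasM; congr mean; apply/funext => w; rewrite mulrBr.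
  suff -> : mean (fun w => xi w * Vn w) = 0 by rewrite subr0.
  have -> : (fun w => xi w * Vn w) =
     (fun w => \sum_(k < K) k%:R / n.+1%:R * (xi w * \1_(A k) w)).
    apply/funext => w; rewrite mulr_sumr; apply: eq_bigr => k _; ring.
  rewrite mean_sum => [|k]; last by apply: bmeasM; [exact: bmeas_cst|exact: bmeasM].
  by rewrite big1// => k _; rewrite meanZ ?cxi ?mulr0//; exact: bmeasM.
apply: mean_norm_le; first by apply: bmeasM => //; exact: bmeasB.
by move=> w; rewrite normrM -[leRHS]mul1r ler_pM.
Qed.

(** Adding the bound C makes [V] nonnegative; the added part has mean zero because the whole space
    belongs to H. *)
Lemma centered_mul (xi V : Om -> R) (C : R) : bmeas xi -> (forall w, `|xi w| <= 1) ->
  centered xi -> meas_wrt H V -> (forall w, `|V w| <= C) ->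
  mean (fun w => xi w * V w) = 0.
Proof.
move=> bxi xi1 cxi HV VC.
have bV : bmeas V by split; [exact: meas_wrt_measurable|exists C].
have -> : (fun w => xi w * V w) = (fun w => xi w * (V w + C) - C * (xi w * \1_setT w)).
  by apply/funext => w; rewrite indicT /=; ring.
have bxiT : bmeas (fun w => xi w * \1_setT w) by apply: bmeasM => //; exact: bmeas_indic.
have HT : H setT by case: sH => H0 HC _; rewrite -[setT]setD0; exact: HC.
rewrite meanB.
- rewrite meanZ// cxi// mulr0 subr0; apply: (@centered_mul_ge0 _ _ (C + C)) => //.
    move=> B mB; have := HV ((fun x => x + C) @^-1` B).
    apply; rewrite -[X in measurable X]setTI.
    exact: (measurable_funD (@measurable_id _ _ _) (@measurable_cst _ _ _ _ setT C)).
  by move=> w; have := VC w; rewrite ler_norml => /andP[a b]; apply/andP; split; lra.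
- by apply: bmeasM => //; apply: bmeasD => //; exact: bmeas_cst.
- by apply: bmeasM => //; exact: bmeas_cst.
Qed.

End SubSigmaAlgebra.
End BoundedExpectation.

Section MeasurableWrt.
Context {Om : pointedType} {R : realType}.
Variable H : set_system Om.
Hypothesis sH : sigma_algebra setT H.

Lemma g_sigma_measurableE : (measurable : set (set (g_sigma_algebraType H))) = H.
Proof. exact: sigma_algebra_id. Qed.

End MeasurableWrt.

(** * Ville's maximal inequality for bounded multiplicative increments *)

Section Ville.
Context {dO : measure_display} {Om : measurableType dO} {R : realType}.
Variable P : probability Om R.

(** Reads [meas_wrt] as ordinary measurability over [Om] with H as its sigma-algebra, so that the
    closure properties of measurable functions apply. *)
Lemma meas_wrtE d (E : measurableType d) (H : set_system Om) (f : Om -> E) :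
  sigma_algebra setT H ->
  meas_wrt H f <-> measurable_fun (setT : set (g_sigma_algebraType H)) f.
Proof.
move=> sH; split=> [Hf _ V mV|mf V mV].
  by rewrite setTI g_sigma_measurableE//; exact: Hf.
by have := mf measurableT V mV; rewrite setTI g_sigma_measurableE.
Qed.

Variables (T : nat) (H : nat -> set_system Om) (Z W xi : nat -> Om -> R) (c : R).
Hypothesis c1 : 1 <= c.
Hypothesis sH : forall t, (t < T)%N -> sigma_algebra setT (H t).
Hypothesis Hm : forall t, (t < T)%N -> forall A, H t A -> measurable A.
Hypothesis HS : forall t, (t.+1 < T)%N -> H t `<=` H t.+1.
Hypothesis Z0 : forall w, Z 0%N w = 1.
Hypothesis Zge0 : forall t w, (t <= T)%N -> 0 <= Z t w.
Hypothesis HZ : forall t, (t < T)%N -> meas_wrt (H t) (Z t).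
Hypothesis mZ : measurable_fun setT (Z T).
Hypothesis HW : forall t, (t < T)%N -> meas_wrt (H t) (W t).
Hypothesis W1 : forall t w, (t < T)%N -> `|W t w| <= 1.
Hypothesis bxi : forall t, (t < T)%N -> bmeas (xi t).
Hypothesis xi1 : forall t w, (t < T)%N -> `|xi t w| <= 1.
Hypothesis cxi : forall t, (t < T)%N -> centered P (H t) (xi t).
Hypothesis ZS : forall t w, (t < T)%N -> Z t.+1 w <= Z t w * (1 + xi t w * W t w).

(** The process frozen at its first value that is at least c. One step at most doubles it, so it
    stays below 2 c and every mean is that of a bounded function. *)
Fixpoint stopped (t : nat) (w : Om) : R :=
  if t is u.+1 then if stopped u w < c then Z u.+1 w else stopped u w else Z 0%N w.

Lemma stopped_lt t w : stopped t w < c -> stopped t w = Z t w.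
Proof. by case: t => //= t; case: ifPn => // /negPf ->. Qed.

Lemma stopped_lt_le s t w : (s <= t)%N -> stopped t w < c -> stopped s w < c.
Proof.
move=> /subnK <-; elim: (t - s)%N => // k IH; rewrite addSn /=.
by case: ifPn => [/IH//|_]; exact: IH.
Qed.

Lemma stopped_itv t w : (t <= T)%N -> 0 <= stopped t w <= 2 * c.
Proof.
elim: t => [_|t IH tT] /=; first by have := c1; rewrite Z0 => ?; apply/andP; split; lra.
have tT' := ltnW tT; case: ifPn => [lt|_]; last exact: IH.
rewrite Zge0//= (le_trans (ZS _ tT))// -stopped_lt// mulrC.
have : `|xi t w * W t w| <= 1.
  by rewrite normrM -[leRHS]mulr1 ler_pM// ?xi1// W1.
rewrite ler_norml => /andP[l1 l2].
have /andP[Y0 _] := IH tT'; rewrite ler_pM//; [lra|lra|exact: ltW].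
Qed.

Lemma meas_wrt_sub (G G' : set_system Om) d (E : measurableType d) (f : Om -> E) :
  G `<=` G' -> meas_wrt G f -> meas_wrt G' f.
Proof. by move=> GG Gf V mV; apply: GG; exact: Gf. Qed.

Lemma stopped_meas_wrt t : (t < T)%N -> meas_wrt (H t) (stopped t).
Proof.
elim: t => [|t IH] tT; first exact: HZ.
have tT' := ltnW tT; have sHt := sH tT.
apply/(meas_wrtE _ sHt).
have /(meas_wrt_sub (HS tT))/(meas_wrtE _ sHt) mY := IH tT'.
apply: measurable_fun_ifT => //.
- by apply: measurable_fun_ltr => //; exact: measurable_cst.
- by apply/meas_wrtE => //; exact: HZ.
Qed.

Lemma stopped_measurable t : (t <= T)%N -> measurable_fun setT (stopped t).
Proof.
have lt u : (u < T)%N -> measurable_fun setT (stopped u).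
  by move=> uT; apply: (meas_wrt_measurable (@Hm u uT)); exact: stopped_meas_wrt.
rewrite leq_eqVlt => /predU1P[->|]; last exact: lt.
case ET : T => [|u] /=; first by rewrite -ET.
have mu : measurable_fun setT (stopped u) by apply: lt; rewrite ET.
apply: measurable_fun_ifT => //; last by rewrite -ET.
by apply: measurable_fun_ltr => //; exact: measurable_cst.
Qed.

Lemma stopped_bmeas t : (t <= T)%N -> bmeas (stopped t).
Proof.
move=> tT; split; first exact: stopped_measurable.
by exists (2 * c) => w; have /andP[a b] := stopped_itv w tT; rewrite ger0_norm.
Qed.

Lemma mean_stoppedS t : (t < T)%N -> mean P (stopped t.+1) <= mean P (stopped t).
Proof.
move=> tT; have bYt := stopped_bmeas (ltnW tT); have bxit := bxi tT.
(* The increment is at most xi V. This [V] is known at time t, bounded by c, and zero once the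
   process is frozen, so centering kills the mean of xi V. *)
pose V w := W t w * (stopped t w * (stopped t w < c)%R%:R).
have HV : meas_wrt (H t) V.
  have sHt := sH tT; have /(meas_wrtE _ sHt) mY := stopped_meas_wrt tT.
  apply/(meas_wrtE _ sHt); apply: measurable_funM.
    by apply/meas_wrtE => //; exact: HW.
  have -> : (fun w => stopped t w * (stopped t w < c)%R%:R) =
      (fun w => if stopped t w < c then stopped t w else 0).
    by apply/funext => w; case: ifP; rewrite ?mulr1 ?mulr0.
  apply: measurable_fun_ifT => //.
  by apply: measurable_fun_ltr => //; exact: measurable_cst.
have VC w : `|V w| <= c.
  have /andP[Y0 _] := stopped_itv w (ltnW tT).
  rewrite /V normrM -[leRHS]mul1r ler_pM ?W1//.
  rewrite normrM ger0_norm//.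
  by have := c1; case: ltP; rewrite ?normr1 ?mulr1 ?normr0 ?mulr0//; lra.
have bV : bmeas V by split; [exact: (meas_wrt_measurable (@Hm t tT))|exists c].
have bxV : bmeas (fun w => xi t w * V w) by exact: bmeasM.
apply: (@le_trans _ _ (mean P (fun w => stopped t w + xi t w * V w))).
  apply: le_mean; [exact: stopped_bmeas|exact: bmeasD|] => w /=.
  case: ifPn => [lt|/negPf lt]; last by rewrite /V lt !mulr0 addr0.
  apply: le_trans (ZS w tT) _; rewrite -stopped_lt// /V lt mulr1.
  by rewrite le_eqVlt; apply/orP; left; apply/eqP; ring.
rewrite meanD// (@centered_mul _ _ _ P (H t) (sH tT) (Hm tT) _ _ c) ?addr0//.
- by move=> w; exact: xi1.
- exact: cxi.
Qed.

Lemma mean_stopped_le1 t : (t <= T)%N -> mean P (stopped t) <= 1.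
Proof.
elim: t => [_|t IH tT]; last exact: le_trans (mean_stoppedS tT) (IH (ltnW tT)).
by rewrite [stopped 0](_ : _ = fun=> 1) ?mean_cst//; apply/funext => w; exact: Z0.
Qed.

(** Freezing remembers a crossing: if the stopped process is below c at time T, no earlier value
    reached c. Hence Markov's inequality at the single time T suffices. *)
Lemma maximal_inequality :
  exists E, [/\ measurable E, ((1 - c^-1)%:E <= P E)%E &
    forall w, E w -> forall t, (t <= T)%N -> Z t w < c].
Proof.
have c0 : 0 < c by exact: lt_le_trans c1.
have mY := stopped_measurable (leqnn T).
pose E := [set w | stopped T w < c].
have mE : measurable E.
  have := @measurable_fun_ltr _ _ _ _ _ _ mY (@measurable_cst _ _ _ _ setT c).
  move=> /(_ measurableT [set true]); rewrite setTI; apply => //.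
exists E; split=> //; last first.
  move=> w Ew t tT; have := stopped_lt_le tT Ew => lt.
  by rewrite -stopped_lt.
have PN : fine (P (~` E)) <= c^-1.
  rewrite -(ler_pM2l c0) divff ?gt_eqF//.
  apply: le_trans (mean_stopped_le1 (leqnn T)).
  rewrite -mean_indic; last exact: measurableC.
  rewrite -meanZ; last by apply: bmeas_indic; exact: measurableC.
  apply: le_mean; [|exact: stopped_bmeas|].
    by apply: bmeasM; [exact: bmeas_cst|apply: bmeas_indic; exact: measurableC].
  move=> w; have /andP[Y0 _] := stopped_itv w (leqnn T).
  rewrite indicE; case: (boolP (w \in ~` E)); rewrite ?mulr1 ?mulr0// inE /E /= => /negP.
  by rewrite -leNgt.
have := probability_setC P mE; rewrite -[P (~` E)]fineK ?fin_num_measure//; last first.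
  exact: measurableC.
have fE : P E \is a fin_num by exact: fin_num_measure.
rewrite -(fineK fE) -EFinB lee_fin => -[]; lra.
Qed.

End Ville.

(** * Measurability of matrix expressions *)

Section MatrixMeasurability.
Context {d : measure_display} {Om : measurableType d} {R : realType}.

Definition mx_meas p q (M : Om -> 'M[R]_(p, q)) : Prop :=
  forall i j, measurable_fun setT (fun w => M w i j).

Lemma mx_meas_cst p q (A : 'M[R]_(p, q)) : mx_meas (fun=> A).
Proof. by move=> i j; exact: measurable_cst. Qed.

Lemma mx_measD p q (M N : Om -> 'M[R]_(p, q)) :
  mx_meas M -> mx_meas N -> mx_meas (fun w => M w + N w).
Proof.
by move=> mM mN i j; under eq_fun do rewrite mxE; exact: measurable_funD.
Qed.

Lemma mx_measZ p q (f : Om -> R) (M : Om -> 'M[R]_(p, q)) :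
  measurable_fun setT f -> mx_meas M -> mx_meas (fun w => f w *: M w).
Proof.
by move=> mf mM i j; under eq_fun do rewrite mxE; exact: measurable_funM.
Qed.

Lemma mx_meas_tr p q (M : Om -> 'M[R]_(p, q)) : mx_meas M -> mx_meas (fun w => (M w)^T).
Proof. by move=> mM i j; under eq_fun do rewrite mxE; exact: mM. Qed.

Lemma mx_measM p q r (M : Om -> 'M[R]_(p, q)) (N : Om -> 'M[R]_(q, r)) :
  mx_meas M -> mx_meas N -> mx_meas (fun w => M w *m N w).
Proof.
move=> mM mN i j; under eq_fun do rewrite mxE.
by apply: measurable_sum => k; exact: measurable_funM.
Qed.

Lemma mx_meas_sum I (r : seq I) p q (M : I -> Om -> 'M[R]_(p, q)) :
  (forall i, mx_meas (M i)) -> mx_meas (fun w => \sum_(i <- r) M i w).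
Proof.
move=> mM i j; under eq_fun do rewrite summxE.
by apply: measurable_sum => k; exact: mM.
Qed.

Lemma mx_meas_if p q (b : Om -> bool) (M N : Om -> 'M[R]_(p, q)) :
  measurable_fun setT b -> mx_meas M -> mx_meas N ->
  mx_meas (fun w => if b w then M w else N w).
Proof.
move=> mb mM mN i j.
rewrite (_ : (fun w => _) = (fun w => if b w then M w i j else N w i j)).
  exact: measurable_fun_ifT.
by apply/funext => w; case: ifP.
Qed.

Lemma measurable_det p (M : Om -> 'M[R]_p) :
  mx_meas M -> measurable_fun setT (fun w => \det (M w)).
Proof.
move=> mM; apply: measurable_sum => s; apply: measurable_funM.
  exact: measurable_cst.
by apply: measurable_prod => i _; exact: mM.
Qed.

Lemma mx_meas_invmx p (M : Om -> 'M[R]_p) : mx_meas M -> (forall w, spd (M w)) ->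
  mx_meas (fun w => invmx (M w)).
Proof.
move=> mM sM.
have detp w : 0 < \det (M w) by have [/andP[]] := spd_det (sM w).
(* Adjugate over determinant: the entries are polynomials, and the positive determinant can be
   inverted by a measurable real power. *)
rewrite (_ : (fun w => _) = (fun w => \det (M w) `^ (- 1) *: \adj (M w))).
  apply: mx_measZ.
    exact: (measurableT_comp (measurable_powR _) (measurable_det mM)).
  move=> i j; under eq_fun do rewrite mxE /cofactor.
  apply: measurable_funM; first exact: measurable_cst.
  apply: measurable_det => k l; under eq_fun do rewrite !mxE; exact: mM.
apply/funext => w; rewrite /invmx (spd_unitmx (sM w)).
by rewrite powR_inv1// ltW.
Qed.

Lemma measurable_dotp p (x y : Om -> 'cV[R]_p) : mx_meas x -> mx_meas y ->
  measurable_fun setT (fun w => dotp (x w) (y w)).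
Proof. by move=> mx my; exact: (mx_measM (mx_meas_tr mx) my ord0 ord0). Qed.

Lemma measurable_qform p (M : Om -> 'M[R]_p) (x : Om -> 'cV[R]_p) :
  mx_meas M -> mx_meas x -> measurable_fun setT (fun w => qform (M w) (x w)).
Proof.
by move=> mM mx; apply: (mx_measM (mx_measM (mx_meas_tr mx) mM) mx ord0 ord0).
Qed.

Lemma measurable_sqrtr (f : Om -> R) : measurable_fun setT f -> measurable_fun setT (fun w => Num.sqrt (f w)).
Proof.
move=> mf.
exact: (measurableT_comp (continuous_measurable_fun (@sqrt_continuous R)) mf).
Qed.

Lemma measurable_wnorm p (M : Om -> 'M[R]_p) (x : Om -> 'cV[R]_p) :
  mx_meas M -> mx_meas x -> measurable_fun setT (fun w => wnorm (M w) (x w)).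
Proof. by move=> mM mx; apply: measurable_sqrtr; exact: measurable_qform. Qed.

End MatrixMeasurability.

(** * The self-normalized inequality *)

Section HyperbolicBounds.
Context {R : realType}.
Implicit Types x A c xi : R.

Definition coshR x : R := (expR x + expR (- x)) / 2.
Definition sinhR x : R := (expR x - expR (- x)) / 2.

Lemma is_derive_coshR x : is_derive x 1 coshR (sinhR x).
Proof.
rewrite /coshR /sinhR; apply: is_derive_eq.
by rewrite /GRing.scale /=; ring.
Qed.

Lemma is_derive_sinhR x : is_derive x 1 sinhR (coshR x).
Proof.
rewrite /coshR /sinhR; apply: is_derive_eq.
by rewrite /GRing.scale /=; ring.
Qed.

Lemma coshR_nd c x : 0 <= c -> c <= x -> coshR c <= coshR x.
Proof.
move=> c0 cx; rewrite ler_pM2r ?invr_gt0// -subr_ge0.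
have -> : expR x + expR (- x) - (expR c + expR (- c)) =
    (expR x - expR c) * (1 - expR (- (c + x))).
  have -> : expR (- (c + x)) = expR (- c) * expR (- x) by rewrite opprD expRD.
  have := expRxMexpNx_1 x; have := expRxMexpNx_1 c; move: (expR x) (expR (-x)) (expR c) (expR (-c)).
  move=> a b e f ef ab.
  have -> : (a - e) * (1 - f * b) = a - e - f * (a * b) + e * f * b by ring.
  by rewrite ab ef; ring.
by rewrite mulr_ge0// subr_ge0 ?ler_expR// expR_le1; lra.
Qed.

Lemma sinhR_le x : 0 <= x -> sinhR x <= x * coshR x.
Proof.
rewrite le_eqVlt => /predU1P[<-|x0]; first by rewrite mul0r /sinhR oppr0 subrr mul0r.
have [|c cx] := @MVT R sinhR coshR 0 x x0 (fun c _ => is_derive_sinhR c).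
  by apply: derivable_within_continuous => c _; apply: ex_derive; exact: is_derive_sinhR.
rewrite /sinhR oppr0 subrr mul0r -/(sinhR x) !subr0 => ->.
move: cx; rewrite in_itv /= => /andP[/ltW c0 /ltW cx].
rewrite addr0 [leLHS]mulrC; apply: ler_wpM2l; [exact: ltW|exact: coshR_nd].
Qed.

(** The sub-Gaussian bound for a random sign. The derivative of exp(-x^2/2) cosh x has the sign of
    sinh x - x cosh x, which is nonpositive for x >= 0. *)
Lemma coshR_le_expR x : coshR x <= expR (x ^+ 2 / 2).
Proof.
wlog x0 : x / 0 <= x => [H|].
  have [/H//|/ltW x0] := leP 0 x.
  have := H (- x); rewrite oppr_ge0 => /(_ x0).
  by rewrite /coshR opprK addrC sqrrN.
have dphi c : is_derive c 1 (fun x => expR (- (x ^+ 2 / 2)) * coshR x)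
    (expR (- (c ^+ 2 / 2)) * (sinhR c - c * coshR c)).
  have := is_derive_coshR c => dc.
  by apply: is_derive_eq; rewrite /GRing.scale /=; field.
suff : expR (- (x ^+ 2 / 2)) * coshR x <= 1.
  by rewrite expRN mulrC ler_pdivrMr ?expR_gt0// mul1r.
have [->|xn0] := eqVneq x 0.
  by rewrite /coshR expr0n /= mul0r !oppr0 expR0; lra.
have {}x0 : 0 < x by rewrite lt_neqAle eq_sym xn0.
have [|c cx] := MVT x0 (fun c _ => dphi c).
  by apply: derivable_within_continuous => c _; apply: ex_derive; exact: dphi.
move: cx; rewrite in_itv /= => /andP[/ltW c0 _].
have -> : expR (- (0 ^+ 2 / 2)) * coshR 0 = 1 :> R.
  by rewrite /coshR expr0n /= mul0r !oppr0 expR0; lra.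
rewrite subr0 => e.
suff : expR (- (c ^+ 2 / 2)) * (sinhR c - c * coshR c) * x <= 0 by rewrite -e; lra.
rewrite mulr_le0_ge0 ?(ltW x0)// mulr_ge0_le0 ?expR_ge0// subr_le0.
exact: sinhR_le.
Qed.

(** The exponential lies below its chord over [-A, A]: average the tangent inequality at A xi,
    evaluated at -A and A, with weights (1 - xi)/2 and (1 + xi)/2. *)
Lemma expR_chord A xi : `|xi| <= 1 -> expR (A * xi) <= coshR A + xi * sinhR A.
Proof.
rewrite ler_norml => /andP[l u].
have tangent y : expR (A * xi) * (1 + (y - A * xi)) <= expR y.
  by rewrite -[in leRHS](subrKC (A * xi) y) expRD ler_pM2l ?expR_gt0// expR_ge1Dx.
have := ler_wpM2l (_ : 0 <= (1 + xi) / 2) (tangent A).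
have := ler_wpM2l (_ : 0 <= (1 - xi) / 2) (tangent (- A)).
rewrite /coshR /sinhR => /(_ ltac:(lra)) h1 /(_ ltac:(lra)) h2.
have := lerD h1 h2; set e := expR (A * xi).
have -> : (1 - xi) / 2 * (e * (1 + (- A - A * xi))) + (1 + xi) / 2 * (e * (1 + (A - A * xi))) = e.
  by field.
move=> /le_trans; apply; rewrite le_eqVlt; apply/orP; left; apply/eqP; by field.
Qed.

(** After squaring this is ln (1 + c) >= c / (1 + c): the growth of the determinant pays for the
    quadratic term of the exponent. *)
Lemma expR_sqrt_bound c : 0 <= c -> expR (c / (1 + c) / 2) <= Num.sqrt (1 + c).
Proof.
move=> c0; have c1 : 0 < 1 + c by lra.
rewrite -(@ler_pXn2r _ 2)// ?nnegrE ?expR_ge0 ?sqrtr_ge0//.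
rewrite sqr_sqrtr ?(ltW c1)// -expRM_natr divfK//.
rewrite -[leRHS]invrK -[expR _]invrK lef_pV2 ?posrE ?invr_gt0 ?expR_gt0//.
rewrite -expRN; apply: le_trans (expR_ge1Dx _).
rewrite le_eqVlt; apply/orP; left; apply/eqP; field; lra.
Qed.

(** Keeps the factor of one step, 1 + xi W, between 0 and 2, as the stopped process needs. *)
Lemma sinhR_weight_le1 A : `|expR (- (A ^+ 2 / 2)) * sinhR A| <= 1.
Proof.
rewrite normrM ger0_norm ?expR_ge0// expRN mulrC ler_pdivrMr ?expR_gt0// mul1r.
apply: le_trans (coshR_le_expR A).
rewrite /sinhR /coshR normrM [`|2^-1|]ger0_norm// ler_pM2r ?invr_gt0// ler_norml.
by have := expR_ge0 A; have := expR_ge0 (- A); move=> ? ?; apply/andP; split; lra.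
Qed.

(* The exponent that a new observation [xi] adds to the self-normalized process;
   [|xi| <= 1] lets one bound [xi ^+ 2] by [1], so no Gaussian mixture is needed. *)
Lemma self_normalized_factor a c xi : 0 <= c -> `|xi| <= 1 ->
  expR ((2 * xi * a + xi ^+ 2 * c - a ^+ 2) / (1 + c) / 2) / Num.sqrt (1 + c) <=
  1 + xi * (expR (- ((a / (1 + c)) ^+ 2 / 2)) * sinhR (a / (1 + c))).
Proof.
move=> c0 xi1; have c1 : 0 < 1 + c by lra.
have xi2 : xi ^+ 2 <= 1 by rewrite -real_normK ?num_real// expr_le1.
set A := a / (1 + c).
have s0 : 0 < Num.sqrt (1 + c) by rewrite sqrtr_gt0.
rewrite ler_pdivrMr//.
apply: (@le_trans _ _ (expR (c / (1 + c) / 2) * (expR (- (A ^+ 2 / 2)) * expR (A * xi)))).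
  rewrite -!expRD ler_expR.
  have -> : a = A * (1 + c) by rewrite /A divfK// gt_eqF.
  have -> : (2 * xi * (A * (1 + c)) + xi ^+ 2 * c - (A * (1 + c)) ^+ 2) / (1 + c) / 2 =
     xi ^+ 2 * (c / (1 + c) / 2) + A * xi - A ^+ 2 / 2 - A ^+ 2 * c / 2 by field; lra.
  have : 0 <= A ^+ 2 * c by rewrite mulr_ge0// sqr_ge0.
  have : xi ^+ 2 * (c / (1 + c) / 2) <= c / (1 + c) / 2.
    by rewrite ler_piMl// !divr_ge0// ltW.
  lra.
rewrite mulrC ler_pM ?expR_ge0 ?mulr_ge0 ?expR_ge0 ?expR_sqrt_bound//.
apply: le_trans (_ : expR (- (A ^+ 2 / 2)) * (coshR A + xi * sinhR A) <= _).
  by rewrite ler_pM2l ?expR_gt0// expR_chord.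
rewrite mulrDr lerD//; last by rewrite mulrCA.
by rewrite expRN mulrC ler_pdivrMr ?expR_gt0// mul1r coshR_le_expR.
Qed.

End HyperbolicBounds.

Section SelfNormalizedStep.
Context {R : realType}.
Variable n : nat.
Implicit Types (V : 'M[R]_n) (s x : 'cV[R]_n).

Definition sn_value (L : R) V s : R :=
  expR (qform (invmx V) s / 2) / Num.sqrt (\det V / L).

Definition sn_shift V s x : R := dotp x (invmx V *m s) / (1 + qform (invmx V) x).

Definition sn_weight V s x : R :=
  expR (- (sn_shift V s x ^+ 2 / 2)) * sinhR (sn_shift V s x).

Lemma sn_value_step (L : R) V s x xi : 0 < L -> spd V -> `|xi| <= 1 ->
  sn_value L (V + x *m x^T) (s + xi *: x) <= sn_value L V s * (1 + xi * sn_weight V s x).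
Proof.
move=> L0 sV xi1; have c0 := spd_qform_ge0 x (spd_invmx sV).
have [/andP[detV _] _] := spd_det sV.
rewrite /sn_value det_addouter// qform_invmx_addouter//.
move: (self_normalized_factor (dotp x (invmx V *m s)) c0 xi1).
rewrite -/(sn_shift V s x) -/(sn_weight V s x).
set u := 1 + qform _ _; set e := (_ - _) / u; set W := 1 + xi * _ => H.
have d0 : 0 <= \det V / L by rewrite divr_ge0// ltW.
rewrite [\det V * u / L]mulrAC sqrtrM// invfM mulrDl expRD mulrACA.
by rewrite ler_wpM2l// divr_ge0 ?expR_ge0 ?sqrtr_ge0.
Qed.

Lemma sn_value_lt (L c : R) V s : 0 < L -> 0 < c -> spd V -> sn_value L V s < c ->
  qform (invmx V) s <= 2 * ln c + ln (\det V / L).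
Proof.
move=> L0 c0 sV; have [/andP[detV _] _] := spd_det sV.
have r0 : 0 < \det V / L by rewrite divr_gt0.
rewrite /sn_value ltr_pdivrMr ?sqrtr_gt0// => lt.
have : expR (qform (invmx V) s) <= c ^+ 2 * (\det V / L).
  rewrite -(sqr_sqrtr (ltW r0)) -exprMn.
  have -> : expR (qform (invmx V) s) = expR (qform (invmx V) s / 2) ^+ 2.
    by rewrite -expRM_natr divfK.
  by rewrite ler_pXn2r ?nnegrE ?expR_ge0 ?mulr_ge0 ?sqrtr_ge0 ?ltW.
have c2 : 0 < c ^+ 2 by rewrite exprn_gt0.
have c2r := mulr_gt0 c2 r0.
rewrite -ler_ln ?posrE ?expR_gt0//.
by rewrite expRK lnM ?posrE ?exprn_gt0// lnXn// mulr_natl.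
Qed.

End SelfNormalizedStep.

Section SelfNormalizedBound.
Context {dO : measure_display} {Om : measurableType dO} {R : realType}.
Variable P : probability Om R.
Variables (T n : nat) (H : nat -> set_system Om) (a : nat -> Om -> 'cV[R]_n)
  (xi : nat -> Om -> R) (l c : R).
Hypothesis l0 : 0 < l.
Hypothesis c1 : 1 <= c.
Hypothesis sH : forall t, (t < T)%N -> sigma_algebra setT (H t).
Hypothesis Hm : forall t, (t < T)%N -> forall A, H t A -> measurable A.
Hypothesis HS : forall t, (t.+1 < T)%N -> H t `<=` H t.+1.
Hypothesis Ha : forall t i, (t < T)%N -> meas_wrt (H t) (fun w => a t w i ord0).
Hypothesis Hxi : forall t, (t.+1 < T)%N -> meas_wrt (H t.+1) (xi t).
Hypothesis mxi : forall t, (t < T)%N -> measurable_fun setT (xi t).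
Hypothesis xi1 : forall t w, (t < T)%N -> `|xi t w| <= 1.
Hypothesis cxi : forall t, (t < T)%N -> centered P (H t) (xi t).

Definition sn_gram (t : nat) (w : Om) : 'M[R]_n :=
  l%:M + \sum_(0 <= i < t) a i w *m (a i w)^T.

Definition sn_sum (t : nat) (w : Om) : 'cV[R]_n := \sum_(0 <= i < t) xi i w *: a i w.

Lemma sn_gramS t w : sn_gram t.+1 w = sn_gram t w + a t w *m (a t w)^T.
Proof. by rewrite /sn_gram big_nat_recr//= addrA. Qed.

Lemma sn_sumS t w : sn_sum t.+1 w = sn_sum t w + xi t w *: a t w.
Proof. by rewrite /sn_sum big_nat_recr. Qed.

Lemma sn_gram_spd t w : spd (sn_gram t w).
Proof.
elim: t => [|t IH]; last by rewrite sn_gramS; exact: spd_addouter.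
by rewrite /sn_gram big_geq// addr0; exact: spd_scalar.
Qed.

Lemma H_le s t : (t < T)%N -> (s <= t)%N -> H s `<=` H t.
Proof.
move=> tT; elim: t tT => [|t IH] tT; first by rewrite leqn0 => /eqP ->.
rewrite leq_eqVlt => /predU1P[->//|]; rewrite ltnS => /(IH (ltnW tT)) st.
by apply: subset_trans st _; exact: HS.
Qed.

Lemma mx_meas_wrt p q G (M : Om -> 'M[R]_(p, q)) : sigma_algebra setT G ->
  (forall i j, meas_wrt G (fun w => M w i j)) <-> @mx_meas _ (g_sigma_algebraType G) R p q M.
Proof.
by move=> sG; split=> GM i j; [apply/(meas_wrtE _ sG)|apply/(meas_wrtE _ sG)]; exact: GM.
Qed.

Lemma big_nat_ord (V : nmodType) t (F : nat -> V) :
  \sum_(0 <= i < t) F i = \sum_(i <- index_enum 'I_t) F (val i).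
Proof. exact: big_mkord. Qed.

Section Generic.
Context {d : measure_display} {Om' : measurableType d} (f : Om' -> Om).

(** Below, [f] is the identity, read either from [Om] with its own sigma-algebra or from [Om] with
    [H t]: one proof serves ambient measurability and predictability. *)
Lemma mx_meas_sn_gram t : (forall i, (i < t)%N -> mx_meas (a i \o f)) ->
  mx_meas (sn_gram t \o f).
Proof.
move=> ma; apply: mx_measD; first exact: mx_meas_cst.
under eq_fun do rewrite big_nat_ord.
apply: mx_meas_sum => i; have mi := ma _ (ltn_ord i).
by apply: (mx_measM mi); exact: mx_meas_tr mi.
Qed.

Lemma mx_meas_sn_sum t : (forall i, (i < t)%N -> mx_meas (a i \o f)) ->
  (forall i, (i < t)%N -> measurable_fun setT (xi i \o f)) -> mx_meas (sn_sum t \o f).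
Proof.
move=> ma mx; rewrite /comp /sn_sum; under eq_fun do rewrite big_nat_ord.
apply: mx_meas_sum => i.
exact: (mx_measZ (mx _ (ltn_ord i)) (ma _ (ltn_ord i))).
Qed.

Lemma measurable_inv_pos (g : Om' -> R) : measurable_fun setT g -> (forall w, 0 < g w) ->
  measurable_fun setT (fun w => (g w)^-1).
Proof.
move=> mg g0; rewrite (_ : (fun w => _) = (fun w => g w `^ (- 1))).
  exact: (measurableT_comp (measurable_powR _) mg).
by apply/funext => w; rewrite powR_inv1// ltW.
Qed.

Lemma measurable_sn_value t : (forall i, (i < t)%N -> mx_meas (a i \o f)) ->
  (forall i, (i < t)%N -> measurable_fun setT (xi i \o f)) ->
  measurable_fun setT (fun w => sn_value (l ^+ n) (sn_gram t (f w)) (sn_sum t (f w))).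
Proof.
move=> ma mx; have mV := mx_meas_sn_gram ma; have ms := mx_meas_sn_sum ma mx.
apply: measurable_funM.
  apply: (measurableT_comp (@measurable_expR R)).
  apply: measurable_funM; last exact: measurable_cst.
  apply: measurable_qform ms; apply: mx_meas_invmx mV _ => w; exact: sn_gram_spd.
apply: measurable_inv_pos.
  apply: measurable_sqrtr; apply: measurable_funM; last exact: measurable_cst.
  exact: measurable_det.
move=> w; rewrite sqrtr_gt0 divr_gt0 ?exprn_gt0//.
by have [/andP[]] := spd_det (sn_gram_spd t (f w)).
Qed.

Lemma measurable_sn_weight t : (forall i, (i <= t)%N -> mx_meas (a i \o f)) ->
  (forall i, (i < t)%N -> measurable_fun setT (xi i \o f)) ->
  measurable_fun setT (fun w => sn_weight (sn_gram t (f w)) (sn_sum t (f w)) (a t (f w))).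
Proof.
move=> ma mx; have ma' i : (i < t)%N -> mx_meas (a i \o f) by move=> /ltnW; exact: ma.
have mV := mx_meas_sn_gram ma'; have ms := mx_meas_sn_sum ma' mx.
have miV : mx_meas (fun w => invmx (sn_gram t (f w))).
  by apply: mx_meas_invmx mV _ => w; exact: sn_gram_spd.
have mat := ma t (leqnn t).
have mA : measurable_fun setT (fun w => sn_shift (sn_gram t (f w)) (sn_sum t (f w)) (a t (f w))).
  apply: measurable_funM; first by apply: measurable_dotp => //; exact: mx_measM.
  apply: measurable_inv_pos.
    by apply: measurable_funD; [exact: measurable_cst|exact: measurable_qform].
  by move=> w; rewrite ltr_pwDl// spd_qform_ge0//; apply: spd_invmx; exact: sn_gram_spd.
have mE (g : Om' -> R) : measurable_fun setT g -> measurable_fun setT (fun w : Om' => expR (g w)).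
  by move=> mg; exact: (measurableT_comp (@measurable_expR R)).
apply: measurable_funM.
  apply: mE.
  have m2 := measurable_funM (measurable_funX 2 mA) (@measurable_cst _ _ _ _ setT (2^-1 : R)).
  exact: (measurable_funN m2).
apply: measurable_funM; last exact: measurable_cst.
by apply: measurable_funB; apply: mE => //; exact: (measurable_funN mA).
Qed.

End Generic.

(** The direction of round t is known in [H t], its noise only in [H t.+1]; hence the value and the
    weight at time t are predictable, and Ville's inequality covers all t at once. *)
Theorem self_normalized_bound : exists E, [/\ measurable E, ((1 - c^-1)%:E <= P E)%E &
  forall w, E w -> forall t, (t <= T)%N ->
    qform (invmx (sn_gram t w)) (sn_sum t w) <=
    2 * ln c + ln (\det (sn_gram t w) / l ^+ n)].
Proof.
have L0 : 0 < l ^+ n by rewrite exprn_gt0.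
have ma t i : (t < T)%N -> (i <= t)%N -> @mx_meas _ (g_sigma_algebraType (H t)) R _ _ (a i).
  move=> tT it; apply/mx_meas_wrt => [|k j]; first exact: sH.
  by rewrite ord1; apply: meas_wrt_sub (H_le tT it) _; apply: Ha; exact: leq_ltn_trans tT.
have mx t i : (t < T)%N -> (i < t)%N -> measurable_fun (setT : set (g_sigma_algebraType (H t))) (xi i).
  move=> tT it; apply/(meas_wrtE _ (sH tT)).
  by apply: meas_wrt_sub (H_le tT it) _; apply: Hxi; exact: leq_ltn_trans tT.
have mx' i : (i < T)%N -> measurable_fun setT (xi i) by exact: mxi.
have ma' i : (i < T)%N -> mx_meas (a i).
  move=> iT k j; rewrite ord1; apply: (meas_wrt_measurable (@Hm i iT)); exact: Ha.
have [||||||||||E [mE PE EZ]] := @maximal_inequality _ _ _ P T H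
  (fun t w => sn_value (l ^+ n) (sn_gram t w) (sn_sum t w))
  (fun t w => sn_weight (sn_gram t w) (sn_sum t w) (a t w)) xi c c1 sH Hm HS.
- move=> w; rewrite /sn_value /sn_sum big_geq// qform0 mul0r expR0.
  by rewrite /sn_gram big_geq// addr0 det_scalar divff ?gt_eqF// sqrtr1 invr1 mulr1.
- by move=> t w _; rewrite divr_ge0 ?expR_ge0 ?sqrtr_ge0.
- move=> t tT; apply/(meas_wrtE _ (sH tT)); apply: (@measurable_sn_value _ (g_sigma_algebraType (H t)) id t).
    by move=> i /ltnW it; exact: ma.
  by move=> i it; exact: mx tT it.
- by apply: (@measurable_sn_value _ _ id) => i iT; [exact: ma'|exact: mx'].
- move=> t tT; apply/(meas_wrtE _ (sH tT)); apply: (@measurable_sn_weight _ (g_sigma_algebraType (H t)) id t).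
    by move=> i it; exact: ma.
  by move=> i it; exact: mx tT it.
- by move=> t w tT; exact: sinhR_weight_le1.
- by move=> t tT; split; [exact: mxi|exists 1 => w; exact: xi1].
- exact: xi1.
- exact: cxi.
- move=> t w tT; rewrite sn_gramS sn_sumS; apply: sn_value_step => //.
    exact: sn_gram_spd.
  exact: xi1.
exists E; split=> // w Ew t tT.
have c0 : 0 < c by exact: lt_le_trans c1.
by apply: (sn_value_lt L0 c0 (sn_gram_spd t w)); exact: EZ.
Qed.

End SelfNormalizedBound.

(** * Independent shocks and uniform prices *)

Section IndependenceFubini.
Context {dO : measure_display} {Om : measurableType dO} {R : realType}.
Variable P : probability Om R.
Variable H : set_system Om.
Hypothesis sH : sigma_algebra setT H.
Hypothesis Hm : forall A, H A -> measurable A.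
Variable Z : {RV P >-> R}.
Hypothesis ind : forall E V, H E -> measurable V ->
  P (Z @^-1` V `&` E) = (P (Z @^-1` V) * P E)%E.

Local Notation G := (g_sigma_algebraType H).

(** The identity into [Om] with the sigma-algebra H is a random variable that carries all the
    information of H, so independence of [Z] and H becomes a product law for a pair. *)
Lemma measurable_sub_id : measurable_fun setT (fun w : Om => w : G).
Proof.
by move=> _ B mB; rewrite setTI; apply: Hm; rewrite -(g_sigma_measurableE sH).
Qed.

Let sub_id : {mfun Om >-> G} :=
  HB.pack (fun w : Om => w : G) (isMeasurableFun.Build _ _ _ _ _ measurable_sub_id).

Lemma measurable_joint : measurable_fun setT (fun w : Om => (Z w, w : G)).
Proof. by apply: measurable_fun_pair => //; exact: measurable_sub_id. Qed.

Let joint : {mfun Om >-> (R * G)%type} :=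
  HB.pack (fun w : Om => (Z w, w : G)) (isMeasurableFun.Build _ _ _ _ _ measurable_joint).

Lemma joint_distribution (X : set (R * G)) : measurable X ->
  (distribution P Z \x distribution P sub_id)%E X = distribution P joint X.
Proof.
apply: product_measure_unique => A B mA mB.
have HB : H B by rewrite -(g_sigma_measurableE sH).
exact: (ind HB mA).
Qed.

Variable f : R * G -> \bar R.
Hypothesis mf : measurable_fun setT f.
Hypothesis f0 : forall x, (0 <= f x)%E.

(** Shock outermost: serves the pilot rounds, where the price is averaged at a fixed value of the
    shock. *)
Lemma indep_fubini1 :
  (\int[P]_w f (Z w, w : G) = \int[distribution P Z]_e \int[P]_w f (e, w : G))%E.
Proof.
transitivity (\int[distribution P joint]_z f z)%E.
  by rewrite ge0_integral_distribution.
transitivity (\int[(distribution P Z \x distribution P sub_id)%E]_z f z)%E.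
  by apply: eq_measure_integral => X mX _; apply/esym; exact: joint_distribution.
rewrite fubini_tonelli1//; apply: eq_integral => e _; rewrite /fubini_F.
rewrite ge0_integral_distribution//.
exact: measurableT_comp mf (pair1_measurable e).
Qed.

(** Shock innermost: serves the LDP rounds, where the surplus is fixed and the shock is averaged
    into the link. *)
Lemma indep_fubini2 :
  (\int[P]_w f (Z w, w : G) = \int[P]_w \int[distribution P Z]_e f (e, w : G))%E.
Proof.
transitivity (\int[distribution P joint]_z f z)%E.
  by rewrite ge0_integral_distribution.
transitivity (\int[(distribution P Z \x distribution P sub_id)%E]_z f z)%E.
  by apply: eq_measure_integral => X mX _; apply/esym; exact: joint_distribution.
rewrite fubini_tonelli2// ge0_integral_distribution//.
  exact: measurable_fun_fubini_tonelli_G.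
by move=> w; apply: integral_ge0 => e _; exact: f0.
Qed.

End IndependenceFubini.

Section EqualInDistribution.
Context {dO : measure_display} {Om : measurableType dO} {R : realType}.
Variable P : probability Om R.

(** The open rays form a pi-system that generates the Borel sets, and the cdf determines their
    measure. *)
Lemma distribution_eq (X Y : {RV P >-> R}) : (forall r, cdf X r = cdf Y r) ->
  forall A, measurable A -> distribution P X A = distribution P Y A.
Proof.
move=> XY A mA.
pose I : set (set R) := [set B | exists x, B = `]x, +oo[%classic].
have ray x : distribution P X `]x, +oo[%classic = distribution P Y `]x, +oo[%classic.
  have e (W : {RV P >-> R}) : distribution P W `]x, +oo[%classic = (1 - cdf W x)%E.
    rewrite -setCitvl probability_setC//.
  by rewrite !e XY.
apply: (@measure_unique _ _ R I (fun n => `](- n%:R)%R, +oo[%classic)) => //.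
- exact: RGenOInfty.measurableE.
- move=> _ _ [x ->] [y ->]; exists (Num.max x y).
  by apply/seteqP; split=> z /=; rewrite !in_itv /= !andbT gt_max => /andP.
- by move=> n; exists (- n%:R).
- apply/seteqP; split=> // z _; exists (Num.truncn (- z)).+1 => //=.
  by rewrite in_itv /= andbT ltrNl; exact: truncnS_gt.
- by move=> _ [x ->]; exact: ray.
- by move=> n; rewrite (le_lt_trans (probability_le1 _ _))// ltry.
Qed.

End EqualInDistribution.

Lemma uniform_prob_ray (R : realType) (B : R) (B0 : 0 < B) (c : R) : 0 <= c ->
  uniform_prob B0 `]-oo, c]%classic = (Num.min c B / B)%:E.
Proof.
move=> c0; rewrite /uniform_prob integral_uniform_pdf.
have -> : `]-oo, c]%classic `&` `[0, B]%classic = `[0, Num.min c B]%classic :> set R.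
  apply/seteqP; split=> z /=; rewrite !in_itv /= le_min.
    by move=> [-> /andP[-> ->]].
  by move=> /and3P[-> -> ->].
rewrite (eq_integral (fun=> (B^-1)%:E)); last first.
  move=> z /set_mem /=; rewrite in_itv /= le_min => /and3P[z0 _ zB].
  by rewrite /uniform_pdf z0 zB subr0.
rewrite integral_cst//= lebesgue_measure_itv /= lte_fin.
case: ltP => [_|h]; first by rewrite -EFinB subr0 -EFinM mulrC.
suff -> : Num.min c B = 0 by rewrite mul0r mule0.
by apply/eqP; rewrite eq_le h le_min c0 ltW.
Qed.

(** * Averaging over a uniform price *)

Section UniformDraw.
Context {dO : measure_display} {Om : measurableType dO} {R : realType}.
Variable P : probability Om R.
Variable H : set_system Om.
Hypothesis sH : sigma_algebra setT H.
Hypothesis Hm : forall A, H A -> measurable A.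
Variables (B : R) (B0 : 0 < B) (p W : Om -> R) (X : set Om).
Hypothesis mp : measurable_fun setT p.
Hypothesis HX : H X.
Hypothesis HW : meas_wrt H W.
Hypothesis WB : forall w, X w -> 0 <= W w <= B.
Hypothesis unif : forall E V, H E -> measurable V ->
  P ((X `&` E) `&` p @^-1` V) = (P (X `&` E) * uniform_prob B0 V)%E.

Lemma sigma_algebra_setI A A' : H A -> H A' -> H (A `&` A').
Proof.
rewrite -(g_sigma_measurableE sH) => mA mA'.
exact: (@measurableI _ (g_sigma_algebraType H)).
Qed.

Let mX : measurable X := Hm HX.

(** The threshold [W] is cut into slices of height 1/(n+1). On a slice, the event p <= W lies
    between the events that p is below the lower and the upper level. Each level is a constant, so
    [unif] gives their probabilities, and these differ by at most 1/((n+1) B). *)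
Lemma mean_uniform_le n :
  `|mean P (fun w => \1_X w * (p w <= W w)%R%:R) - mean P (fun w => \1_X w * W w) / B|
  <= (n.+1%:R * B)^-1.
Proof.
have n0 : 0 < n.+1%:R :> R by rewrite ltr0n.
have nV : 0 < n.+1%:R^-1 :> R by rewrite invr_gt0.
pose K := (Num.truncn (n.+1%:R * B)).+1.
pose A (k : nat) := W @^-1` [set` `[k%:R / n.+1%:R, k.+1%:R / n.+1%:R[].
have HA k : H (A k) by apply: HW; exact: measurable_itv.
have HXA k : H (X `&` A k) by exact: sigma_algebra_setI.
have mXA k : measurable (X `&` A k) by exact: Hm.
have mp' c : measurable (p @^-1` `]-oo, c]%classic).
  by rewrite -[X in measurable X]setTI; exact: mp.
have bXA k : bmeas (\1_(X `&` A k) : Om -> R) by exact: bmeas_indic.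
have bp c : bmeas (\1_(p @^-1` `]-oo, c]%classic) : Om -> R) by exact: bmeas_indic.
have mW : measurable_fun setT W by apply: (meas_wrt_measurable (@Hm)); exact: HW.
have m1 c k : mean P (fun w => \1_(X `&` A k) w * \1_(p @^-1` `]-oo, c]%classic) w) =
    mean P (\1_(X `&` A k)) * fine (uniform_prob B0 `]-oo, c]%classic).
  rewrite (_ : (fun w => _) = \1_(X `&` A k `&` p @^-1` `]-oo, c]%classic)); last first.
    by rewrite [in RHS]indicI.
  rewrite !mean_indic//; last exact: measurableI.
  by rewrite unif// fineM// fin_num_measure.
have bX : bmeas (\1_X : Om -> R) by exact: bmeas_indic.
have bF : bmeas (fun w => \1_X w * (p w <= W w)%R%:R : R).
  apply: bmeasM => //; split.
    have := @measurable_fun_ler _ _ _ _ _ _ mp mW => mb.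
    rewrite (_ : (fun w => _) = (fun w => if p w <= W w then 1 else 0)); last first.
      by apply/funext => w; case: ifP.
    exact: measurable_fun_ifT.
  by exists 1 => w; case: (p w <= W w); rewrite ?normr1 ?normr0.
have bXW : bmeas (fun w => \1_X w * W w : R).
  split; first by apply: measurable_funM => //; exact: measurable_indic.
  exists B => w; rewrite indicE; have [/set_mem Xw|_] := boolP (w \in X).
    by have /andP[w0 wB] := WB Xw; rewrite mul1r ger0_norm.
  by rewrite mul0r normr0 ltW.
pose lo w : R := \sum_(k < K) \1_(X `&` A k) w * \1_(p @^-1` `]-oo, k%:R / n.+1%:R]%classic) w.
pose hi w : R := \sum_(k < K) \1_(X `&` A k) w * \1_(p @^-1` `]-oo, k.+1%:R / n.+1%:R]%classic) w.
pose sl w : R := \sum_(k < K) k%:R / n.+1%:R * \1_(X `&` A k) w.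
have blo : bmeas lo by apply: bmeas_sum => k; exact: bmeasM.
have bhi : bmeas hi by apply: bmeas_sum => k; exact: bmeasM.
have bsl : bmeas sl by apply: bmeas_sum => k; apply: bmeasM => //; exact: bmeas_cst.
have pick w : X w -> exists k0 : 'I_K, [/\ A k0 w, k0%:R / n.+1%:R <= W w,
     W w < k0.+1%:R / n.+1%:R & forall k : 'I_K, (w \in X `&` A k) = (k == k0)].
  move=> Xw; have /andP[W0 WB'] := WB Xw.
  have nW0 : 0 <= n.+1%:R * W w by rewrite mulr_ge0// ltW.
  have kK : (Num.truncn (n.+1%:R * W w) < K)%N by rewrite ltnS le_truncn// ler_pM2l.
  have /andP[t1 t2] := truncn_itv nW0.
  have AE k : A k w = (k == Num.truncn (n.+1%:R * W w)) :> Prop.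
    rewrite eq_sym truncn_eq// /A /= in_itv /=.
    by rewrite ler_pdivrMr// ltr_pdivlMr// ![_ * W w]mulrC.
  exists (Ordinal kK); split=> /=.
  - by rewrite AE.
  - by rewrite ler_pdivrMr// [W w * _]mulrC.
  - by rewrite ltr_pdivlMr// [W w * _]mulrC.
  move=> k; apply/idP/idP => [/set_mem[_]|/eqP ->].
    by rewrite AE => /eqP e; apply/eqP/val_inj.
  by apply/mem_set; split=> //; rewrite AE.
have sumE w (F : nat -> R) : X w -> exists k0 : 'I_K, [/\
     \sum_(k < K) F k * \1_(X `&` A k) w = F k0, k0%:R / n.+1%:R <= W w &
     W w < k0.+1%:R / n.+1%:R].
  move=> Xw; have [k0 [_ h1 h2 h3]] := pick w Xw; exists k0; split=> //.
  rewrite (bigD1 k0)//= indicE h3 eqxx mulr1 big1 ?addr0// => k kk.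
  by rewrite indicE h3 (negbTE kk) mulr0.
have sum0 w (F : nat -> R) : ~ X w -> \sum_(k < K) F k * \1_(X `&` A k) w = 0.
  move=> nX; rewrite big1// => k _; rewrite indicE memNset ?mulr0// => -[].
  by [].
have sumz w (F : nat -> R) : ~ X w -> \sum_(k < K) \1_(X `&` A k) w * F k = 0.
  by move=> nX; under eq_bigr do rewrite mulrC; exact: sum0.
have sumE' w : X w -> exists k0 : 'I_K, [/\
     forall F : nat -> R, \sum_(k < K) \1_(X `&` A k) w * F k = F k0,
     k0%:R / n.+1%:R <= W w & W w < k0.+1%:R / n.+1%:R].
  move=> Xw; have [k0 [_ h1 h2 h3]] := pick w Xw; exists k0; split=> // F.
  rewrite (bigD1 k0)//= indicE h3 eqxx mul1r big1 ?addr0// => k kk.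
  by rewrite indicE h3 (negbTE kk) mul0r.
have indw w c : \1_(p @^-1` `]-oo, c]%classic) w = (p w <= c)%R%:R :> R.
  rewrite indicE (_ : (w \in _) = (p w <= c))//; apply/idP/idP => [/set_mem|h].
    by rewrite /= in_itv.
  by apply/mem_set; rewrite /= in_itv.
have X01 w : (\1_X w = 1 :> R /\ X w) \/ (\1_X w = 0 :> R /\ ~ X w).
  rewrite indicE; have [/set_mem|/negP nX] := boolP (w \in X); [by left|right].
  by split=> // Xw; apply: nX; exact/mem_set.
have lo_le w : lo w <= \1_X w * (p w <= W w)%R%:R <= hi w.
  rewrite /lo /hi; have [[-> Xw]|[-> nX]] := X01 w; last first.
    rewrite (sumz _ (fun k : nat => \1_(p @^-1` `]-oo, k%:R / n.+1%:R]%classic) w))//.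
    rewrite (sumz _ (fun k : nat => \1_(p @^-1` `]-oo, k.+1%:R / n.+1%:R]%classic) w))//.
    by rewrite mul0r lexx.
  have [k0 [E h1 h2]] := sumE' w Xw.
  rewrite (E (fun k : nat => \1_(p @^-1` `]-oo, k%:R / n.+1%:R]%classic) w)).
  rewrite (E (fun k : nat => \1_(p @^-1` `]-oo, k.+1%:R / n.+1%:R]%classic) w)).
  rewrite !indw mul1r; apply/andP; split; rewrite ler_nat.
    by case: (lerP (p w) (k0%:R / n.+1%:R)) => // h; rewrite (le_trans h h1).
  by case: (lerP (p w) (W w)) => // h; rewrite (le_trans h (ltW h2)).
have sl_le w : sl w <= \1_X w * W w <= sl w + n.+1%:R^-1.
  rewrite /sl; have [[-> Xw]|[-> nX]] := X01 w; last first.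
    by rewrite (sum0 _ (fun k : nat => k%:R / n.+1%:R))// mul0r lexx add0r ltW.
  have [k0 [-> h1 h2]] := sumE w (fun k : nat => k%:R / n.+1%:R) Xw.
  rewrite mul1r h1 /= (le_trans (ltW h2))//.
  by rewrite -[k0.+1]addn1 natrD mulrDl mul1r.
pose su w : R := \sum_(k < K) k.+1%:R / n.+1%:R * \1_(X `&` A k) w.
have bsu : bmeas su by apply: bmeas_sum => k; apply: bmeasM => //; exact: bmeas_cst.
have su_le w : su w <= sl w + n.+1%:R^-1.
  rewrite /sl /su; have [[_ Xw]|[_ nX]] := X01 w; last first.
    rewrite (sum0 _ (fun k : nat => k%:R / n.+1%:R))//.
    by rewrite (sum0 _ (fun k : nat => k.+1%:R / n.+1%:R))// add0r ltW.
  have [k0 [_ _ _ h3]] := pick w Xw.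
  have E (F : nat -> R) : \sum_(k < K) F k * \1_(X `&` A k) w = F k0.
    rewrite (bigD1 k0)//= indicE h3 eqxx mulr1 big1 ?addr0// => k kn.
    by rewrite indicE h3 (negbTE kn) mulr0.
  rewrite (E (fun k : nat => k.+1%:R / n.+1%:R)) (E (fun k : nat => k%:R / n.+1%:R)).
  by rewrite -[k0.+1]addn1 natrD mulrDl mul1r.
have meanlo : mean P lo = mean P sl / B.
  rewrite /lo /sl !mean_sum; last 2 first.
  - by move=> k; apply: bmeasM => //; exact: bmeas_cst.
  - by move=> k; exact: bmeasM.
  rewrite mulr_suml; apply: eq_bigr => k _; rewrite m1 meanZ// uniform_prob_ray; last first.
    by rewrite divr_ge0// ler0n.
  (* A lower level never exceeds B, by the choice of [K]. An upper level may, which is why [hi] only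
     gets an inequality. *)
  rewrite /= min_l; first by rewrite mulrA [mean P _ * _]mulrC.
  rewrite ler_pdivrMr// mulrC.
  have := ltn_ord k; rewrite ltnS => kk.
  rewrite (le_trans (_ : _ <= (Num.truncn (n.+1%:R * B))%:R)) ?ler_nat//.
  by rewrite truncn_le// mulr_ge0 ?ltW.
have meanhi : mean P hi <= mean P su / B.
  rewrite /hi /su !mean_sum; last 2 first.
  - by move=> k; apply: bmeasM => //; exact: bmeas_cst.
  - by move=> k; exact: bmeasM.
  rewrite mulr_suml; apply: ler_sum => k _; rewrite m1 meanZ// uniform_prob_ray; last first.
    by rewrite divr_ge0// ler0n.
  rewrite /= [leLHS]mulrC [leRHS]mulrAC; apply: ler_wpM2r; first by rewrite mean_indic// fine_ge0.
  by apply: ler_wpM2r; [rewrite invr_ge0 ltW|rewrite ge_min lexx].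
have meansu : mean P su <= mean P sl + n.+1%:R^-1.
  rewrite -[X in _ <= _ + X](mean_cst P) -meanD//; last exact: bmeas_cst.
  apply: le_mean => //; apply: bmeasD => //; exact: bmeas_cst.
have f1 : mean P lo <= mean P (fun w => \1_X w * (p w <= W w)%R%:R).
  by apply: le_mean => // w; have /andP[] := lo_le w.
have f2 : mean P (fun w => \1_X w * (p w <= W w)%R%:R) <= mean P hi.
  by apply: le_mean => // w; have /andP[] := lo_le w.
have g1 : mean P sl <= mean P (fun w => \1_X w * W w).
  by apply: le_mean => // w; have /andP[] := sl_le w.
have g2 : mean P (fun w => \1_X w * W w) <= mean P sl + n.+1%:R^-1.
  rewrite -[X in _ <= _ + X](mean_cst P) -meanD//; last exact: bmeas_cst.
  apply: le_mean => //; first by apply: bmeasD => //; exact: bmeas_cst.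
  by move=> w; have /andP[] := sl_le w.
rewrite invfM.
have BV : 0 <= B^-1 by rewrite invr_ge0 ltW.
have g1' := ler_wpM2r BV g1; have g2' := ler_wpM2r BV g2.
have h' := ler_wpM2r BV meansu; rewrite mulrDl in g2' h'.
rewrite meanlo in f1.
have f2' := le_trans f2 (le_trans meanhi h').
move: f1 f2' g1' g2'; clear; rewrite ler_norml.
move: (mean P sl / B) (mean P _ / B) (mean P _) (_ / _) => a b c e ? ? ? ?.
by apply/andP; split; lra.
Qed.

Lemma mean_uniform : mean P (fun w => \1_X w * (p w <= W w)%R%:R) =
  mean P (fun w => \1_X w * W w) / B.
Proof.
apply/eqP; rewrite -subr_eq0 -normr_eq0 eq_le normr_ge0 andbT leNgt; apply/negP => m0.
set e := `|_| in m0.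
have := mean_uniform_le (Num.truncn ((e * B)^-1)).
rewrite -/e leNgt => /negP; apply.
by rewrite invfM ltr_pdivrMr// invf_plt ?posrE ?mulr_gt0// truncnS_gt.
Qed.

End UniformDraw.

Section LinkFunction.
Context {dO : measure_display} {Om : measurableType dO} {R : realType}.
Variables (P : probability Om R) (q : R -> R) (D : R) (Z0 : {RV P >-> R}).
Hypothesis mq : measurable_fun setT q.
Hypothesis qD : forall z, 0 <= q z <= D.

Let g (u : R) : R := fine ('E_P[fun w => q (Z0 w - u)])%E.

Let q0 z : 0 <= q z.
Proof. by have /andP[] := qD z. Qed.

Lemma expected_demandE u :
  (\int[distribution P Z0]_e (q (e - u))%:E)%E = (g u)%:E.
Proof.
rewrite ge0_integral_distribution//; first last.
- by move=> e; rewrite lee_fin.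
- apply/measurable_EFinP; apply: measurableT_comp => //.
  by apply: measurable_funB => //; exact: measurable_id.
rewrite /g unlock fineK//.
have b : bmeas (fun w => q (Z0 w - u)).
  split; first by apply: measurableT_comp => //; apply: measurable_funB.
  by exists D => w; rewrite ger0_norm//; have /andP[] := qD (Z0 w - u).
exact: integrable_fin_num (bmeas_integrable P b).
Qed.

Lemma expected_demand_in u : 0 <= g u <= D.
Proof.
rewrite -!lee_fin -expected_demandE; apply/andP; split.
  by apply: integral_ge0 => e _; rewrite lee_fin.
apply: (@le_trans _ _ (\int[distribution P Z0]_e (D%:E))%E).
  apply: ge0_le_integral => //.
  - by move=> e _; rewrite lee_fin.
  - apply/measurable_EFinP; apply: measurableT_comp => //.
    by apply: measurable_funB => //; exact: measurable_id.
  - by move=> e _; rewrite lee_fin; have /andP[] := qD (e - u).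
by rewrite integral_cst// [X in (_ * X)%E]probability_setT mule1.
Qed.

Lemma measurable_expected_demand : measurable_fun setT g.
Proof.
have m : measurable_fun setT (fun z : R * R => (q (z.1 - z.2))%:E).
  by apply/measurable_EFinP; apply: measurableT_comp => //; exact: measurable_funB.
have := @measurable_fun_fubini_tonelli_G _ _ _ _ _ (distribution P Z0) _ m.
move=> /(_ (fun z => _)) h; apply/measurable_EFinP.
rewrite (_ : _ \o _ = fubini_G (distribution P Z0) (fun z : R * R => (q (z.1 - z.2))%:E)).
  by apply: h => z; rewrite lee_fin.
by apply/funext => u; rewrite /fubini_G /= expected_demandE.
Qed.

Section Shock.
Variables (H : set_system Om) (Z : {RV P >-> R}) (c : Om -> R).
Hypothesis sH : sigma_algebra setT H.
Hypothesis Hm : forall A, H A -> measurable A.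
Hypothesis ind : forall E V, H E -> measurable V ->
  P (Z @^-1` V `&` E) = (P (Z @^-1` V) * P E)%E.
Hypothesis ZZ0 : forall A, measurable A -> distribution P Z A = distribution P Z0 A.
Hypothesis Hc : meas_wrt H c.

(** The surplus threshold [c] is known before the shock, so integrating the shock first replaces q(Z
    - c) by the link at c. *)
Lemma integral_demand A : H A ->
  (\int[P]_w (q (Z w - c w) * \1_A w)%:E = \int[P]_w (g (c w) * \1_A w)%:E)%E.
Proof.
move=> HA; set G := g_sigma_algebraType H.
have mc : measurable_fun (setT : set G) c by exact/meas_wrtE.
have mA : measurable (A : set G) by rewrite g_sigma_measurableE.
pose f (z : R * G) := (q (z.1 - c z.2) * \1_A z.2)%:E.
have mf : measurable_fun setT f.
  apply/measurable_EFinP; apply: measurable_funM.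
    apply: measurableT_comp => //; apply: measurable_funB => //.
    exact: measurableT_comp mc measurable_snd.
  apply: (measurableT_comp (f := \1_A : G -> R)) measurable_snd.
  exact: measurable_indic.
have i0 w : 0 <= \1_A w :> R by rewrite indicE.
rewrite (indep_fubini2 sH Hm ind mf); last first.
  by move=> z; rewrite lee_fin mulr_ge0.
apply: eq_integral => w _; rewrite /f /=.
under eq_integral do rewrite EFinM muleC.
rewrite ge0_integralZl//.
- rewrite (eq_measure_integral (distribution P Z0)); last by move=> *; exact: ZZ0.
  by rewrite expected_demandE -EFinM mulrC.
- apply/measurable_EFinP; apply: measurableT_comp => //.
  by apply: measurable_funB => //; exact: measurable_id.
- by move=> e _; rewrite lee_fin.
Qed.

End Shock.

End LinkFunction.

Lemma measurable_sale_indic (R : realType) (d : measure_display) (T : measurableType d)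
    (X : set T) (p W : T -> R) :
  measurable X -> measurable_fun setT p -> measurable_fun setT W ->
  measurable_fun setT
    (fun z : R * T => (\1_X z.2 * (p z.2 <= W z.2 + z.1)%R%:R)%:E : \bar R).
Proof.
move=> mX mp mW; apply/measurable_EFinP; apply: measurable_funM.
  apply: (measurableT_comp (f := \1_X : T -> R)) measurable_snd.
  exact: measurable_indic.
rewrite (_ : (fun _ => _) = (fun z : R * T => if p z.2 <= W z.2 + z.1 then 1 else 0)); last first.
  by apply/funext => z; case: ifP.
apply: measurable_fun_ifT => //; apply: measurable_fun_ler.
  exact: measurableT_comp mp measurable_snd.
by apply: measurable_funD => //; exact: measurableT_comp mW measurable_snd.
Qed.

Section PilotNoise.
Context {dO : measure_display} {Om : measurableType dO} {R : realType}.
Variables (P : probability Om R) (G H : set_system Om) (Z : {RV P >-> R}).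
Hypothesis sG : sigma_algebra setT G.
Hypothesis sH : sigma_algebra setT H.
Hypothesis HG : H `<=` G.
Hypothesis Gm : forall A, G A -> measurable A.
Hypothesis ind : forall E V, G E -> measurable V ->
  P (Z @^-1` V `&` E) = (P (Z @^-1` V) * P E)%E.
Variables (B b : R) (B0 : 0 < B) (b0 : 0 <= b) (p W y : Om -> R) (X : set Om).
Hypothesis Zb : {ae P, forall w, `|Z w| <= b}.
Hypothesis Z0 : ('E_P[Z] = 0)%E.
Hypothesis Gp : meas_wrt G p.
Hypothesis HW : meas_wrt H W.
Hypothesis WB : forall w, b <= W w <= B - b.
Hypothesis my : measurable_fun setT y.
Hypothesis sale : {ae P, forall w, 0 < y w <-> p w <= W w + Z w}.
Hypothesis HX : H X.
Hypothesis unif : forall E V, H E -> measurable V ->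
  P ((X `&` E) `&` p @^-1` V) = (P (X `&` E) * uniform_prob B0 V)%E.

Let Hm A (h : H A) : measurable A := Gm (HG h).
Let mW : measurable_fun setT W.
Proof. by apply: (meas_wrt_measurable (@Hm)); exact: HW. Qed.
Let mp : measurable_fun setT p.
Proof. by apply: (meas_wrt_measurable (@Gm)); exact: Gp. Qed.
Let bX : bmeas (\1_X : Om -> R).
Proof. by apply: bmeas_indic; exact: Hm. Qed.
Let bW : bmeas W.
Proof.
split=> //; exists B => w; have /andP[h1 h2] := WB w.
by rewrite ger0_norm ?(le_trans h2) ?(le_trans b0)// gerBl.
Qed.

(** The shock is bounded only almost surely; clipping bounds it everywhere and does not change its
    mean. *)
Let Zt w : R := Num.max (- b) (Num.min b (Z w)).

Let mZt : measurable_fun setT Zt.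
Proof. by apply: measurable_funTS; apply: measurable_maxr => //; exact: measurable_minr. Qed.

Let Zt_le w : `|Zt w| <= b.
Proof.
rewrite /Zt ler_norml le_max lexx /= ge_max; apply/andP; split; last by rewrite ge_min lexx.
by rewrite (le_trans _ b0)// oppr_le0.
Qed.

Let Zt_ae : {ae P, forall w, Zt w = Z w}.
Proof.
apply: filterS Zb => w; rewrite ler_norml => /andP[h1 h2].
by rewrite /Zt min_r// max_r.
Qed.

Let bZt : bmeas Zt.
Proof. by split=> //; exists b. Qed.

Let mean_Zt : mean P Zt = 0.
Proof.
rewrite /mean /Rintegral (_ : integral _ _ _ = 0%E)//.
rewrite -Z0 unlock; apply: ae_eq_integral => //.
- exact/measurable_EFinP.
- exact/measurable_EFinP.
- by apply: filterS Zt_ae => w e _; rewrite /= e.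
Qed.

(** At a shock e with |e| <= b the valuation W + e lies in [0, B], so a uniform price is below it
    with probability (W + e) / B. This is affine in e, and the zero mean of the shock removes e. *)
Lemma pilot_sale_mean :
  mean P (fun w => \1_X w * (0 < y w)%R%:R) = mean P (fun w => \1_X w * W w) / B.
Proof.
set Gs := g_sigma_algebraType G.
pose f (z : R * Gs) := (\1_X z.2 * (p z.2 <= W z.2 + z.1)%R%:R)%:E : \bar R.
have i0 w : 0 <= \1_X w :> R by rewrite indicE.
have mpG : measurable_fun (setT : set Gs) p by exact/meas_wrtE.
have mWG : measurable_fun (setT : set Gs) W by apply/meas_wrtE => //; exact: meas_wrt_sub HW.
have mf : measurable_fun setT f.
  by apply: measurable_sale_indic => //; rewrite g_sigma_measurableE//; exact: HG.
pose fO (z : R * Om) := (\1_X z.2 * (p z.2 <= W z.2 + z.1)%R%:R)%:E : \bar R.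
have mfO : measurable_fun setT fO by apply: measurable_sale_indic => //; exact: Hm.
have f0 z : (0 <= f z)%E by rewrite lee_fin mulr_ge0.
have inner e : `|e| <= b -> (\int[P]_w f (e, w : Gs))%E =
    ((mean P (fun w => \1_X w * W w) + e * mean P \1_X) / B)%:E.
  move=> eb; have /andP[e1 e2] : - b <= e <= b by rewrite -ler_norml.
  have meas : measurable_fun setT (fun w => W w + e) by exact: measurable_funD.
  have He : meas_wrt H (fun w => W w + e).
    apply/meas_wrtE => //; apply: measurable_funD => //; exact/meas_wrtE.
  have We w : X w -> 0 <= W w + e <= B.
    by move=> _; have /andP[h1 h2] := WB w; apply/andP; split; lra.
  have bI : bmeas (fun w => \1_X w * (p w <= W w + e)%R%:R : R).
    apply: bmeasM => //; split.
      rewrite (_ : (fun w => _) = (fun w => if p w <= W w + e then 1 else 0)); last first.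
        by apply/funext => w; case: ifP.
      by apply: measurable_fun_ifT => //; exact: measurable_fun_ler.
    by exists 1 => w; case: (p w <= W w + e); rewrite ?normr1 ?normr0.
  transitivity ((mean P (fun w => \1_X w * (p w <= W w + e)%R%:R))%:E).
    by rewrite /mean /Rintegral fineK// (integrable_fin_num measurableT (bmeas_integrable P bI)).
  rewrite (mean_uniform sH (@Hm) mp HX He We unif); congr ((_ / _)%:E).
  rewrite -meanZ// -meanD//; first by congr (mean P _); apply/funext => w; rewrite mulrDr [e * _]mulrC.
    exact: bmeasM.
  by apply: bmeasM => //; exact: bmeas_cst.
have bY : bmeas (fun w => \1_X w * (0 < y w)%R%:R : R).
  apply: bmeasM => //; split.
    rewrite (_ : (fun w => _) = (fun w => if 0 < y w then 1 else 0)); last first.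
      by apply/funext => w; case: ifP.
    by apply: measurable_fun_ifT => //; exact: measurable_fun_ltr.
  by exists 1 => w; case: (0 < y w); rewrite ?normr1 ?normr0.
set a := mean P (fun w => \1_X w * W w); set k := mean P \1_X.
have mh : measurable_fun setT (fubini_F P fO) by exact: measurable_fun_fubini_tonelli_F.
transitivity (mean P (fun w => (a + Zt w * k) / B)).
  rewrite /mean /Rintegral; congr fine.
  transitivity (\int[P]_w f (Z w, w : Gs))%E.
    apply: ae_eq_integral => //.
    - by apply/measurable_EFinP; case: bY.
    - by apply: (measurableT_comp mfO); exact: measurable_fun_pair.
    - by apply: filterS sale => w yp _; rewrite /f /=; congr ((_ * (nat_of_bool _)%:R)%:E);
        apply/idP/idP => /yp.
  rewrite (indep_fubini1 sG Gm ind mf f0) (ge0_integral_distribution Z mh)//; last first.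
    by move=> e; apply: integral_ge0.
  apply: ae_eq_integral => //.
  - exact: (measurableT_comp mh).
  - by apply/measurable_EFinP; apply: measurable_funM => //; apply: measurable_funD => //; exact: measurable_funM.
  - by apply: filterS2 Zb Zt_ae => w zb ze _; rewrite /= ze; exact: (inner _ zb).
have -> : (fun w => (a + Zt w * k) / B) = (fun w => a / B + (k / B) * Zt w).
  by apply/funext => w; field; rewrite gt_eqF.
rewrite meanD ?mean_cst ?meanZ// ?mean_Zt ?mulr0 ?addr0//; first exact: bmeas_cst.
by apply: bmeasM => //; exact: bmeas_cst.
Qed.

End PilotNoise.

(** * Derivatives on a compact interval *)

Section Clipping.
Context {R : realDomainType}.
Implicit Types x y z : R.

Lemma ler_dist_max z x y : `|Num.max z x - Num.max z y| <= `|x - y|.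
Proof.
have h1 := ler_norm (x - y); have := ler_norm (y - x); rewrite distrC => h2.
by rewrite ler_norml; apply/andP; case: (leP z x); case: (leP z y) => ? ?; split; lra.
Qed.

Lemma ler_dist_min z x y : `|Num.min z x - Num.min z y| <= `|x - y|.
Proof.
have h1 := ler_norm (x - y); have := ler_norm (y - x); rewrite distrC => h2.
by rewrite ler_norml; apply/andP; case: (leP z x); case: (leP z y) => ? ?; split; lra.
Qed.

End Clipping.

Section DerivativeOnInterval.
Context {R : realType}.
Implicit Types (a b u l s : R) (f g : R -> R).

(** The epsilon-delta form of the convergence of [slopes]. Unlike the limit [derivI], it can be
    restricted to subintervals and glued. *)
Definition has_derivI a b f u l : Prop :=
  forall e, 0 < e -> exists2 r, 0 < r & forall v, a <= v <= b -> v != u ->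
    `|v - u| < r -> `|(f v - f u) / (v - u) - l| < e.

Lemma has_derivIP a b f u l : has_derivI a b f u l <-> slopes a b f u --> l.
Proof.
split=> [H|/cvgrPdist_lt H].
  apply/cvgrPdist_lt => e /H[r r0 Hr].
  exists r => //= v /= uv vu vab.
  by rewrite distrC; apply: Hr; [move: vab; rewrite in_itv| |rewrite distrC].
move=> e /H [r /= r0 Hr]; exists r => // v vab vu vr.
by rewrite distrC; apply: Hr; rewrite //= ?in_itv// distrC.
Qed.

(** An endpoint has points of the interval on one side only, and a < b guarantees them. Properness
    is what makes the limit in [derivI] unique. *)
Lemma within_dnbhs_proper a b u : a < b -> a <= u <= b ->
  ProperFilter (within `[a, b] u^').
Proof.
move=> ab /andP[au ub]; apply: Build_ProperFilter_ex => A [r /= r0 Hr].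
have [ub'|bu] := ltP u b.
  pose v := Num.min b (u + r / 2).
  have uv : u < v by rewrite /v lt_min ub' /=; lra.
  exists v; apply: Hr => /=; [|by rewrite gt_eqF|rewrite in_itv /= ge_min lexx andbT].
    rewrite distrC gtr0_norm ?subr_gt0//.
    by have : v <= u + r / 2 by [rewrite ge_min lexx orbT|]; lra.
  by lra.
have {bu}ub : u = b by apply/eqP; rewrite eq_le ub.
pose v := Num.max a (u - r / 2).
have uv : v < u by rewrite /v gt_max {1}ub ab /=; lra.
exists v; apply: Hr => /=; [|by rewrite lt_eqF|rewrite in_itv /= le_max lexx /=; lra].
rewrite gtr0_norm ?subr_gt0//.
by have : u - r / 2 <= v by [rewrite le_max lexx orbT|]; lra.
Qed.

Lemma derivI_eq a b f u l : a < b -> a <= u <= b -> has_derivI a b f u l ->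
  derivI a b f u = l.
Proof.
move=> ab uab /has_derivIP fl; have F := within_dnbhs_proper ab uab.
by apply: cvg_lim => //; exact: fmap_proper_filter.
Qed.

Lemma cvg_has_derivI a b f u : a < b -> a <= u <= b -> cvg (slopes a b f u) ->
  has_derivI a b f u (derivI a b f u).
Proof. by move=> ab uab /has_derivIP. Qed.

Lemma eq_has_derivI a b f g u l : (forall v, a <= v <= b -> f v = g v) -> a <= u <= b ->
  has_derivI a b f u l -> has_derivI a b g u l.
Proof.
move=> fg uab H e /H[r r0 Hr]; exists r => // v vab vu vr.
by rewrite -!fg//; exact: Hr.
Qed.

Lemma sub_has_derivI a b a' b' f u l : a <= a' -> b' <= b ->
  has_derivI a b f u l -> has_derivI a' b' f u l.
Proof.
move=> aa bb H e /H[r r0 Hr]; exists r => // v /andP[av vb]; apply: Hr.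
by rewrite (le_trans aa)// (le_trans vb).
Qed.

(** Differentiability is local, so both one-sided hypotheses are needed only at the junction u =
    s. *)
Lemma glue_has_derivI a s b f u l :
  (u <= s -> has_derivI a s f u l) -> (s <= u -> has_derivI s b f u l) ->
  has_derivI a b f u l.
Proof.
have [us L _|su _ Rt|-> L Rt] := ltgtP u s => e e0.
- have [r r0 Hr] := L isT e e0; exists (Num.min r (s - u)).
    by rewrite lt_min r0 subr_gt0.
  move=> v /andP[av vb] vu; rewrite lt_min => /andP[vr].
  by rewrite ltr_norml => /andP[_ h]; apply: Hr; rewrite ?av//=; lra.
- have [r r0 Hr] := Rt isT e e0; exists (Num.min r (u - s)).
    by rewrite lt_min r0 subr_gt0.
  move=> v /andP[av vb] vu; rewrite lt_min => /andP[vr].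
  by rewrite ltr_norml => /andP[h _]; apply: Hr; rewrite ?vb ?andbT//=; lra.
- have [r r0 Hr] := L isT e e0; have [r' r'0 Hr'] := Rt isT e e0.
  exists (Num.min r r'); first by rewrite lt_min r0.
  move=> v /andP[av vb] vu; rewrite lt_min => /andP[vr vr'].
  have [vs|/ltW sv] := leP v s; first by apply: Hr => //; rewrite av.
  by apply: Hr' => //; rewrite sv.
Qed.

Lemma is_derive_has_derivI a b f u l : is_derive u 1 f l -> has_derivI a b f u l.
Proof.
move=> [df <-] e e0.
have /cvgrPdist_lt/(_ e e0) : h^-1 *: ((f \o shift u) (h *: 1) - f u) @[h --> 0^'] --> 'D_1 f u by [].
move=> [r /= r0 Hr]; exists r => // v vab vu vr.
have /= := Hr (v - u); rewrite sub0r normrN subr_eq0 => /(_ vr vu).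
by rewrite /GRing.scale /= mulr1 subrK distrC [_^-1 * _]mulrC.
Qed.

Lemma has_derivI_is_derive a b f u l : a < u < b -> has_derivI a b f u l ->
  is_derive u 1 f l.
Proof.
move=> /andP[au ub] H.
have C : h^-1 *: ((f \o shift u) (h *: 1) - f u) @[h --> 0^'] --> l.
  apply/cvgrPdist_lt => e /H[r r0 Hr].
  exists (Num.min r (Num.min (u - a) (b - u))) => /=.
    by rewrite !lt_min r0 !subr_gt0 au ub.
  move=> h /=; rewrite sub0r normrN !lt_min => /and3P[hr ha hb] h0.
  rewrite /GRing.scale /= mulr1 distrC [_^-1 * _]mulrC.
  have e2 : h + u - u = h by rewrite addrK.
  rewrite -{2}e2; apply: Hr; rewrite ?e2//.
    by move: ha hb; rewrite !ltr_norml => /andP[? _] /andP[_ ?]; apply/andP; split; lra.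
  by rewrite -subr_eq0 e2.
split; first by apply/cvg_ex; exists l.
exact: cvg_lim.
Qed.

Lemma has_derivI_continuous a b f df :
  (forall u, a <= u <= b -> has_derivI a b f u (df u)) -> {within `[a, b], continuous f}.
Proof.
move=> H; apply/subspace_continuousP => u /=; rewrite in_itv /= => uab.
apply/cvgrPdist_lt => e e0; have [r r0 Hr] := H u uab 1 ltr01.
have M0 : 0 < `|df u| + 1 by rewrite ltr_wpDl.
exists (Num.min r (e / (`|df u| + 1))) => /=.
  by rewrite lt_min r0 divr_gt0.
move=> v /=; rewrite lt_min => /andP[vr ve]; rewrite in_itv /= => vab.
have [->|vu] := eqVneq v u; first by rewrite subrr normr0.
rewrite distrC in vr; have := Hr v vab vu vr.
rewrite distrC in ve.
have vu0 : v - u != 0 by rewrite subr_eq0.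
have -> : f u - f v = - ((f v - f u) / (v - u) * (v - u)) by rewrite divfK// opprB.
rewrite normrN normrM => h.
have : `|(f v - f u) / (v - u)| <= `|df u| + 1.
  rewrite -[X in `|X|](subrK (df u)); apply: le_trans (ler_normD _ _) _.
  by rewrite addrC lerD2l ltW.
rewrite ltr_pdivlMr// mulrC in ve.
by move=> /(ler_wpM2r (normr_ge0 (v - u))) /le_lt_trans; apply.
Qed.

Lemma MVT_derivI a b f df u v : a <= u -> u < v -> v <= b ->
  (forall w, a <= w <= b -> has_derivI a b f w (df w)) ->
  exists2 w, u < w < v & f v - f u = df w * (v - u).
Proof.
move=> au uv vb H.
have H' w : u <= w <= v -> has_derivI u v f w (df w).
  move=> /andP[uw wv]; apply: (sub_has_derivI au vb); apply: H.
  by rewrite (le_trans au)//= (le_trans wv).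
have [w|w] := @MVT _ f df u v uv _ (has_derivI_continuous H').
  rewrite in_itv /= => /andP[uw wv]; apply: has_derivI_is_derive (H' _ _).
    by rewrite uw.
  by rewrite !ltW.
by rewrite in_itv => wuv; exists w.
Qed.

(** Cauchy's mean value theorem between [c] and [u], on whichever side [u] lies. Comparing with a
    power g of v - c integrates a bound on f' without losing the factorial. *)
Lemma cauchy_MVT_bound a b f df g dg c u k : a <= c <= b -> a <= u <= b ->
  (forall w, a <= w <= b -> has_derivI a b f w (df w)) ->
  (forall w, a <= w <= b -> has_derivI a b g w (dg w)) ->
  (forall w, w != c -> dg w != 0) ->
  f c = 0 -> g c = 0 -> 0 <= k ->
  (forall w, a <= w <= b -> `|w - c| <= `|u - c| -> `|df w| <= k * `|dg w|) ->
  `|f u| <= k * `|g u|.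
Proof.
move=> cab uab Hf Hg dg0 fc gc k0 dfg.
have [->|uc] := eqVneq u c; first by rewrite fc gc normr0 mulr0.
pose p := Num.min c u; pose q := Num.max c u.
have pqE : [/\ p = c, q = u & c < u] \/ [/\ p = u, q = c & u < c].
  move: uc; rewrite /p /q neq_lt => /orP[uc|cu]; [right|left].
    by rewrite (min_r (ltW uc)) (max_l (ltW uc)).
  by rewrite (min_l (ltW cu)) (max_r (ltW cu)).
have pq : p < q by case: pqE => -[-> ->].
have pa : a <= p by rewrite le_min; case/andP: cab => ->; case/andP: uab => ->.
have qb : q <= b by rewrite ge_max; case/andP: cab => _ ->; case/andP: uab => _ ->.
have sub w : p <= w <= q -> a <= w <= b.
  by move=> /andP[pw wq]; rewrite (le_trans pa)//= (le_trans wq).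
have Hf' w : p <= w <= q -> has_derivI p q f w (df w).
  by move=> /sub; move=> /Hf; exact: sub_has_derivI.
have Hg' w : p <= w <= q -> has_derivI p q g w (dg w).
  by move=> /sub; move=> /Hg; exact: sub_has_derivI.
have D F dF : (forall w, p <= w <= q -> has_derivI p q F w (dF w)) ->
    forall w, w \in `]p, q[ -> is_derive w 1 F (dF w).
  move=> HF w; rewrite in_itv /= => /andP[pw wq].
  by apply: has_derivI_is_derive (HF _ _); rewrite ?pw ?ltW.
have ne w : w \in `]p, q[ -> w != c.
  rewrite in_itv /= => /andP[]; case: pqE => -[-> -> _] h1 h2.
    by rewrite gt_eqF.
  by rewrite lt_eqF.
have dgN w : w \in `]p, q[ -> dg w != 0 by move=> /ne; exact: dg0.
have gq := differentiable_subr_neq0 pq (has_derivI_continuous Hg') (D _ _ Hg') dgN.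
have [w wpq] := cauchy_MVT pq (has_derivI_continuous Hf') (has_derivI_continuous Hg')
  (D _ _ Hf') (D _ _ Hg') dgN.
have -> : (f q - f p) / (g q - g p) = f u / g u.
  case: pqE => -[-> -> _]; rewrite fc gc ?subr0// !sub0r.
  by rewrite invrN mulrNN.
have gu : g u != 0.
  by move: gq; case: pqE => -[-> -> _]; rewrite gc ?subr0// sub0r oppr_eq0.
move=> e; have -> : f u = df w / dg w * g u by rewrite e divfK.
have dw := dgN w wpq.
rewrite normrM ler_wpM2r// normf_div ler_pdivrMr ?normr_gt0//.
move: wpq; rewrite in_itv /= => /andP[pw wq]; apply: dfg; first by rewrite sub ?ltW ?pw.
by move: pw wq; case: pqE => -[-> -> cu] pw wq;
  [rewrite !gtr0_norm ?subr_gt0//|rewrite !ltr0_norm ?subr_lt0//]; lra.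
Qed.


Lemma is_derive_shift_exp (c u : R) n :
  is_derive u 1 (fun v : R => (v - c) ^+ n.+1) (n.+1%:R * (u - c) ^+ n).
Proof.
have d1 : is_derive u 1 (fun v : R => v - c) 1.
  by apply: is_derive_eq; rewrite subr0.
have := @is_deriveX _ _ (fun v : R => v - c) n.+1 u 1 1 d1.
by rewrite exprfctE /GRing.scale /= mulr1.
Qed.

Lemma is_derive_taylor (D : nat -> R) (m : nat) (c u : R) :
  is_derive u 1 (fun v : R => \sum_(k < m.+1) D k / (k`!)%:R * (v - c) ^+ k)
    (\sum_(k < m) D k.+1 / (k`!)%:R * (u - c) ^+ k).
Proof.
elim: m => [|m IH].
  rewrite big_ord0 (_ : (fun v => _) = cst (D 0%N / (0`!)%:R)).
    exact: is_derive_cst.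
  by apply/funext => v; rewrite big_ord1 expr0 mulr1.
rewrite (_ : (fun v => _) = (fun v => \sum_(k < m.+1) D k / (k`!)%:R * (v - c) ^+ k) +
    (fun v => D m.+1 / (m.+1`!)%:R * (v - c) ^+ m.+1)); last first.
  by apply/funext => v; rewrite big_ord_recr.
rewrite big_ord_recr /=; apply: is_deriveD.
have f0 : (m`!)%:R != 0 :> R by rewrite pnatr_eq0 -lt0n fact_gt0.
have m0 : m.+1%:R != 0 :> R by rewrite pnatr_eq0.
have -> : D m.+1 / (m`!)%:R * (u - c) ^+ m =
    D m.+1 / (m.+1`!)%:R *: (m.+1%:R * (u - c) ^+ m) :> R.
  move: f0 m0; rewrite /GRing.scale /= factS natrM; move: (m`!%:R : R) (m.+1%:R : R) => p q p0 q0.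
  by field; rewrite p0 q0.
exact: is_deriveZ (is_derive_shift_exp c u m).
Qed.

(** There is no derivative of order m + 1, so the remainder is controlled by the oscillation K of
    the m-th one. The derivative of the remainder is the remainder of the shifted family, and
    comparison with (v - c)^(m+1) gives the induction. *)
Lemma taylor_bound a b (D : nat -> R -> R) m (c u K : R) : a <= c <= b -> a <= u <= b ->
  (forall k w, (k < m)%N -> a <= w <= b -> has_derivI a b (D k) w (D k.+1 w)) ->
  (forall w, a <= w <= b -> `|w - c| <= `|u - c| -> `|D m w - D m c| <= K) ->
  `|D 0%N u - \sum_(k < m.+1) D k c / (k`!)%:R * (u - c) ^+ k| <=
  K / (m`!)%:R * `|u - c| ^+ m.
Proof.
move=> cab; elim: m D u => [|m IH] D u uab HD HK.
  by rewrite big_ord1 fact0 !divr1 expr0 !mulr1; exact: HK.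
have K0 : 0 <= K.
  by have := HK c cab; rewrite !subrr normr0 => /(_ (normr_ge0 _)).
pose f v := D 0%N v - \sum_(k < m.+2) D k c / (k`!)%:R * (v - c) ^+ k.
pose df v := D 1%N v - \sum_(k < m.+1) D k.+1 c / (k`!)%:R * (v - c) ^+ k.
pose g (v : R) := (v - c) ^+ m.+1.
pose dg v : R := m.+1%:R * (v - c) ^+ m.
have Hdg (w : R) : is_derive w 1 g (dg w : R) by exact: is_derive_shift_exp.
have k0 : 0 <= K / (m.+1`!)%:R by rewrite divr_ge0.
rewrite -normrX -/(f u) -/(g u).
apply: (@cauchy_MVT_bound a b f df g dg c) => //.
- move=> w wab e e0.
  have e20 : 0 < e / 2 by rewrite divr_gt0.
  have [r r0 Hr] := HD 0%N w (ltn0Sn m) wab _ e20.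
  have [r' r'0 Hr'] := is_derive_has_derivI a b (is_derive_taylor (D ^~ c) m.+1 c w) e20.
  exists (Num.min r r'); first by rewrite lt_min r0.
  move=> v vab vw; rewrite lt_min => /andP[/(Hr v vab vw) h1 /(Hr' v vab vw) h2].
  rewrite /f /df; set p := \sum_(k < m.+2) _ in h2 *; set q := \sum_(k < m.+2) _ in h2 *.
  set p' := \sum_(k < m.+1) _ in h2 *.
  have -> : (D 0%N v - p - (D 0%N w - q)) / (v - w) - (D 1%N w - p') =
    ((D 0%N v - D 0%N w) / (v - w) - D 1%N w) - ((p - q) / (v - w) - p') by ring.
  by rewrite (le_lt_trans (ler_normB _ _))// [ltRHS]splitr ltrD.
- by move=> w _; exact: is_derive_has_derivI.
- by move=> w wc; rewrite mulf_neq0 ?expf_neq0 ?subr_eq0// pnatr_eq0.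
- rewrite /f big_ord_recl /= expr0 mulr1 fact0 divr1 big1 ?addr0 ?subrr// => i _.
  by rewrite ?subrr expr0n mulr0.
- by rewrite /g subrr expr0n.
- move=> w wab wu; rewrite /dg normrM normrX ger0_norm// mulrA.
  have -> : K / (m.+1`!)%:R * m.+1%:R = K / (m`!)%:R.
    have f0 : (m`!)%:R != 0 :> R by rewrite pnatr_eq0 -lt0n fact_gt0.
    have m0 : m.+1%:R != 0 :> R by rewrite pnatr_eq0.
    move: f0 m0; rewrite factS natrM; move: (m`!%:R : R) (m.+1%:R : R) => p q p0 q0.
    by field; rewrite p0 q0.
  apply: (IH (fun k => D k.+1)) => //.
    by move=> k v km vab; exact: HD.
  by move=> v vab vw; apply: HK => //; exact: le_trans wu.
Qed.

End DerivativeOnInterval.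

(** * The extension by endpoint Taylor polynomials *)

Section LinkExtension.
Context {R : realType}.
Variables (a lo hi b : R) (m : nat) (f : R -> R) (L al : R).
Hypothesis alo : a <= lo.
Hypothesis lohi : lo < hi.
Hypothesis hib : hi <= b.
Hypothesis L0 : 0 <= L.
Hypothesis al0 : 0 <= al.
Hypothesis f_smooth : forall k u, (k < m)%N -> u \in `[lo, hi] ->
  cvg (slopes lo hi (derivnI lo hi k f) u).
Hypothesis f_holder : forall u u', u \in `[lo, hi] -> u' \in `[lo, hi] ->
  `|derivnI lo hi m f u - derivnI lo hi m f u'| <= L * `|u - u'| `^ al.

Local Notation D := (fun k => derivnI lo hi k f).

(* The k-th derivative of the extension of f by its endpoint Taylor polynomials. *)
Definition ext_deriv (k : nat) (u : R) : R :=
  if u < lo then \sum_(l < m.+1 - k) D (k + l)%N lo / (l`!)%:R * (u - lo) ^+ l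
  else if hi < u then \sum_(l < m.+1 - k) D (k + l)%N hi / (l`!)%:R * (u - hi) ^+ l
  else D k u.

Lemma ext_deriv_inside k u : lo <= u <= hi -> ext_deriv k u = D k u.
Proof. by move=> /andP[lu uh]; rewrite /ext_deriv !ltNge lu uh. Qed.

Lemma taylor_at_center k c : (k <= m)%N ->
  \sum_(l < m.+1 - k) D (k + l)%N c / (l`!)%:R * (c - c) ^+ l = D k c.
Proof.
move=> km; rewrite subSn// big_ord_recl /= expr0 mulr1 fact0 divr1 addn0 big1 ?addr0// => i _.
by rewrite subrr expr0n mulr0.
Qed.

Lemma ext_deriv_left k u : (k <= m)%N -> u <= lo ->
  ext_deriv k u = \sum_(l < m.+1 - k) D (k + l)%N lo / (l`!)%:R * (u - lo) ^+ l.
Proof.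
move=> km; rewrite le_eqVlt => /predU1P[->|]; last by rewrite /ext_deriv => ->.
by rewrite taylor_at_center// ext_deriv_inside// lexx ltW.
Qed.

Lemma ext_deriv_right k u : (k <= m)%N -> hi <= u ->
  ext_deriv k u = \sum_(l < m.+1 - k) D (k + l)%N hi / (l`!)%:R * (u - hi) ^+ l.
Proof.
move=> km; rewrite le_eqVlt => /predU1P[<-|hu]; last first.
  by rewrite /ext_deriv hu ltNge (ltW (lt_trans lohi hu)).
by rewrite taylor_at_center// ext_deriv_inside// lexx ltW.
Qed.

Lemma has_derivI_taylor a' b' k c u : (k < m)%N ->
  has_derivI a' b' (fun v => \sum_(l < m.+1 - k) D (k + l)%N c / (l`!)%:R * (v - c) ^+ l) u
    (\sum_(l < m.+1 - k.+1) D (k.+1 + l)%N c / (l`!)%:R * (u - c) ^+ l).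
Proof.
move=> km; apply: is_derive_has_derivI; rewrite subSn ?(ltnW km)// subSS.
have := is_derive_taylor (fun l => D (k + l)%N c) (m - k) c u.
by under [X in is_derive _ _ _ X]eq_bigr do rewrite addnS -addSn.
Qed.

(** Three pieces glued at [lo] and [hi], where the derivatives of the Taylor polynomials agree with
    the one-sided derivatives of f. *)
Lemma has_derivI_ext k u : (k < m)%N -> a <= u <= b ->
  has_derivI a b (ext_deriv k) u (ext_deriv k.+1 u).
Proof.
move=> km /andP[au ub]; have km' := ltnW km.
apply: (@glue_has_derivI _ a lo) => [ulo|lou].
  rewrite ext_deriv_left//; apply: eq_has_derivI (has_derivI_taylor _ _ _ _ km).
    by move=> v /andP[_ vlo]; rewrite ext_deriv_left.
  by rewrite au.
apply: (@glue_has_derivI _ lo hi) => [uhi|hiu].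
  rewrite ext_deriv_inside ?lou//; apply: (@eq_has_derivI _ _ _ (D k)).
  - by move=> v vv; rewrite ext_deriv_inside.
  - by rewrite lou.
  - by apply: cvg_has_derivI; rewrite ?lou//; apply: f_smooth => //; rewrite in_itv /= lou.
rewrite ext_deriv_right//; apply: eq_has_derivI (has_derivI_taylor _ _ _ _ km).
  by move=> v /andP[vhi _]; rewrite ext_deriv_right.
by rewrite hiu.
Qed.

Lemma derivnI_ext k u : (k <= m)%N -> a <= u <= b ->
  derivnI a b k (taylor_ext m lo hi f) u = ext_deriv k u.
Proof.
have ab : a < b by apply: le_lt_trans alo _; exact: lt_le_trans hib.
elim: k u => [|k IH] u km uab.
  rewrite /= /taylor_ext /ext_deriv /taylorI subn0.
  by do 2 case: ifP => // _.
rewrite /derivnI iterS -/(derivnI a b k _); apply: derivI_eq => //.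
apply: eq_has_derivI (has_derivI_ext km uab) => // v vab.
by rewrite IH// ltnW.
Qed.

(** The m-th derivative of the extension is constant on each side of [lo, hi]: it is the original
    one at the projected point, and the projection is 1-Lipschitz. *)
Lemma ext_deriv_holder u v : a <= u <= b -> a <= v <= b ->
  `|ext_deriv m u - ext_deriv m v| <= L * `|u - v| `^ al.
Proof.
move=> uab vab; pose pr w := Num.max lo (Num.min hi w).
have E w : ext_deriv m w = D m (pr w).
  rewrite /pr /ext_deriv subSnn !big_ord1 !expr0 !mulr1 fact0 !divr1 addn0.
  case: ifPn => [wlo|]; first by rewrite min_r ?max_l// ltW// (lt_trans wlo).
  rewrite -leNgt => low; case: ifPn => [hw|]; first by rewrite min_l ?max_r// ltW.
  by rewrite -leNgt => wh; rewrite min_r// max_r.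
have pr_in w : pr w \in `[lo, hi].
  by rewrite in_itv /= le_max lexx /= ge_max (ltW lohi) ge_min lexx.
rewrite !E; apply: le_trans (f_holder (pr_in u) (pr_in v)) _.
rewrite ler_wpM2l// ge0_ler_powR ?nnegrE//.
exact: le_trans (ler_dist_max _ _ _) (ler_dist_min _ _ _).
Qed.

Lemma ext_taylor_bound c u : a <= c <= b -> a <= u <= b ->
  `|ext_deriv 0 u - \sum_(k < m.+1) ext_deriv k c / (k`!)%:R * (u - c) ^+ k| <=
  L * `|u - c| `^ al / (m`!)%:R * `|u - c| ^+ m.
Proof.
move=> cab uab; apply: (taylor_bound cab uab) => [k w km wab|w wab wu].
  exact: has_derivI_ext.
apply: le_trans (ext_deriv_holder wab cab) _.
by rewrite ler_wpM2l// ge0_ler_powR ?nnegrE.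
Qed.

End LinkExtension.

(** * The surplus features *)

Section TaylorRemainder.
Context {R : realType}.

(** The remainders satisfy r_(k+1) = (x + D) r_k + k D^2 x^(k-1), and |x + D| <= 2 H. The constants
    2^k - k - 1 solve the recurrence c_(k+1) = 2 c_k + k; this is their origin in [Cl]. *)
Lemma binomial_remainder (H x D : R) (k : nat) : `|x| <= H -> `|D| <= H ->
  `|(x + D) ^+ k - x ^+ k - k%:R * x ^+ k.-1 * D| <=
  D ^+ 2 * ((2 ^+ k - k%:R - 1) * H ^+ (k - 2)).
Proof.
move=> xH DH; have H0 : 0 <= H by exact: le_trans xH.
case: k => [|[|k]].
- by rewrite !expr0 subrr !mul0r subr0 normr0 subr0 subrr mul0r mulr0.
- rewrite (_ : _ - _ - _ * D = 0); last by rewrite /=; ring.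
  by rewrite normr0 (_ : 2 ^+ 1 - 1 - 1 = 0 :> R) ?mul0r ?mulr0//; ring.
rewrite subSS subSS subn0; elim: k => [|k IH].
  rewrite expr0 mulr1 (_ : _ - _ - _ = D ^+ 2); last by rewrite /=; ring.
  by rewrite ger0_norm ?sqr_ge0// ler_peMr ?sqr_ge0//; lra.
set r := _ - _ - _ in IH.
have -> : (x + D) ^+ k.+3 - x ^+ k.+3 - k.+3%:R * x ^+ k.+3.-1 * D =
    (x + D) * r + k.+2%:R * D ^+ 2 * x ^+ k.+1.
  by rewrite /r /= [(x + D) ^+ k.+3]exprS [x ^+ k.+3]exprS [x ^+ k.+2]exprS -[k.+3%:R]natr1; ring.
have xD : `|x + D| <= 2 * H by apply: le_trans (ler_normD _ _) _; lra.
have h1 : `|(x + D) * r| <= 2 * H * (D ^+ 2 * ((2 ^+ k.+2 - k.+2%:R - 1) * H ^+ k)).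
  by rewrite normrM; exact: ler_pM (normr_ge0 _) (normr_ge0 _) xD IH.
have h2 : `|k.+2%:R * D ^+ 2 * x ^+ k.+1| <= k.+2%:R * D ^+ 2 * H ^+ k.+1.
  have c0 : 0 <= k.+2%:R * D ^+ 2 by rewrite mulr_ge0 ?sqr_ge0.
  by rewrite normrM (ger0_norm c0) ler_wpM2l// normrX lerXn2r// ?nnegrE.
apply: le_trans (ler_normD _ _) _; apply: le_trans (lerD h1 h2) _.
rewrite le_eqVlt; apply/orP; left; apply/eqP.
by rewrite [H ^+ k.+1]exprS [2 ^+ k.+3]exprS -[k.+3%:R]natr1; ring.
Qed.

Lemma sum_shift_deriv (m : nat) (c : nat -> R) (y : R) :
  \sum_(k < m) k.+1%:R * y ^+ k * c k.+1 = \sum_(k < m.+1) k%:R * y ^+ k.-1 * c k.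
Proof. by rewrite [RHS]big_ord_recl /= !mul0r add0r. Qed.

Lemma dotp_mxvec p q (A B : 'M[R]_(p, q)) :
  dotp (mxvec A)^T (mxvec B)^T = \sum_i \sum_j A i j * B i j.
Proof.
rewrite dotpE pair_bigA (reindex _ (curry_mxvec_bij _ _)) /=.
by apply: eq_bigr => -[i j] _ /=; rewrite !mxE !mxvecE.
Qed.

End TaylorRemainder.

Section LinkProperties.
Context {R : realType} (pr : primitives R) (g : R -> R).
Local Notation B := (pB pr).
Local Notation Beps := (pBeps pr).
Local Notation D := (pD pr).
Local Notation m := (mord pr).
Local Notation L := (pLg pr).
Local Notation Cg := (pCg pr).
Local Notation beta := (pbeta pr).
Local Notation lo := (- B + Beps).
Local Notation hi := (B - Beps).

Definition link_ok : Prop :=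
  [/\ forall u, 0 <= g u <= D, holder beta L lo hi g &
   forall k u, (k <= m)%N -> - B <= u <= B ->
     `|derivnI (- B) B k (taylor_ext m lo hi g) u| <= Cg].

Hypothesis g_ok : link_ok.

Definition link_deriv (k : nat) (u : R) : R := ext_deriv lo hi m g k u.

Lemma m_lt_beta : m%:R < beta.
Proof. by have [] := varpiP (pbeta_ge1 pr). Qed.

Lemma link_interval : [/\ - B <= lo, lo < hi & hi <= B].
Proof. by have /andP[b1 b2] := pBeps_itv pr; have := pB_gt0 pr; split; lra. Qed.

Lemma link_smooth k u : (k < m)%N -> u \in `[lo, hi] -> cvg (slopes lo hi (derivnI lo hi k g) u).
Proof. by have [_ [+ _] _] := g_ok; apply. Qed.

Lemma link_holder_m u u' : u \in `[lo, hi] -> u' \in `[lo, hi] ->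
  `|derivnI lo hi m g u - derivnI lo hi m g u'| <= L * `|u - u'| `^ (beta - m%:R).
Proof. by have [_ [_ +] _] := g_ok; apply. Qed.

Lemma link_deriv_bound k u : (k <= m)%N -> - B <= u <= B -> `|link_deriv k u| <= Cg.
Proof.
move=> km uB; have [i1 i2 i3] := link_interval; have [_ _ +] := g_ok.
by move=> /(_ k u km uB); rewrite (derivnI_ext i1 i2 i3 link_smooth).
Qed.

Lemma Cg_ge0 : 0 <= Cg.
Proof.
apply: le_trans (@link_deriv_bound 0 0 _ _); rewrite ?leq0n//.
by rewrite oppr_le0 (ltW (pB_gt0 pr)).
Qed.

Lemma link_derivE u : lo <= u <= hi -> link_deriv 0 u = g u.
Proof. exact: ext_deriv_inside. Qed.

(** The center may lie outside the interval of the link, as the knots of the extreme bins do; the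
    extension supplies the expansion there. *)
Lemma link_taylor c u : - B <= c <= B -> lo <= u <= hi ->
  `|g u - \sum_(k < m.+1) link_deriv k c / (k`!)%:R * (u - c) ^+ k| <=
  L / (m`!)%:R * `|u - c| `^ beta.
Proof.
move=> cB uI; have [i1 i2 i3] := link_interval.
have uB : - B <= u <= B.
  by case/andP: uI => u1 u2; rewrite (le_trans i1)//= (le_trans u2).
have al0 : 0 <= beta - m%:R by rewrite subr_ge0 ltW// m_lt_beta.
rewrite -link_derivE//; apply: le_trans (ext_taylor_bound i2 (ltW (pLg_gt0 pr)) al0
  link_smooth link_holder_m cB uB) _.
rewrite -powR_mulrn//.
have -> : forall p q r s : R, p * q / r * s = p / r * (q * s) by move=> *; ring.
rewrite -powRD ?subrK//; apply/implyP => /eqP e.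
by have := pbeta_ge1 pr; rewrite e ler10.
Qed.

(** If m = 0 then beta = 1 and the Hölder bound is a Lipschitz bound with constant L_g; otherwise
    the first derivative is at most C_g. Hence the maximum in [LRev]. *)
Lemma link_lipschitz u v : lo <= u <= hi -> lo <= v <= hi ->
  `|g u - g v| <= Num.max L Cg * `|u - v|.
Proof.
move=> uI vI; have [i1 i2 i3] := link_interval.
have [m0|m0] := posnP m.
  have b1 : beta = 1.
    apply/eqP; rewrite eq_le pbeta_ge1 andbT leNgt; apply/negP => b1.
    by have [_ /(_ 1%N b1)] := varpiP (pbeta_ge1 pr); rewrite -/(mord pr) m0.
  have := @link_holder_m u v; rewrite m0 b1 subr0 powRr1// !in_itv => /(_ uI vI) h.
  by apply: le_trans h _; rewrite ler_wpM2r// le_max lexx.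
have H w : - B <= w <= B -> has_derivI (- B) B (link_deriv 0) w (link_deriv 1 w).
  by move=> wB; exact: (@has_derivI_ext _ _ _ _ _ _ _ i2 link_smooth 0%N w m0 wB).
wlog uv : u v uI vI / u < v => [W|].
  have [uv|vu|->] := ltgtP u v; first exact: W.
    by rewrite distrC [`|u - v|]distrC; exact: W.
  by rewrite !subrr normr0 mulr0.
case/andP: (uI) => u1 u2; case/andP: (vI) => v1 v2.
have [w /andP[uw wv]] := MVT_derivI (le_trans i1 u1) uv (le_trans v2 i3) H.
rewrite !link_derivE// => e; rewrite distrC e normrM [`|u - v|]distrC ler_wpM2r//.
rewrite le_max link_deriv_bound ?orbT// (le_trans (le_trans i1 u1) (ltW uw))/=.
by rewrite (le_trans (ltW wv))// (le_trans v2).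
Qed.

End LinkProperties.

Section Features.
Context {R : realType} (pr : primitives R) (tu : tuning pr) (d : nat).
Variables (g : R -> R) (theta : 'cV[R]_d) (tr : trajectory R d (tN tu)).
Local Notation B := (pB pr).
Local Notation Beps := (pBeps pr).
Local Notation m := (mord pr).
Local Notation L := (pLg pr).
Local Notation Cg := (pCg pr).
Local Notation beta := (pbeta pr).
Local Notation N := (tN tu).
Local Notation h := (hbin tu).
Local Notation eta := (teta tu).
Local Notation bias := (hbin tu `^ pbeta pr + teta tu ^+ 2).
Hypothesis g_ok : link_ok pr g.
Hypothesis theta_in : norm2 theta <= pCtheta pr.

Definition coef (j : 'I_N) (k : nat) : R := link_deriv pr g k (knot tu j) / (k`!)%:R.

(** The regression target of bin j: the Taylor coefficients of the extended link at the left knot,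
    then those of order at least 1 multiplied by theta, in the row-major layout of [Xblocks]. *)
Definition z_true (j : 'I_N) : 'cV[R]_(m.+1 + m * d) :=
  col_mx (\col_k coef j k)
    (mxvec (\matrix_(k < m, i < d) (coef j k.+1 * theta i ord0)))^T.

Lemma N_gt0 : 0 < N%:R :> R. Proof. by rewrite ltr0n tN_gt0. Qed.

Lemma hbin_gt0 : 0 < h.
Proof. by rewrite /hbin divr_gt0 ?mulr_gt0 ?pB_gt0 ?N_gt0. Qed.

Lemma hbin_le : h <= 2 * B.
Proof.
rewrite /hbin ler_pdivrMr ?N_gt0// ler_peMr ?mulr_ge0 ?(ltW (pB_gt0 pr))//.
by rewrite ler1n tN_gt0.
Qed.

Lemma eta_gt0 : 0 < eta. Proof. by case/andP: (teta_itv tu). Qed.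
Lemma eta_le : eta <= h. Proof. by case/andP: (teta_itv tu). Qed.

Lemma knotS (k : nat) : knot tu k.+1 = knot tu k + h.
Proof. by rewrite /knot /hbin -(natr1 k) mulrDr mulr1 mulrDl addrA. Qed.

Lemma knot_in (k : nat) : (k <= N)%N -> - B <= knot tu k <= B.
Proof.
move=> kN; have B0 := pB_gt0 pr; have n0 := N_gt0.
have : 0 <= k%:R / N%:R :> R by rewrite divr_ge0 ?(ltW n0).
have : k%:R / N%:R <= 1 :> R by rewrite ler_pdivrMr// mul1r ler_nat.
rewrite /knot -mulrA; move: (k%:R / N%:R) => r r1 r0; apply/andP; split; nra.
Qed.

Lemma in_binP (j : 'I_N) w : in_bin j w -> 0 <= w - knot tu j <= h.
Proof.
by rewrite /in_bin; case: ifP => _ /andP[w1 w2]; move: w2; rewrite knotS => w2;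
  apply/andP; split; lra.
Qed.

Lemma coef_bound j k : (k <= m)%N -> `|coef j k| <= Cg / (k`!)%:R.
Proof.
move=> km; rewrite /coef normrM normfV [`|(k`!)%:R|]ger0_norm// ler_wpM2r ?invr_ge0//.
apply: link_deriv_bound => //; exact: knot_in (ltnW (ltn_ord j)).
Qed.

Lemma sum_from1 (F : nat -> R) : \sum_(k < m) F k.+1 = \sum_(1 <= k < m.+1) F k.
Proof. by rewrite big_add1 big_mkord. Qed.

Lemma norm2_z_true j : norm2 (z_true j) <= Cz pr.
Proof.
have C0 := Cg_ge0 g_ok.
rewrite /Cz -[leRHS]ger0_norm; last by rewrite mulr_ge0 ?sqrtr_ge0.
rewrite -sqrtr_sqr /norm2 wnormE; apply: ler_wsqrtr; rewrite qformE mul1mx exprMn sqr_sqrtr; last first.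
  apply: addr_ge0; [|apply: mulr_ge0; first exact: sqr_ge0];
    by apply: sumr_ge0 => k _; rewrite invr_ge0 sqr_ge0.
have cb k : (k <= m)%N -> coef j k ^+ 2 <= Cg ^+ 2 * ((k`!)%:R ^+ 2)^-1.
  move=> /coef_bound -/(_ j) cb; rewrite -exprVn -exprMn -real_normK ?num_real//.
  by rewrite lerXn2r// nnegrE ?mulr_ge0// invr_ge0.
rewrite dotp_col_mx mulrDr; apply: lerD.
  rewrite dotpE mulr_sumr big_mkord ler_sum// => k _.
  by rewrite !mxE -expr2 cb// -ltnS.
rewrite dotp_mxvec mulrCA -sum_from1 mulr_sumr mulr_sumr.
apply: ler_sum => k _.
rewrite (_ : \sum_i _ = coef j k.+1 ^+ 2 * norm2 theta ^+ 2); last first.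
  rewrite norm2_sqr dotpE mulr_sumr; apply: eq_bigr => i _; rewrite !mxE; ring.
rewrite mulrC; apply: ler_pM; rewrite ?sqr_ge0//; last exact: cb.
by rewrite lerXn2r ?nnegrE ?norm2_ge0// (le_trans (norm2_ge0 theta)).
Qed.

Lemma u_hat_in t : 0 <= u_hat tr t <= B.
Proof.
rewrite /u_hat /proj le_min (ltW (pB_gt0 pr)) le_max lexx /=.
by rewrite ge_min lexx.
Qed.

(** The theta blocks complete u to the pilot error u - x^T theta: the pairing is the Taylor
    polynomial at v plus this error, linearized in the error. *)
Lemma feat_dotp t (j : 'I_N) w (x := tr_x tr t) (u := u_hat tr t) : let v := w - knot tu j in
  dotp (feat tr t j w) (z_true j) =
  \sum_(k < m.+1) coef j k * (v ^+ k + (u - dotp x theta) * (k%:R * v ^+ k.-1)).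
Proof.
move=> v; rewrite /feat /z_true dotp_col_mx.
have -> : p_hat tr t w - w = u by rewrite /p_hat addrK.
have -> : - Xblocks j (tr_x tr t) w =
   (mxvec (\matrix_(k < m, i < d) (- (k.+1%:R * v ^+ k * x i ord0))))^T.
  rewrite /Xblocks -linearN -linearN /=; congr (mxvec _)^T.
  by apply/matrixP => k i; rewrite !mxE.
rewrite dotp_mxvec dotpE.
rewrite (_ : \sum_i \sum_j0 _ = - dotp x theta * \sum_(k < m) k.+1%:R * v ^+ k * coef j k.+1).
  rewrite sum_shift_deriv mulr_sumr -big_split /=; apply: eq_bigr => k _.
  by rewrite !mxE -/v; ring.
rewrite mulr_sumr; apply: eq_bigr => k _.
rewrite dotpE mulNr -mulrN mulr_suml; apply: eq_bigr => i _; rewrite !mxE; ring.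
Qed.

Lemma feat_sqr_le t (j : 'I_N) w : norm2 (tr_x tr t) <= pCx pr -> in_bin j w ->
  dotp (feat tr t j w) (feat tr t j w) <= Cpsi2 pr.
Proof.
move=> xC /in_binP /andP[v0 vh]; have B0 := pB_gt0 pr.
have vB := le_trans vh hbin_le; have /andP[u0 uB] := u_hat_in t.
have B20 : 0 <= 2 * B by lra.
rewrite /feat dotp_col_mx /Cpsi2; set v := w - knot tu j in v0 vB *.
have -> : p_hat tr t w - w = u_hat tr t by rewrite /p_hat addrK.
apply: lerD.
  rewrite dotpE big_ord_recl !mxE /= expr0 mul0r mulr0 addr0 mulr1.
  rewrite lerD2l -sum_from1; apply: ler_sum => k _.
  rewrite !mxE -/v /= -expr2 subSS subn0 lerXn2r ?nnegrE//.
  - by rewrite addr_ge0 ?mulr_ge0 ?exprn_ge0.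
  - by rewrite addr_ge0 ?mulr_ge0 ?exprn_ge0 ?(ltW B0).
  - rewrite lerD ?lerXn2r ?nnegrE// -mulrA; apply: ler_pM => //.
      by rewrite mulr_ge0 ?exprn_ge0.
    by rewrite ler_wpM2l// lerXn2r ?nnegrE.
rewrite dotpNl dotpNr opprK /Xblocks dotp_mxvec -sum_from1 mulr_sumr.
apply: ler_sum => k _.
rewrite (_ : \sum_i _ = (k.+1%:R * v ^+ k) ^+ 2 * norm2 (tr_x tr t) ^+ 2); last first.
  rewrite norm2_sqr dotpE mulr_sumr; apply: eq_bigr => i _; rewrite !mxE -/v; ring.
rewrite mulrC; apply: ler_pM; rewrite ?sqr_ge0//.
  by rewrite lerXn2r ?nnegrE ?norm2_ge0// (le_trans (norm2_ge0 (tr_x tr t))).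
rewrite exprMn subSS subn0 mulnC exprM ler_wpM2l ?sqr_ge0//.
by rewrite lerXn2r ?nnegrE ?exprn_ge0// lerXn2r ?nnegrE.
Qed.

Lemma sum_from2 : \sum_(k < m.+1) (2 ^+ k - k%:R - 1) * (2 * B) ^+ (k - 2) / (k`!)%:R =
  \sum_(2 <= k < m.+1) (2 ^+ k - k%:R - 1) * (2 * B) ^+ (k - 2) / (k`!)%:R :> R.
Proof.
set F := fun k : nat => (2 ^+ k - k%:R - 1) * (2 * B) ^+ (k - 2) / (k`!)%:R.
have F0 : F 0%N = 0 by rewrite /F expr0 subr0 subrr !mul0r.
have F1 : F 1%N = 0 by rewrite /F expr1 (_ : 2 - 1 - 1 = 0 :> R) ?mul0r//; lra.
rewrite -(big_mkord xpredT F) /=; have [m0|m0] := posnP m.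
  by rewrite m0 big_nat1 F0 big_geq.
by rewrite big_ltn// big_ltn// F0 F1 !add0r.
Qed.

Lemma bias_ge0 : 0 <= bias.
Proof. by rewrite addr_ge0 ?powR_ge0 ?sqr_ge0. Qed.

Lemma Cl_ge0 : 0 <= Cl pr.
Proof.
rewrite /Cl le_max; apply/orP; left.
by rewrite divr_ge0// mulr_ge0 ?powR_ge0// ltW// pLg_gt0.
Qed.

(** Two errors add up: the Taylor remainder of the link at the displaced point v + De, of order
    h^beta, and the part of the Taylor polynomial of order at least 2 in De, of order eta^2. *)
Lemma feat_approx t (j : 'I_N) w (xt := dotp (tr_x tr t) theta) : in_bin j w ->
  Beps <= xt <= B - Beps -> 0 <= p_hat tr t w <= B -> `|u_hat tr t - xt| <= eta ->
  `|g (p_hat tr t w - xt) - dotp (feat tr t j w) (z_true j)| <= Cl pr * bias.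
Proof.
move=> /in_binP /andP[v0 vh] /andP[x1 x2] /andP[p1 p2] ue.
have B0 := pB_gt0 pr; have b1 := pbeta_ge1 pr.
have vB := le_trans vh hbin_le; have eh := le_trans ue eta_le.
rewrite feat_dotp -/xt; set v := w - knot tu j in v0 vh vB *.
set De := u_hat tr t - xt in ue eh *.
have kj := knot_in (ltnW (ltn_ord j)).
have pE : p_hat tr t w - xt - knot tu j = v + De by rewrite /p_hat /v /De; ring.
have pI : - B + Beps <= p_hat tr t w - xt <= B - Beps by apply/andP; split; lra.
have T := link_taylor g_ok kj pI; rewrite pE in T.
set S := \sum_(k < m.+1) _ in T.
set S' := \sum_(k < m.+1) _.
have -> : g (p_hat tr t w - xt) - S' = (g (p_hat tr t w - xt) - S) + (S - S') by ring.
rewrite (le_trans (ler_normD _ _))// mulrDr; apply: lerD.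
  apply: le_trans T _.
  (* Both |v| and the pilot error are at most h, since eta <= h; the factor 2 becomes the 2^beta of
     [Cl]. *)
  have : `|v + De| <= 2 * h.
    by rewrite (le_trans (ler_normD _ _))// (ger0_norm v0); lra.
  move=> vD; apply: (@le_trans _ _ (L / (m`!)%:R * (2 * h) `^ beta)).
    apply: ler_wpM2l; first by rewrite divr_ge0// ltW// pLg_gt0.
    rewrite ge0_ler_powR ?nnegrE//; first lra.
    by rewrite mulr_ge0// ltW// hbin_gt0.
  rewrite powRM ?(ltW hbin_gt0)// mulrA ler_wpM2r ?powR_ge0// /Cl le_max.
  by apply/orP; left; rewrite mulrC mulrA.
have -> : S - S' = \sum_(k < m.+1) coef j k * ((v + De) ^+ k - v ^+ k - k%:R * v ^+ k.-1 * De).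
  by rewrite /S /S' -sumrB; apply: eq_bigr => k _; rewrite -/(coef j k); ring.
apply: (@le_trans _ _ (De ^+ 2 * (Cg * \sum_(k < m.+1)
   (2 ^+ k - k%:R - 1) * (2 * B) ^+ (k - 2) / (k`!)%:R))).
  rewrite !mulr_sumr (le_trans (ler_norm_sum _ _ _))// ler_sum// => k _.
  have km : (k <= m)%N by rewrite -ltnS.
  have DB : `|De| <= 2 * B by apply: le_trans eh _; exact: hbin_le.
  have vN : `|v| <= 2 * B by rewrite ger0_norm.
  have := ler_pM (normr_ge0 _) (normr_ge0 _) (coef_bound j km) (binomial_remainder k vN DB).
  by rewrite -normrM => /le_trans; apply; rewrite le_eqVlt; apply/orP; left; apply/eqP; ring.
rewrite mulrC sum_from2; apply: ler_pM.
- rewrite mulr_ge0 ?(Cg_ge0 g_ok)// sumr_ge0// => k _.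
  have k2 : k%:R + 1 <= 2 ^+ k :> R.
    elim: k => [|k IH]; first by rewrite expr0 add0r.
    by rewrite exprS -natr1; have : 0 <= k%:R :> R by []; lra.
  by rewrite divr_ge0// mulr_ge0 ?exprn_ge0//; lra.
- exact: sqr_ge0.
- by rewrite /Cl le_max lexx orbT.
- by rewrite -real_normK ?num_real// lerXn2r ?nnegrE// ltW// eta_gt0.
Qed.

End Features.

(** * Confidence widths along a good trajectory *)

Section Deterministic.
Context {R : realType} (pr : primitives R) (tu : tuning pr) (d : nat).
Variables (g : R -> R) (theta : 'cV[R]_d) (tr : trajectory R d (tN tu)) (pstar : nat -> R).
Local Notation B := (pB pr).
Local Notation Beps := (pBeps pr).
Local Notation D := (pD pr).
Local Notation m := (mord pr).
Local Notation N := (tN tu).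
Local Notation S := (nlayers tu).
Local Notation T := (tT tu).
Local Notation lam := (tlambda tu).
Local Notation delta := (tdelta tu).
Local Notation eta := (teta tu).
Local Notation bias := (hbin tu `^ pbeta pr + teta tu ^+ 2).
Local Notation dimf := (m.+1 + m * d)%N.
Local Notation x := (tr_x tr).
Local Notation y := (tr_y tr).
Local Notation xth t := (dotp (tr_x tr t) theta).
Local Notation iota_T := (iotaT d tu).
Local Notation gamma_T := (gammaT d tu).

(** A zero direction changes neither the Gram matrix nor the sum, so the pilot and all the layer
    regressions share the time index of the filtration. *)
Definition pilot_dir (i : nat) : 'cV[R]_d := if explore tr i then x i else 0.
Definition pilot_noise (i : nat) : R := (0 < y i)%R%:R - xth i / B.

Definition selected (s : nat) (j : 'I_N) (i : nat) : bool :=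
  [&& ~~ explore tr i, tr_s tr i == s & tr_j tr i == j].
Definition layer_dir (s : nat) (j : 'I_N) (i : nat) : 'cV[R]_dimf :=
  if selected s j i then feat tr i j (tr_w tr i) else 0.
Definition layer_noise (i : nat) : R := (y i - g (tr_p tr i - xth i)) / D.

Definition pilot_event : Prop := forall t, (t <= T)%N ->
  qform (invmx (gram_seq 1 pilot_dir t)) (\sum_(0 <= i < t) pilot_noise i *: pilot_dir i) <=
  2 * ln (4 / delta) + ln (\det (gram_seq 1 pilot_dir t) / 1 ^+ d).

Definition layer_event (s : nat) (j : 'I_N) : Prop := forall t, (t <= T)%N ->
  qform (invmx (gram_seq lam (layer_dir s j) t))
    (\sum_(0 <= i < t) layer_noise i *: layer_dir s j i) <=
  2 * ln (4 * S%:R * N%:R / delta) + ln (\det (gram_seq lam (layer_dir s j) t) / lam ^+ dimf).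

(** All that the regret analysis uses of one realization. Probability enters only through the
    confidence events [run_pilot] and [run_layer]. *)
Record run_ok : Prop := RunOk {
  run_dim : (0 < d)%N;
  run_link : link_ok pr g;
  run_theta : norm2 theta <= pCtheta pr;
  run_x : forall t, (t < T)%N -> norm2 (x t) <= pCx pr;
  run_value : forall t, (t < T)%N -> Beps <= xth t <= B - Beps;
  run_p : forall t, (t < T)%N -> 0 <= tr_p tr t <= B;
  run_policy : follows_policy tr;
  run_pstar : forall t, (t < T)%N ->
    argmax [set r | 0 <= r <= B] (fun r => r * g (r - xth t)) (pstar t);
  run_pilot : pilot_event;
  run_layer : forall s j, (1 <= s <= S)%N -> layer_event s j
}.

Lemma pilotE t : (pilot tr t).1 = gram_seq 1 pilot_dir t /\
  (pilot tr t).2 = \sum_(0 <= i < t) (B * (0 < y i)%R%:R) *: pilot_dir i.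
Proof.
elim: t => [|t [IM Ib]]; first by rewrite gram_seq0 big_geq.
rewrite gram_seqS big_nat_recr//= -IM -Ib /pilot_dir /explore.
case: (pilot tr t) => M b /=; case: ifP => _ //=.
by rewrite mul0mx scaler0 !addr0.
Qed.

Lemma pilot_spd t : spd (pilot tr t).1.
Proof. by rewrite (pilotE t).1; exact: gram_seq_spd. Qed.

Lemma PsiE t s j : Psi tr t s j = [seq i <- iota 0 t | selected s j i].
Proof.
elim: t => [//|t IH]; rewrite -addn1 iotaD filter_cat -IH add0n addn1 /=.
by rewrite -/(selected s j t); case: ifP => _; rewrite ?cats1 ?cats0.
Qed.

Lemma sum_Psi (V : nmodType) t s j (F : nat -> V) :
  \sum_(i <- Psi tr t s j) F i = \sum_(0 <= i < t | selected s j i) F i.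
Proof. by rewrite PsiE big_filter /index_iota subn0. Qed.

Lemma sum_layer_dir (c : nat -> R) t s j :
  \sum_(0 <= i < t) c i *: layer_dir s j i =
  \sum_(i <- Psi tr t s j) c i *: feat tr i j (tr_w tr i).
Proof.
rewrite sum_Psi [RHS]big_mkcond; apply: eq_bigr => i _.
by rewrite /layer_dir; case: ifP => // _; rewrite scaler0.
Qed.

Lemma rgramE t s j : rgram tr t s j = gram_seq lam (layer_dir s j) t.
Proof.
rewrite /rgram /gram_seq /gram sum_Psi [in LHS]big_mkcond; congr (_ + _).
by apply: eq_bigr => i _; rewrite /layer_dir; case: ifP => // _; rewrite mul0mx.
Qed.

Lemma lam_gt0 : 0 < lam. Proof. exact: tlambda_gt0. Qed.

Lemma rgram_spd t s j : spd (rgram tr t s j).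
Proof. by rewrite rgramE; exact: gram_seq_spd lam_gt0 _. Qed.

Lemma nlayers_ge1 : 1 <= S%:R :> R.
Proof. by rewrite ler1n /nlayers leq_max. Qed.

Lemma delta_gt0 : 0 < delta. Proof. by case/andP: (tdelta_itv tu). Qed.
Lemma delta_lt1 : delta < 1. Proof. by case/andP: (tdelta_itv tu). Qed.

Lemma ln4_ge : 3 / 4 <= ln 4 :> R.
Proof.
have := @ln_le_subr1 R 4^-1 _; rewrite invr_gt0 ltr0n => /(_ isT).
rewrite lnV ?posrE//; lra.
Qed.

Lemma confidence_ge4 : 4 <= 4 * S%:R * N%:R / delta.
Proof.
have s1 := nlayers_ge1; have n1 : 1 <= N%:R :> R by rewrite ler1n tN_gt0.
rewrite ler_pdivlMr ?delta_gt0// -mulrA ler_wpM2l//.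
apply: (@le_trans _ _ (1 * 1)); last by apply: ler_pM.
by rewrite mulr1 ltW// delta_lt1.
Qed.

Lemma ln_conf_ge1 : 1 <= 2 * ln (4 * S%:R * N%:R / delta).
Proof.
have c4 := confidence_ge4; have l4 := ln4_ge.
have : ln 4 <= ln (4 * S%:R * N%:R / delta) :> R.
  by rewrite ler_ln ?posrE//; lra.
by lra.
Qed.

Lemma ln_1T_ge0 : 0 <= ln (1 + T%:R / lam).
Proof. by rewrite ln_ge0// lerDl divr_ge0// ltW// lam_gt0. Qed.

Lemma iotaE : iota_T = 2 * ln (4 * S%:R * N%:R / delta) + dimf%:R * ln (1 + T%:R / lam).
Proof. by rewrite /iotaT addSn mulnDr muln1 [(m * d + m)%N]addnC. Qed.

(** Allows lone constants such as D to be absorbed into multiples of the root of [iotaT]. *)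
Lemma iota_ge1 : 1 <= iota_T.
Proof.
rewrite iotaE; have := ln_conf_ge1; have := ln_1T_ge0.
have : 0 <= dimf%:R :> R by [].
by move: (ln (1 + _)) (dimf%:R) => a b; nra.
Qed.

Lemma Cpsi2_ge1 : 1 <= Cpsi2 pr.
Proof.
rewrite /Cpsi2 -addrA lerDl addr_ge0//.
  by rewrite sumr_ge0// => k _; rewrite sqr_ge0.
rewrite mulr_ge0 ?sqr_ge0// sumr_ge0// => k _; rewrite mulr_ge0 ?sqr_ge0//.
by rewrite exprn_ge0// mulr_ge0// ltW// pB_gt0.
Qed.

Hypothesis ok : run_ok.

Lemma Cx_ge0 : 0 <= pCx pr.
Proof. exact: le_trans (norm2_ge0 _) (run_x ok (tT_gt0 tu)). Qed.

Lemma Ctheta_ge0 : 0 <= pCtheta pr.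
Proof. exact: le_trans (norm2_ge0 _) (run_theta ok). Qed.

Lemma gamma_gt0 : 0 < gamma_T.
Proof.
rewrite /gammaT ltr_pwDl ?Ctheta_ge0// mulr_gt0 ?pB_gt0// sqrtr_gt0.
have : ln 4 <= ln (4 / delta) :> R.
  rewrite ler_ln ?posrE ?divr_gt0 ?delta_gt0// ler_pdivlMr ?delta_gt0//.
  have := delta_lt1; lra.
have : 0 <= d%:R * ln (1 + T%:R * pCx pr ^+ 2 / d%:R) :> R.
  by rewrite mulr_ge0// ln_ge0// lerDl divr_ge0// mulr_ge0// sqr_ge0.
by have := ln4_ge; lra.
Qed.

Lemma pilot_dir_sqr i : (i < T)%N -> dotp (pilot_dir i) (pilot_dir i) <= pCx pr ^+ 2.
Proof.
move=> iT; rewrite /pilot_dir; case: ifP => _; last by rewrite dotp0 sqr_ge0.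
by rewrite -norm2_sqr lerXn2r ?nnegrE ?norm2_ge0 ?Cx_ge0 ?(run_x ok).
Qed.

Lemma ln_det_pilot_le t : (t <= T)%N ->
  ln (\det (gram_seq 1 pilot_dir t) / 1 ^+ d) <= d%:R * ln (1 + T%:R * pCx pr ^+ 2 / d%:R).
Proof.
move=> tT; have d0 := run_dim ok; have dR : 0 < d%:R :> R by rewrite ltr0n.
have aK i : (i < t)%N -> dotp (pilot_dir i) (pilot_dir i) <= pCx pr ^+ 2.
  by move=> it; apply: pilot_dir_sqr; exact: leq_trans tT.
apply: le_trans (ln_det_gram_le ltr01 d0 aK (sqr_ge0 _)) _; rewrite mulr1.
have f k : 0 < 1 + k%:R * pCx pr ^+ 2 / d%:R :> R.
  by rewrite ltr_pwDl// divr_ge0// mulr_ge0// sqr_ge0.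
rewrite ler_wpM2l// ler_ln ?posrE// lerD2l ler_wpM2r ?invr_ge0// ler_wpM2r ?sqr_ge0//.
by rewrite ler_nat.
Qed.

(** A response B 1{y > 0} is x^T theta plus B times the noise, so the error is M^-1 (B s - theta),
    with s the noise sum. The term theta comes from the identity regularization and costs
    C_theta. *)
Lemma pilot_confidence t : (t <= T)%N ->
  wnorm (pilot tr t).1 (theta_hat tr t - theta) <= gamma_T.
Proof.
move=> tT; have [ME bE] := pilotE t; have B0 := pB_gt0 pr.
rewrite /theta_hat ME bE; set V := gram_seq 1 pilot_dir t.
have sV : spd V by exact: gram_seq_spd ltr01 _.
have uV := spd_unitmx sV; set s := \sum_(0 <= i < t) pilot_noise i *: pilot_dir i.
have VE : V *m theta = theta + \sum_(0 <= i < t) xth i *: pilot_dir i.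
  rewrite /V /gram_seq mulmxDl mul1mx mulmx_suml; congr (_ + _).
  apply: eq_bigr => i _; rewrite outer_mul /pilot_dir; case: ifP => // _.
  by rewrite !scaler0.
have -> : invmx V *m (\sum_(0 <= i < t) (B * (0 < y i)%R%:R) *: pilot_dir i) - theta =
    invmx V *m (B *: s - theta).
  rewrite -[X in _ - X = _](mulKmx uV) -mulmxBr VE; congr (_ *m _).
  rewrite opprD [- theta - _]addrC addrA; congr (_ - _).
  rewrite /s scaler_sumr -sumrB; apply: eq_bigr => i _.
  rewrite scalerA -scalerBl /pilot_noise; congr (_ *: _).
  by field; rewrite gt_eqF.
have -> : wnorm V (invmx V *m (B *: s - theta)) = wnorm (invmx V) (B *: s - theta).
  by rewrite !wnormE !qformE mulKVmx// dotpC.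
apply: le_trans (wnorm_triangle _ _ (spd_invmx sV)) _; rewrite wnormN wnormZ gtr0_norm//.
rewrite /gammaT; apply: lerD.
  rewrite ler_wpM2l ?(ltW B0)// wnormE ler_wsqrtr//.
  apply: le_trans (run_pilot ok tT) _.
  by rewrite addrC lerD2r ln_det_pilot_le.
apply: le_trans (run_theta ok); rewrite /norm2 !wnormE ler_wsqrtr//.
apply: le_trans (qform_invmx_gram_le _ ltr01 _ _) _.
by rewrite invr1 mul1r qformE mul1mx.
Qed.

Lemma xth_in t : (t < T)%N -> 0 <= xth t <= B.
Proof.
move=> tT; have /andP[] := run_value ok tT; have /andP[] := pBeps_itv pr.
by move=> *; apply/andP; split; lra.
Qed.

(** Clipping is 1-Lipschitz and fixes the true value; the failed exploration test then bounds the
    product of the two dual norms by eta. *)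
Lemma u_hat_error t : (t < T)%N -> ~~ explore tr t -> `|u_hat tr t - xth t| <= eta.
Proof.
move=> tT; rewrite /explore /explores -leNgt => ex.
have /andP[x0 xB] := xth_in tT.
have {1}-> : xth t = proj 0 B (xth t) by rewrite /proj max_r// min_r.
rewrite /u_hat /proj; apply: le_trans (ler_dist_min _ _ _) _.
apply: le_trans (ler_dist_max _ _ _) _.
rewrite -dotpNr -dotpDr; apply: le_trans (dotp_le_wnorm _ _ (pilot_spd t)) _.
apply: le_trans ex; rewrite mulrC ler_wpM2r ?sqrtr_ge0//.
exact: pilot_confidence (ltnW tT).
Qed.

Lemma selected_LDP s j i : (i < T)%N -> selected s j i ->
  [/\ ~~ explore tr i, tr_s tr i = s, tr_j tr i = j &
    layered_choice tr i /\ tr_p tr i = p_hat tr i (tr_w tr i)].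
Proof.
move=> iT /and3P[ex /eqP si /eqP ji]; split=> //.
exact: (run_policy ok iT ex).
Qed.

Lemma actions_initial t s c : (0 < s)%N -> actions tr t s c -> initial_actions tr t c.
Proof.
case: s => // s _; elim: s => [//|s IH] in c *.
by move=> [] /IH.
Qed.

Lemma choice_actions t : layered_choice tr t ->
  actions tr t (tr_s tr t) (tr_j tr t, tr_w tr t).
Proof. by move=> [_ _]; case: ifP => _ => [[]|[_ [[]]]]. Qed.

Lemma choice_initial t : layered_choice tr t ->
  initial_actions tr t (tr_j tr t, tr_w tr t).
Proof.
by move=> ch; apply: actions_initial (choice_actions ch); have [/andP[]] := ch.
Qed.

Lemma layer_dir_sqr s j i : (i < T)%N -> dotp (layer_dir s j i) (layer_dir s j i) <= Cpsi2 pr.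
Proof.
move=> iT; rewrite /layer_dir; case: ifPn => [sel|_]; last first.
  by rewrite dotp0 (le_trans ler01)// Cpsi2_ge1.
have [_ _ jE [ch _]] := selected_LDP iT sel.
have [_ + _] := choice_initial ch; rewrite /= jE => wj.
exact: feat_sqr_le (run_x ok iT) wj.
Qed.

Lemma ln_det_layer_le s j t : (t <= T)%N ->
  ln (\det (gram_seq lam (layer_dir s j) t) / lam ^+ dimf) <=
  Cpsi2 pr * (dimf%:R * ln (1 + T%:R / lam)).
Proof.
move=> tT; have l0 := lam_gt0; have n0 : (0 < dimf)%N by rewrite addSn.
have nR : 0 < dimf%:R :> R by rewrite ltr0n.
have C1 := Cpsi2_ge1; have C0 : 0 <= Cpsi2 pr by lra.
have aK i : (i < t)%N -> dotp (layer_dir s j i) (layer_dir s j i) <= Cpsi2 pr.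
  by move=> it; apply: layer_dir_sqr; exact: leq_trans tT.
apply: le_trans (ln_det_gram_le l0 n0 aK C0) _.
rewrite mulrCA ler_wpM2l//.
have TL : 0 <= T%:R / lam by rewrite divr_ge0// ltW.
apply: le_trans (ln_1DM_le C1 TL).
have q : 0 <= t%:R * Cpsi2 pr / (dimf%:R * lam) by rewrite divr_ge0 ?mulr_ge0// ltW.
have q' := mulr_ge0 C0 TL.
rewrite ler_ln ?posrE; [|by rewrite ltr_pwDl|by rewrite ltr_pwDl].
rewrite lerD2l ler_pdivrMr ?mulr_gt0//.
have -> : Cpsi2 pr * (T%:R / lam) * (dimf%:R * lam) = T%:R * Cpsi2 pr * dimf%:R.
  by field; rewrite gt_eqF.
apply: (@le_trans _ _ (T%:R * Cpsi2 pr)); first by rewrite ler_wpM2r// ler_nat.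
by rewrite ler_peMr ?mulr_ge0// ler1n.
Qed.

(** The log-determinant is at most Cpsi^2 times the dimension part of [iotaT]; the confidence part
    is merely enlarged by Cpsi^2 >= 1, so that a single factor comes out of the root. *)
Lemma layer_noise_le s j t : (1 <= s <= S)%N -> (t <= T)%N ->
  wnorm (invmx (rgram tr t s j))
    (\sum_(i <- Psi tr t s j) (y i - g (tr_p tr i - xth i)) *: feat tr i j (tr_w tr i)) <=
  Cpsi pr * D * Num.sqrt iota_T.
Proof.
move=> sS tT; have D0 := pD_gt0 pr; have C1 := Cpsi2_ge1.
have -> : \sum_(i <- Psi tr t s j) (y i - g (tr_p tr i - xth i)) *: feat tr i j (tr_w tr i) =
   D *: \sum_(0 <= i < t) layer_noise i *: layer_dir s j i.
  rewrite sum_layer_dir scaler_sumr; apply: eq_bigr => i _.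
  by rewrite scalerA /layer_noise mulrC divfK// gt_eqF.
rewrite wnormZ gtr0_norm// [Cpsi pr * D]mulrC -mulrA ler_wpM2l ?(ltW D0)//.
rewrite /Cpsi -sqrtrM; last by lra.
rewrite wnormE ler_wsqrtr// rgramE.
have h := run_layer ok j sS tT; apply: le_trans h _.
rewrite iotaE mulrDr; apply: lerD; last exact: ln_det_layer_le.
by rewrite ler_peMl//; have := ln_conf_ge1; lra.
Qed.

Lemma g_in u : 0 <= g u <= D. Proof. by have [+ _ _] := run_link ok; apply. Qed.

Lemma g_hat_error t s (c : 'I_N * R) : (t < T)%N -> ~~ explore tr t -> (1 <= s <= S)%N ->
  initial_actions tr t c ->
  `|g (p_hat tr t c.2 - xth t) - g_hat tr t s c.1 c.2| <= radius tr t s c.1 c.2.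
Proof.
move=> tT ex sS [_ bc pc]; case: c bc pc => j w /= bc pc.
have /andP[g0 gD] := g_in (p_hat tr t w - xth t); have D0 := pD_gt0 pr.
have triv : `|g (p_hat tr t w - xth t) - g_hat tr t s j w| <= D.
  have : 0 <= g_hat tr t s j w <= D.
    by rewrite /g_hat /proj le_min (ltW D0) le_max lexx /= ge_min lexx.
  by move=> /andP[h0 hD]; rewrite ler_norml; apply/andP; split; lra.
rewrite /radius; case Ps : (Psi tr t s j) => [//|i0 r0]; rewrite -Ps.
rewrite le_min triv /=.
have -> : g (p_hat tr t w - xth t) = proj 0 D (g (p_hat tr t w - xth t)).
  by rewrite /proj max_r// min_r.
rewrite /g_hat /proj; apply: le_trans (ler_dist_min _ _ _) _.
apply: le_trans (ler_dist_max _ _ _) _.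
have ap := feat_approx (run_link ok) bc (run_value ok tT) pc (u_hat_error tT ex).
set z := z_true g theta j in ap.
(* Split into the approximation error of the queried action and the estimation error of its linear
   part. *)
rewrite (_ : _ - _ = (g (p_hat tr t w - xth t) - dotp (feat tr t j w) z) -
  (dotp (feat tr t j w) (z_hat tr t s j) - dotp (feat tr t j w) z)); last by ring.
rewrite -[X in _ <= X + _]mulrDl.
apply: le_trans (ler_normB _ _) _; rewrite addrC; apply: lerD; last exact: ap.
pose e i := g (tr_p tr i - xth i) - dotp (feat tr i j (tr_w tr i)) z.
pose xi i := y i - g (tr_p tr i - xth i).
have iP i : i \in Psi tr t s j -> (i < T)%N /\ selected s j i.
  rewrite PsiE mem_filter mem_iota add0n => /and3P[-> _ it]; split=> //.
  exact: ltn_trans tT.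
have := @ridge_error _ _ lam _ (Psi tr t s j) (fun i => feat tr i j (tr_w tr i))
  lam_gt0 (rgram_spd t s j) (feat tr t j w) z y e xi (Cl pr * bias) (Cz pr).
rewrite -/(gram tr t s j) -/(rgram tr t s j) -/(z_hat tr t s j) => H.
apply: le_trans (H _ _ _) _.
- by move=> i _; rewrite /e /xi; ring.
- move=> i /iP[iT sel]; have [exi si ji [ch pE]] := selected_LDP iT sel.
  have [_ bi pi] := choice_initial ch; rewrite /e pE; rewrite /= ji in bi.
  have h := feat_approx (run_link ok) bi (run_value ok iT) pi (u_hat_error iT exi); exact: h.
- exact: norm2_z_true (run_link ok) (run_theta ok) j.
rewrite mulrC ler_wpM2r ?sqrtr_ge0// lerD2r; apply: lerD; last by rewrite mulrC.
exact: layer_noise_le sS (ltnW tT).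
Qed.

End Deterministic.

(** * Regret along a good trajectory *)

Lemma finite_argmax (R : realType) (C : eqType) (L : seq C) (P : C -> Prop) (f : C -> R) :
  (exists2 c, c \in L & P c) ->
  exists c, P c /\ forall c', c' \in L -> P c' -> f c' <= f c.
Proof.
elim: L => [[]//|a L IH] [c]; have [/IH [c0 [P0 M0]] _ _|nex] :=
    pselect (exists2 c, c \in L & P c); last first.
  rewrite inE => /predU1P[->|cL] Pc; last by exfalso; apply: nex; exists c.
  exists a; split=> // c'; rewrite inE => /predU1P[->//|cL'] Pc'.
  by exfalso; apply: nex; exists c'.
have [[Pa ac]|na] := pselect (P a /\ f c0 <= f a).
  exists a; split=> // c'; rewrite inE => /predU1P[->//|cL'] Pc'.
  exact: le_trans (M0 _ cL' Pc') ac.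
exists c0; split=> // c'; rewrite inE => /predU1P[->|cL'] Pc'; last exact: M0.
by have [//|/ltW ca] := leP (f a) (f c0); exfalso; apply: na.
Qed.

Section Layers.
Context {R : realType} (pr : primitives R) (tu : tuning pr) (d : nat).
Variables (g : R -> R) (theta : 'cV[R]_d) (tr : trajectory R d (tN tu)) (pstar : nat -> R).
Local Notation B := (pB pr).
Local Notation Beps := (pBeps pr).
Local Notation D := (pD pr).
Local Notation N := (tN tu).
Local Notation S := (nlayers tu).
Local Notation T := (tT tu).
Local Notation rT := (Num.sqrt (tT tu)%:R : R).
Local Notation xth t := (dotp (tr_x tr t) theta).
Hypothesis ok : run_ok g theta tr pstar.

Definition rev (t : nat) (p : R) : R := p * g (p - xth t).

Lemma rev_in t p : 0 <= p <= B -> 0 <= rev t p <= B * D.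
Proof.
move=> /andP[p0 pB]; have /andP[g0 gD] := g_in ok (p - xth t).
by rewrite /rev mulr_ge0//= ler_pM.
Qed.

Lemma LRev_ge0 : 0 <= LRev pr.
Proof.
by rewrite /LRev addr_ge0 ?(ltW (pD_gt0 pr))// mulr_ge0 ?(ltW (pB_gt0 pr))// le_max (ltW (pLg_gt0 pr)).
Qed.

Lemma rev_lipschitz t p p' : (t < T)%N -> 0 <= p <= B -> 0 <= p' <= B ->
  `|rev t p - rev t p'| <= LRev pr * `|p - p'|.
Proof.
move=> tT /andP[p0 pB] /andP[p'0 p'B]; have /andP[x1 x2] := run_value ok tT.
have pI : - B + Beps <= p - xth t <= B - Beps by apply/andP; split; lra.
have pI' : - B + Beps <= p' - xth t <= B - Beps by apply/andP; split; lra.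
have := link_lipschitz (run_link ok) pI pI'.
rewrite (_ : p - xth t - (p' - xth t) = p - p'); last by ring.
have /andP[g0 gD] := g_in ok (p - xth t).
move=> h; rewrite (_ : rev t p - rev t p' =
  (p - p') * g (p - xth t) + p' * (g (p - xth t) - g (p' - xth t))); last by rewrite /rev; ring.
apply: le_trans (ler_normD _ _) _; rewrite /LRev [leRHS]mulrDl; apply: lerD.
  by rewrite normrM mulrC ler_wpM2r// ger0_norm.
by rewrite normrM (ger0_norm p'0) -mulrA ler_pM.
Qed.

Lemma rT_gt0 : 0 < rT. Proof. by rewrite sqrtr_gt0 ltr0n tT_gt0. Qed.

Lemma exists_bin w : - B <= w <= B -> exists j : 'I_N, in_bin j w.
Proof.
move=> /andP[w1 w2]; have B0 := pB_gt0 pr; have n0 := N_gt0 tu; have h0 := hbin_gt0 tu.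
pose v := (w + B) / hbin tu.
have v0 : 0 <= v by rewrite divr_ge0 ?(ltW h0)//; lra.
have vN : v <= N%:R.
  rewrite ler_pdivrMr// /hbin mulrC divfK ?gt_eqF//; lra.
have wE : w = - B + v * hbin tu by rewrite /v divfK ?gt_eqF//; ring.
have kE (k : nat) : knot tu k = - B + k%:R * hbin tu.
  by rewrite /knot /hbin; ring.
have /andP[i1 i2] := truncn_itv v0.
have [iN|iN] := ltnP (Num.truncn v) N.
  exists (Ordinal iN); rewrite /in_bin !kE wE /= !lerD2l ltrD2l.
  rewrite !ler_pM2r// ltr_pM2r// i1 i2 (ltW i2) /=; by case: ifP.
(* The remaining point is w = B, which belongs to the last bin because that bin is closed. *)
have NP : (N.-1 < N)%N by rewrite prednK ?tN_gt0.
have vE : v = N%:R by apply/eqP; rewrite eq_le vN /= (le_trans _ i1)// ler_nat.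
exists (Ordinal NP); rewrite /in_bin /= prednK ?tN_gt0// eqxx !kE wE vE !lerD2l.
by rewrite !ler_pM2r// lexx andbT ler_nat leq_pred.
Qed.

(** The ideal offset p - u_hat is rounded towards 0, which keeps the price between p and u_hat and
    hence in [0, B]. Rounding that would pass 0 stops there, so 0 has to be a grid point. *)
Lemma discretization t p : (t < T)%N -> 0 <= p <= B ->
  exists2 c, initial_actions tr t c & `|p_hat tr t c.2 - p| <= rT^-1.
Proof.
move=> tT /andP[p0 pB]; have B0 := pB_gt0 pr; have r0 := rT_gt0.
have /andP[u0 uB] := u_hat_in tr t; pose ws := p - u_hat tr t.
have rV : 0 < rT^-1 by rewrite invr_gt0.
suff [w [gw wB pw wd]] : exists w, [/\ in_grid tu w, - B <= w <= B,
    0 <= u_hat tr t + w <= B & `|w - ws| <= rT^-1].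
  have [j jw] := exists_bin wB; exists (j, w) => //=.
  by rewrite /p_hat (_ : _ - p = w - ws)// /ws; ring.
pose k := Num.truncn ((ws + B) * rT).
have a0 : 0 <= (ws + B) * rT by rewrite mulr_ge0 ?(ltW r0)// /ws; lra.
have /andP[k1 k2] := truncn_itv a0; rewrite -/k in k1 k2.
have {}k1 : k%:R * rT^-1 <= ws + B by rewrite ler_pdivrMr.
have {}k2 : ws + B < k%:R * rT^-1 + rT^-1.
  by rewrite -[X in _ < _ + X]mul1r -mulrDl natr1 ltr_pdivlMr.
have grid (i : nat) : i%:R * rT^-1 <= 2 * B -> in_grid tu (- B + i%:R * rT^-1).
  move=> iB; left; exists i => //; rewrite truncn_ge_nat ?mulr_ge0 ?(ltW r0)//; last lra.
  by rewrite -ler_pdivrMr.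
have g00 : in_grid tu 0 by right; left.
have kr0 : 0 <= k%:R * rT^-1 by rewrite mulr_ge0 ?(ltW rV).
have [w0|w0] := leP 0 ws.
  have [e|e] := leP 0 (- B + k%:R * rT^-1).
    exists (- B + k%:R * rT^-1); split; first by apply: grid; rewrite /ws in k1; lra.
    - by apply/andP; rewrite /ws in k1; split; lra.
    - by apply/andP; rewrite /ws in k1; split; lra.
    - by rewrite ler_norml; apply/andP; split; lra.
  exists 0; split=> //; first by apply/andP; split; lra.
    by rewrite addr0 u0.
  by rewrite ler_norml; apply/andP; split; lra.
have kS : k.+1%:R * rT^-1 = k%:R * rT^-1 + rT^-1 by rewrite -natr1 mulrDl mul1r.
have [e|e] := leP (- B + k.+1%:R * rT^-1) 0.
  exists (- B + k.+1%:R * rT^-1); split; first by apply: grid; lra.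
  - by apply/andP; rewrite kS; split; lra.
  - by apply/andP; rewrite /ws in k2; rewrite kS in e *; split; lra.
  - by rewrite kS ler_norml; apply/andP; split; lra.
exists 0; split=> //; first by apply/andP; split; lra.
  by rewrite addr0 u0.
by rewrite ler_norml; apply/andP; rewrite kS in e; split; lra.
Qed.

Definition rev_action (t : nat) (c : 'I_N * R) : R := rev t (p_hat tr t c.2).

(** The optimal price need not be on the grid. The best of the finitely many grid actions is the
    comparator that the layers can keep alive, at a discretization cost per round. *)
Lemma best_action t : (t < T)%N -> exists c, [/\ initial_actions tr t c,
  forall c', initial_actions tr t c' -> rev_action t c' <= rev_action t c &
  rev t (pstar t) - rev_action t c <= LRev pr / rT].
Proof.
move=> tT; have [[/andP[ps0 psB] _]] := (run_pstar ok tT : argmax _ _ _).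
have ps : 0 <= pstar t <= B by rewrite ps0.
have [c0 ic0 cd] := discretization tT ps.
pose K := Num.truncn (2 * B * rT).
have [G inG] : exists G : seq R, forall w, in_grid tu w -> w \in G.
  exists ([:: 0; B] ++ [seq - B + k%:R * rT^-1 | k <- iota 0 K.+1]) => w.
  rewrite mem_cat => -[[k kK ->]|[->|->]]; last 2 first.
  - by rewrite mem_head.
  - by rewrite !inE eqxx orbT.
  apply/orP; right; apply: (map_f (fun k : nat => - B + k%:R * rT^-1)).
  by rewrite mem_iota add0n ltnS.
pose L := [seq (j, w) | j <- enum 'I_N, w <- G].
have inL c : initial_actions tr t c -> c \in L.
  case: c => j w [/= gw _ _]; apply/allpairsP; exists (j, w) => /=.
  by rewrite mem_enum; split=> //; exact: inG.
have [|c [ic cmax]] := @finite_argmax R _ L (initial_actions tr t) (rev_action t).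
  by exists c0 => //; exact: inL.
exists c; split=> // [c' ic'|]; first by apply: cmax => //; exact: inL.
have h1 := cmax c0 (inL _ ic0) ic0.
have [_ _ pc0] := ic0.
have := rev_lipschitz tT ps pc0; rewrite distrC in cd.
have := ler_wpM2l LRev_ge0 cd; have := ler_norm (rev t (pstar t) - rev t (p_hat tr t c0.2)).
rewrite /rev_action in h1 *; lra.
Qed.

Lemma ucb_bounds t s c : (t < T)%N -> ~~ explore tr t -> (1 <= s <= S)%N ->
  initial_actions tr t c ->
  rev_action t c <= ucb tr t s c <= rev_action t c + 2 * wid tr t s c.
Proof.
move=> tT ex sS ic; have := g_hat_error ok tT ex sS ic; have [_ _ /andP[p0 pB]] := ic.
rewrite /rev_action /rev /ucb /wid; have /andP[g0 gD] := g_in ok (p_hat tr t c.2 - xth t).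
rewrite ler_norml => /andP[e1 e2]; apply/andP; split.
  by rewrite ler_wpM2l// le_min gD /=; lra.
rewrite mulrCA -mulrDr ler_wpM2l// ge_min; apply/orP; right; lra.
Qed.

Lemma actionsS t s : (0 < s)%N -> actions tr t s.+1 = refine tr t s (actions tr t s).
Proof. by case: s. Qed.

Lemma pow2_gt0 s : 0 < 2 ^+ s :> R. Proof. by rewrite exprn_gt0. Qed.

Section OnePeriod.
Variables (t : nat) (c0 : 'I_N * R).
Hypothesis tT : (t < T)%N.
Hypothesis ex : ~~ explore tr t.
Hypothesis ic0 : initial_actions tr t c0.
Hypothesis c0max : forall c', initial_actions tr t c' -> rev_action t c' <= rev_action t c0.

(** An upper index exceeds the revenue of its action by at most twice the width, that is 2 B D 2^-s
    after a passed check. This is exactly the elimination threshold. *)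
Lemma best_survives s : (1 <= s <= S)%N -> (forall r, (1 <= r < s)%N -> precise tr t r) ->
  actions tr t s c0.
Proof.
elim: s => [//|[_ _ _|s IH]]; first exact: ic0.
move=> /andP[_ sS] pre; have s1S : (1 <= s.+1 <= S)%N by exact: ltnW sS.
have pre' r : (1 <= r < s.+1)%N -> precise tr t r.
  by move=> /andP[r1 rs]; apply: pre; rewrite r1; exact: ltnW.
have A := IH s1S pre'; rewrite actionsS//; split=> // c' A'.
have ic' : initial_actions tr t c' by exact: (actions_initial (ltn0Sn s) A').
have /andP[_ u'] := ucb_bounds tT ex s1S ic'.
have /andP[u0 _] := ucb_bounds tT ex s1S ic0.
have w' := pre s.+1 (ltnSn _) c' A'; have m' := c0max ic'.
have -> : B * D * (2 / 2 ^+ s.+1) = 2 * (B * D / 2 ^+ s.+1) by ring.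
lra.
Qed.

(** Surviving layer s - 1 costs its threshold 2 B D / 2^(s-1) plus twice a width B D / 2^(s-1), in
    total 8 B D / 2^s. In layer 1 the range B D of the revenue suffices. *)
Lemma layer_quality s c : (1 <= s <= S)%N -> (forall r, (1 <= r < s)%N -> precise tr t r) ->
  actions tr t s c -> rev_action t c0 - rev_action t c <= 8 * B * D / 2 ^+ s.
Proof.
have B0 := pB_gt0 pr; have D0 := pD_gt0 pr; have BD0 := mulr_gt0 B0 D0.
case: s => [//|[|s]] /andP[_ sS] pre A.
  have [_ _ pc0] := ic0; have [_ _ pc] := actions_initial (ltn0Sn 0) A.
  have /andP[_ r1] := rev_in t pc0; have /andP[r2 _] := rev_in t pc.
  rewrite expr1 /rev_action; have : 0 <= 3 * (B * D) by lra.
  lra.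
have s1S : (1 <= s.+1 <= S)%N by exact: ltnW sS.
have pre' r : (1 <= r < s.+1)%N -> precise tr t r.
  by move=> /andP[r1 rs]; apply: pre; rewrite r1; exact: ltnW.
have A0 := best_survives s1S pre'.
move: A; rewrite actionsS// => -[A /(_ _ A0) u0c].
have ic : initial_actions tr t c by exact: (actions_initial (ltn0Sn s) A).
have /andP[_ uc] := ucb_bounds tT ex s1S ic.
have /andP[u0 _] := ucb_bounds tT ex s1S ic0.
have wc := pre s.+1 (ltnSn _) c A.
have e1 : B * D * (2 / 2 ^+ s.+1) = 4 * (B * D / 2 ^+ s.+2).
  by rewrite [2 ^+ s.+2]exprS; field; rewrite gt_eqF// pow2_gt0.
have e2 : B * D / 2 ^+ s.+1 = 2 * (B * D / 2 ^+ s.+2).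
  by rewrite [2 ^+ s.+2]exprS; field; rewrite gt_eqF// pow2_gt0.
have e3 : 8 * B * D / 2 ^+ s.+2 = 8 * (B * D / 2 ^+ s.+2) by ring.
rewrite e1 in u0c; rewrite e2 in wc; rewrite e3; lra.
Qed.

End OnePeriod.

Lemma LDP_regret t : (t < T)%N -> ~~ explore tr t ->
  [/\ (1 <= tr_s tr t <= S)%N,
   rev t (pstar t) - rev t (tr_p tr t) <= LRev pr / rT + 8 * B * D / 2 ^+ tr_s tr t &
   (tr_s tr t < S)%N -> D / 2 ^+ tr_s tr t < radius tr t (tr_s tr t) (tr_j tr t) (tr_w tr t)].
Proof.
move=> tT ex; have [ch pE] := run_policy ok tT ex; have [sS pre last] := ch.
have B0 := pB_gt0 pr; split=> //.
  have [c0 [ic0 c0max c0star]] := best_action tT.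
  have := layer_quality tT ex ic0 c0max sS pre (choice_actions ch).
  by rewrite pE /rev_action /= in c0star *; lra.
move=> sltS; move: last; rewrite ltn_eqF// => -[_ [[_ /= wide] _]].
have [_ _ /andP[p0 pB]] := choice_initial ch.
move: wide; rewrite /wid /=; set r := radius _ _ _ _ _ => wide.
(* The price factor of the width is at most B, so a wide action has a large radius. *)
rewrite -(ltr_pM2l B0) mulrA; apply: (lt_le_trans wide).
have r0 : 0 <= r \/ r < 0 by case: (leP 0 r); [left|right].
case: r0 => [r0|r0]; first by rewrite ler_wpM2r.
have : p_hat tr t (tr_w tr t) * r <= 0 by rewrite mulr_ge0_le0// ltW.
have : 0 < B * D / 2 ^+ tr_s tr t by rewrite divr_gt0 ?pow2_gt0// mulr_gt0// pD_gt0.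
by move: wide; lra.
Qed.

Lemma explore_regret t : (t < T)%N -> rev t (pstar t) - rev t (tr_p tr t) <= B * D.
Proof.
move=> tT; have [psB _] := (run_pstar ok tT : argmax _ _ _).
have /andP[_ r1] := rev_in t psB; have /andP[r2 _] := rev_in t (run_p ok tT); lra.
Qed.

Lemma pow2_nlayers : rT <= 2 ^+ S.
Proof.
have r0 := rT_gt0; have l2 : 0 < ln 2 :> R by rewrite ln_gt0// ltr1n.
rewrite -ler_ln ?posrE ?pow2_gt0// lnXn// -[ln 2 *+ _]mulr_natl -ler_pdivrMr//.
have q0 : 0 <= ln rT / ln 2.
  rewrite divr_ge0 ?(ltW l2)// ln_ge0//.
  by rewrite -[leLHS]sqrtr1 ler_wsqrtr// ler1n tT_gt0.
apply: le_trans (ceil_ge _) _.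
have c0 : 0 <= Num.ceil (ln rT / ln 2) by rewrite ceil_ge0 (lt_le_trans _ q0)// ltrN10.
rewrite /nlayers -{1}(gez0_abs c0) -pmulrn ler_nat.
by rewrite leq_max leqnn orbT.
Qed.

End Layers.

Section Peeling.
Context {R : realType}.

(** Avoids a factor counting the layers. Before the sequences cross, the increasing one sums to at
    most A 2^n; after that, the invariant reserves 2 C / 2^n, the whole remaining tail of the
    decreasing one. *)
Lemma geometric_peeling (A C : R) n : 0 <= A -> 0 <= C ->
  \sum_(0 <= s < n) Num.min (A * 2 ^+ s) (C / 2 ^+ s) <= 4 * Num.sqrt (A * C).
Proof.
move=> A0 C0; set q := Num.sqrt (A * C).
have q0 : 0 <= q by exact: sqrtr_ge0.
have q2 : q ^+ 2 = A * C by rewrite sqr_sqrtr// mulr_ge0.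
pose Sm n := \sum_(0 <= s < n) Num.min (A * 2 ^+ s) (C / 2 ^+ s).
suff [H1 H2] : Sm n <= A * 2 ^+ n /\ (C <= A * (2 ^+ n * 2 ^+ n) -> Sm n + 2 * (C / 2 ^+ n) <= 4 * q).
  have p0 : 0 < 2 ^+ n :> R by rewrite exprn_gt0.
  have [/H2 h|h] := leP C (A * (2 ^+ n * 2 ^+ n)).
    have : 0 <= C / 2 ^+ n by rewrite divr_ge0// ltW.
    by rewrite -/(Sm n); lra.
  apply: le_trans H1 _; apply: (@le_trans _ _ q); last by lra.
  rewrite -[leLHS]ger0_norm ?mulr_ge0 ?(ltW p0)// -sqrtr_sqr ler_wsqrtr//.
  rewrite (_ : (A * 2 ^+ n) ^+ 2 = A * (A * (2 ^+ n * 2 ^+ n))); last by ring.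
  by rewrite ler_wpM2l// ltW.
elim: n => [|n [H1 H2]].
  rewrite /Sm big_geq// expr0 mulr1; split=> //; rewrite !mulr1 divr1 add0r => CA.
  suff : C <= q by lra.
  by rewrite -[leLHS]ger0_norm// -sqrtr_sqr ler_wsqrtr// expr2 ler_wpM2r.
have p0 : 0 < 2 ^+ n :> R by rewrite exprn_gt0.
have SmS : Sm n.+1 = Sm n + Num.min (A * 2 ^+ n) (C / 2 ^+ n) by rewrite /Sm big_nat_recr.
have m1 : Num.min (A * 2 ^+ n) (C / 2 ^+ n) <= A * 2 ^+ n by rewrite ge_min lexx.
have m2 : Num.min (A * 2 ^+ n) (C / 2 ^+ n) <= C / 2 ^+ n by rewrite ge_min lexx orbT.
have G1 : Sm n.+1 <= A * 2 ^+ n.+1 by rewrite SmS exprS; lra.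
split=> // CA.
have e : C / 2 ^+ n.+1 = C / 2 ^+ n / 2 by rewrite exprS; field; rewrite gt_eqF.
have [/H2 h|h] := leP C (A * (2 ^+ n * 2 ^+ n)); first by rewrite SmS e; lra.
rewrite e; apply: le_trans (lerD G1 (lexx _)) _; rewrite exprS.
suff : 2 * (A * 2 ^+ n) + C / 2 ^+ n <= 4 * q by lra.
(* At the crossing a <= c <= 4 a, which yields (2 a + c)^2 <= 16 a c. *)
set a := A * 2 ^+ n; set c := C / 2 ^+ n.
have ac : A * C = a * c by rewrite /a /c; field; rewrite gt_eqF.
have a0 : 0 <= a by rewrite mulr_ge0// ltW.
have c0 : 0 <= c by rewrite divr_ge0// ltW.
have h1 : a <= c by rewrite /a /c ler_pdivlMr// -mulrA ltW.
have h2 : c <= 4 * a.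
  rewrite /a /c ler_pdivrMr//; move: CA; rewrite exprS.
  by move: (2 ^+ n) => p; lra.
have : (2 * a + c) ^+ 2 <= (4 * q) ^+ 2 by rewrite exprMn q2 ac; nra.
by rewrite ler_pXn2r// nnegrE; lra.
Qed.

End Peeling.

Section TotalRegret.
Context {R : realType} (pr : primitives R) (tu : tuning pr) (d : nat).
Variables (g : R -> R) (theta : 'cV[R]_d) (tr : trajectory R d (tN tu)) (pstar : nat -> R).
Local Notation B := (pB pr).
Local Notation gamma_T := (gammaT d tu).
Local Notation N := (tN tu).
Local Notation S := (nlayers tu).
Local Notation T := (tT tu).
Local Notation rT := (Num.sqrt (tT tu)%:R : R).
Local Notation D := (pD pr).
Local Notation lam := (tlambda tu).
Local Notation bias := (hbin tu `^ pbeta pr + teta tu ^+ 2).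
Local Notation iota_T := (iotaT d tu).
Local Notation rev := (rev g theta tr).
Hypothesis ok : run_ok g theta tr pstar.

Let al := Cpsi pr * D * Num.sqrt iota_T + Cz pr * Num.sqrt lam.
Let sq := Num.sqrt (2 * Cpsi2 pr * iota_T).
(** The radii of n visits to a bin sum to at most K sqrt n + b n: K collects noise, regularization
    and the first visit, b the approximation error; [sq] comes from the elliptical potential. *)
Definition Kconst : R := al * sq + D.
Definition bconst : R := Cl pr * bias * (1 + sq).
Local Notation K := Kconst.
Local Notation b := bconst.

Lemma Cz_ge0 : 0 <= Cz pr.
Proof.
have j : 'I_N := Ordinal (tN_gt0 tu).
exact: le_trans (norm2_ge0 _) (norm2_z_true (run_link ok) (run_theta ok) j).
Qed.

Lemma Cpsi_ge1 : 1 <= Cpsi pr.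
Proof. by rewrite /Cpsi -[leLHS]sqrtr1 ler_wsqrtr// Cpsi2_ge1. Qed.

Lemma sqrt_iota_ge1 : 1 <= Num.sqrt iota_T.
Proof. by rewrite -[leLHS]sqrtr1 ler_wsqrtr// iota_ge1. Qed.

Lemma al_ge : D <= al.
Proof.
have D0 := pD_gt0 pr; have h1 := Cpsi_ge1; have h2 := sqrt_iota_ge1.
have : 0 <= Cz pr * Num.sqrt lam by rewrite mulr_ge0 ?Cz_ge0 ?sqrtr_ge0.
have : D <= Cpsi pr * D * Num.sqrt iota_T.
  by rewrite [Cpsi pr * D]mulrC -mulrA ler_peMr ?(ltW D0)// -[1]mulr1 ler_pM.
by rewrite /al; lra.
Qed.

Lemma Kconst_ge0 : 0 <= K.
Proof.
have D0 := pD_gt0 pr; have := al_ge; rewrite /K => a0.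
by rewrite addr_ge0 ?(ltW D0)// mulr_ge0 ?sqrtr_ge0//; lra.
Qed.

Lemma bconst_ge0 : 0 <= b.
Proof.
by rewrite /b !mulr_ge0 ?Cl_ge0 ?addr_ge0 ?powR_ge0 ?sqr_ge0 ?sqrtr_ge0.
Qed.

Section OneBin.
Variables (s : nat) (j : 'I_N).
Let n := size (Psi tr T s j).
Let potl (i : nat) := pot lam (layer_dir tr s j) i.
Let lbar (i : nat) := Num.sqrt (Num.min 1 (potl i)).

Lemma size_Psi_le i : (i <= T)%N -> (size (Psi tr i s j) <= n)%N.
Proof.
move=> iT; rewrite /n !PsiE -(subnKC iT) iotaD filter_cat size_cat.
exact: leq_addr.
Qed.

(** Only the first visit meets an empty index set, so the default radius D is paid at most once per
    bin. *)
Lemma first_visits t :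
  \sum_(i <- Psi tr t s j) (Psi tr i s j == [::])%:R = (Psi tr t s j != [::])%:R :> R.
Proof.
elim: t => [|t IH]; first by rewrite big_nil.
rewrite /=; case: ifP => _; last exact: IH.
rewrite -cats1 big_cat /= IH big_seq1; case: (Psi tr t s j) => [|a l] /=.
  by rewrite add0r.
by rewrite addr0.
Qed.

Lemma potl_ge0 i : 0 <= potl i. Proof. exact: pot_ge0 (lam_gt0 tu) _. Qed.

Lemma radius_le i : (i < T)%N -> selected tr s j i ->
  radius tr i s j (tr_w tr i) <=
  D * (Psi tr i s j == [::])%:R + (al + Cl pr * bias * Num.sqrt n%:R) * lbar i + Cl pr * bias.
Proof.
move=> iT sel; have D0 := pD_gt0 pr; have a0 : 0 <= al by have := al_ge; lra.
have C0 : 0 <= Cl pr * bias by rewrite mulr_ge0 ?Cl_ge0// bias_ge0.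
have l0 : 0 <= lbar i by exact: sqrtr_ge0.
have s0 : 0 <= Num.sqrt n%:R :> R by exact: sqrtr_ge0.
have p0 := potl_ge0 i.
rewrite /radius; case Ps : (Psi tr i s j) => [|i0 r0].
  by rewrite eqxx mulr1 -addrA lerDl addr_ge0// mulr_ge0// addr_ge0// mulr_ge0.
have e0 : (i0 :: r0 == [::])%:R = 0 :> R by [].
rewrite e0 mulr0 add0r -Ps.
have lE : wnorm (invmx (rgram tr i s j)) (feat tr i j (tr_w tr i)) = Num.sqrt (potl i).
  by rewrite wnormE rgramE /potl /pot /layer_dir sel.
rewrite lE; have [p1|p1] := leP 1 (potl i).
  (* When the potential exceeds 1, the cap D on the radius is already at most [al]; this is why
     [lbar] may be truncated. *)
  apply: (@le_trans _ _ D); first by rewrite ge_min lexx.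
  have -> : lbar i = 1 by rewrite /lbar min_l// sqrtr1.
  rewrite mulr1; have := al_ge; have : 0 <= Cl pr * bias * Num.sqrt n%:R by exact: mulr_ge0.
  lra.
have -> : lbar i = Num.sqrt (potl i) by rewrite /lbar min_r// ltW.
rewrite ge_min; apply/orP; right; rewrite lerD2r [leRHS]mulrDl lerD2l.
rewrite ler_wpM2r ?sqrtr_ge0// ler_wpM2l// ler_wsqrtr// ler_nat.
exact: size_Psi_le (ltnW iT).
Qed.

Lemma mem_Psi t i : i \in Psi tr t s j -> (i < t)%N /\ selected tr s j i.
Proof. by rewrite PsiE mem_filter mem_iota add0n => /and3P[-> _ ->]. Qed.

Lemma lbar_sum : \sum_(i <- Psi tr T s j) lbar i <= Num.sqrt n%:R * sq.
Proof.
have -> : \sum_(i <- Psi tr T s j) lbar i = \sum_(i <- Psi tr T s j) `|lbar i|.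
  by apply: eq_bigr => i _; rewrite ger0_norm// sqrtr_ge0.
apply: le_trans (sum_norm_le_sqrt _ _) _; rewrite ler_wpM2l ?sqrtr_ge0// ler_wsqrtr//.
apply: (@le_trans _ _ (2 * \sum_(0 <= i < T) ln (1 + potl i))).
  rewrite sum_Psi big_mkcond mulr_sumr; apply: ler_sum => i _.
  have p0 := potl_ge0 i; have l0 : 0 <= ln (1 + potl i) by rewrite ln_ge0// lerDl.
  case: ifP => _; last by rewrite mulr_ge0.
  rewrite /lbar sqr_sqrtr ?minr1_le_ln//.
  by rewrite le_min ler01.
rewrite -mulrA ler_wpM2l// -(ln_det_gram _ (lam_gt0 tu)).
apply: le_trans (ln_det_layer_le ok s j (leqnn T)) _.
rewrite ler_wpM2l//; first by have := Cpsi2_ge1 pr; lra.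
by rewrite iotaE lerDr; have := ln_conf_ge1 tu; lra.
Qed.

Lemma bin_radius_sum :
  \sum_(i <- Psi tr T s j) radius tr i s j (tr_w tr i) <= K * Num.sqrt n%:R + b * n%:R.
Proof.
have D0 := pD_gt0 pr; have a0 : 0 <= al by have := al_ge; lra.
have C0 : 0 <= Cl pr * bias by rewrite mulr_ge0 ?Cl_ge0// bias_ge0.
have s0 : 0 <= Num.sqrt n%:R :> R by exact: sqrtr_ge0.
apply: (@le_trans _ _ (\sum_(i <- Psi tr T s j) (D * (Psi tr i s j == [::])%:R +
   (al + Cl pr * bias * Num.sqrt n%:R) * lbar i + Cl pr * bias))).
  rewrite big_seq [leRHS]big_seq; apply: ler_sum => i /mem_Psi[iT sel].
  exact: radius_le.
rewrite !big_split /= -mulr_sumr -[X in _ + X + _]mulr_sumr first_visits.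
have -> : \sum_(i <- Psi tr T s j) Cl pr * bias = Cl pr * bias * n%:R.
  by rewrite big_const_seq count_predT iter_addr addr0 mulr_natr.
have fv : (Psi tr T s j != [::])%:R <= Num.sqrt n%:R :> R.
  rewrite /n; case: (Psi tr T s j) => [|a l] /=; first exact: sqrtr_ge0.
  by rewrite -[leLHS]sqrtr1 ler_wsqrtr// ler1n.
have h1 := ler_wpM2l (ltW D0) fv.
have aC : 0 <= al + Cl pr * bias * Num.sqrt n%:R by rewrite addr_ge0// mulr_ge0.
have h2 := ler_wpM2l aC lbar_sum.
have nE : n%:R = Num.sqrt n%:R * Num.sqrt n%:R :> R by rewrite -expr2 sqr_sqrtr.
apply: le_trans (lerD (lerD h1 h2) (lexx _)) _.
rewrite le_eqVlt; apply/orP; left; apply/eqP; rewrite /K /b.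
set r := Num.sqrt n%:R in nE *; rewrite nE; ring.
Qed.

End OneBin.

Definition in_layer (s i : nat) : bool := ~~ explore tr i && (tr_s tr i == s).

Definition layer_count (s : nat) : R := \sum_(0 <= i < T | in_layer s i) 1.

Lemma layer_count_ge0 s : 0 <= layer_count s.
Proof. by apply: sumr_ge0. Qed.

Lemma sum_layer s (F : nat -> R) : \sum_(0 <= i < T | in_layer s i) F i =
  \sum_(j < N) \sum_(i <- Psi tr T s j) F i.
Proof.
rewrite (partition_big (tr_j tr) xpredT)//=; apply: eq_bigr => j _.
rewrite sum_Psi; apply: eq_bigl => i.
by rewrite /selected /in_layer andbA.
Qed.

Lemma layer_countE s : layer_count s = \sum_(j < N) (size (Psi tr T s j))%:R.
Proof.
rewrite /layer_count sum_layer; apply: eq_bigr => j _.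
by rewrite big_const_seq count_predT iter_addr addr0.
Qed.

(** Below the last layer every round has a radius above D / 2^s. The roots of the bin counts are
    merged by Cauchy-Schwarz over the N bins. *)
Lemma layer_radius s : (1 <= s < S)%N ->
  D / 2 ^+ s * layer_count s <= K * Num.sqrt (N%:R * layer_count s) + b * layer_count s.
Proof.
move=> /andP[s1 sS].
apply: (@le_trans _ _ (\sum_(0 <= i < T | in_layer s i) radius tr i s (tr_j tr i) (tr_w tr i))).
  rewrite /layer_count mulr_sumr big_nat_cond [leRHS]big_nat_cond.
  apply: ler_sum => i /andP[/andP[_ iT] /andP[ex /eqP si]]; rewrite mulr1.
  by have [_ _ +] := LDP_regret ok iT ex; rewrite si => /(_ sS)/ltW.
rewrite sum_layer.
apply: (@le_trans _ _ (\sum_(j < N) (K * Num.sqrt (size (Psi tr T s j))%:R + b * (size (Psi tr T s j))%:R))).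
  apply: ler_sum => j _; apply: le_trans (bin_radius_sum s j).
  rewrite big_seq [leRHS]big_seq le_eqVlt; apply/orP; left; apply/eqP.
  by apply: eq_bigr => i /mem_Psi[_ /and3P[_ _ /eqP ->]].
rewrite big_split /= -!mulr_sumr -layer_countE lerD2r ler_wpM2l ?Kconst_ge0//.
pose u (j : 'I_N) : R := Num.sqrt (size (Psi tr T s j))%:R.
have := sum_norm_le_sqrt (index_enum 'I_N) u.
have -> : size (index_enum 'I_N) = N by rewrite -[index_enum _]enumT size_enum_ord.
have -> : \sum_(j < N) `|u j| = \sum_(j < N) u j.
  by apply: eq_bigr => j _; rewrite ger0_norm ?sqrtr_ge0.
have -> : \sum_(j < N) u j ^+ 2 = layer_count s.
  by rewrite layer_countE; apply: eq_bigr => j _; rewrite sqr_sqrtr.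
by rewrite sqrtrM.
Qed.

Lemma sum_LDP (f : nat -> R) : (forall i, (i < T)%N -> ~~ explore tr i -> (1 <= tr_s tr i <= S)%N) ->
  \sum_(0 <= i < T | ~~ explore tr i) f (tr_s tr i) = \sum_(1 <= s < S.+1) f s * layer_count s.
Proof.
move=> sS; rewrite /layer_count.
under [RHS]eq_bigr do rewrite mulr_sumr big_mkcond.
rewrite exchange_big /= big_mkcond big_nat [RHS]big_nat; apply: eq_bigr => i /andP[_ iT].
rewrite /in_layer; case: ifPn => [ex|_]; last by rewrite big1.
rewrite (bigD1_seq (tr_s tr i)) ?iota_uniq ?mem_index_iota ?ltnS ?sS//= eqxx mulr1.
rewrite big1 ?addr0// => s si; by rewrite eq_sym (negbTE si).
Qed.

Lemma LDP_layers i : (i < T)%N -> ~~ explore tr i -> (1 <= tr_s tr i <= S)%N.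
Proof. by move=> iT ex; have [] := LDP_regret ok iT ex. Qed.

Lemma sum_const_le (P : pred nat) : \sum_(0 <= i < T | P i) 1 <= T%:R :> R.
Proof.
rewrite big_mkcond; apply: (@le_trans _ _ (\sum_(0 <= i < T) 1)).
  by apply: ler_sum => i _; case: ifP.
by rewrite big_const_nat subn0 iter_addr addr0.
Qed.

Lemma layer_count_sum : \sum_(1 <= s < S.+1) layer_count s <= T%:R.
Proof.
rewrite -[leLHS](_ : \sum_(1 <= s < S.+1) 1 * layer_count s = _); last first.
  by apply: eq_bigr => s _; rewrite mul1r.
by rewrite -(sum_LDP (fun=> 1) LDP_layers) sum_const_le.
Qed.

Lemma layer_count_le s : layer_count s <= T%:R.
Proof. exact: sum_const_le. Qed.

Local Notation Acst := (32 * B * K ^+ 2 * N%:R / D).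
Local Notation Ccst := (8 * B * D * T%:R).

(** If D / 2^s <= 2 b, a round costs at most 16 B b. Otherwise b n is at most half of the left side
    of [layer_radius], so n <= 4 K^2 N 4^s / D^2, which gives the term in 2^s; the trivial n <= T
    gives the other one. *)
Lemma layer_regret s : (1 <= s < S)%N ->
  8 * B * D / 2 ^+ s * layer_count s <=
  16 * B * b * layer_count s + Num.min (Acst * 2 ^+ s) (Ccst / 2 ^+ s).
Proof.
move=> sS; have h := layer_radius sS; set n := layer_count s in h *.
have B0 := pB_gt0 pr; have D0 := pD_gt0 pr; have B0' := ltW B0; have D0' := ltW D0; have p0 := pow2_gt0 s (R := R).
have n0 : 0 <= n by exact: layer_count_ge0.
have K0 := Kconst_ge0; have b0 := bconst_ge0.
have mn0 : 0 <= Num.min (Acst * 2 ^+ s) (Ccst / 2 ^+ s).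
  rewrite le_min; apply/andP; split.
    by rewrite mulr_ge0 ?(ltW p0)// divr_ge0 ?(ltW D0)// !mulr_ge0 ?sqr_ge0.
  by rewrite divr_ge0 ?(ltW p0)// !mulr_ge0.
have [bb|bb] := leP (D / 2 ^+ s) (2 * b).
  have : 8 * B * (D / 2 ^+ s) * n <= 8 * B * (2 * b) * n.
    by rewrite ler_wpM2r// ler_wpM2l// mulr_ge0.
  have -> : 8 * B * D / 2 ^+ s = 8 * B * (D / 2 ^+ s) by ring.
  by move: mn0; set mn := Num.min _ _; lra.
have c8 : 0 <= 8 * B * D / 2 ^+ s.
  by apply: divr_ge0 (ltW p0); have := mulr_gt0 B0 D0; lra.
have bn : 0 <= 16 * B * b * n by do 4?[apply: mulr_ge0 => //].
suff : 8 * B * D / 2 ^+ s * n <= Num.min (Acst * 2 ^+ s) (Ccst / 2 ^+ s) by lra.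
rewrite le_min; apply/andP; split; last first.
  rewrite [leRHS](_ : _ = 8 * B * D / 2 ^+ s * T%:R); last by ring.
  by rewrite ler_wpM2l ?layer_count_le//; lra.
set r := Num.sqrt n; have r0 : 0 <= r by exact: sqrtr_ge0.
have rn : n = r ^+ 2 by rewrite sqr_sqrtr.
set rN := Num.sqrt N%:R : R; have rN0 : 0 <= rN by exact: sqrtr_ge0.
have rNE : N%:R = rN ^+ 2 :> R by rewrite sqr_sqrtr.
move: h; rewrite sqrtrM// -/r -/rN.
set q := D / 2 ^+ s in bb *; have q0 : 0 < q by rewrite divr_gt0.
move=> h; have h2 : q * n <= 2 * (K * (rN * r)) by have : b * n <= q / 2 * n by [rewrite ler_wpM2r//; lra|]; lra.
have h3 : q * r <= 2 * K * rN.
  have [->|rneq] := eqVneq r 0; first by rewrite mulr0 !mulr_ge0.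
  have rp : 0 < r by rewrite lt_neqAle eq_sym rneq.
  by rewrite -(ler_pM2r rp); move: h2; rewrite rn; lra.
have h4 : (q * r) ^+ 2 <= (2 * K * rN) ^+ 2.
  by rewrite lerXn2r ?nnegrE ?mulr_ge0.
have -> : 8 * B * D / 2 ^+ s * n = 8 * B / q * (q * r) ^+ 2.
  by rewrite rn /q; field; rewrite !gt_eqF.
have -> : Acst * 2 ^+ s = 8 * B / q * (2 * K * rN) ^+ 2.
  by rewrite rNE /q; field; rewrite !gt_eqF.
by rewrite ler_wpM2l// divr_ge0 ?(ltW q0)// mulr_ge0.
Qed.

(** Since 32 * 8 = 16^2, this is the origin of the constant 64 of the theorem. *)
Lemma sqrt_AC : 4 * Num.sqrt (Acst * Ccst) = 64 * B * K * Num.sqrt (N%:R * T%:R).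
Proof.
have B0 := pB_gt0 pr; have D0 := pD_gt0 pr; have B0' := ltW B0; have D0' := ltW D0; have K0 := Kconst_ge0.
have -> : Acst * Ccst = (16 * B * K) ^+ 2 * (N%:R * T%:R) by field; rewrite gt_eqF.
rewrite (sqrtrM _ (sqr_ge0 (16 * B * K))) sqrtr_sqr ger0_norm; first by ring.
by do 4?[apply: mulr_ge0 => //].
Qed.

Lemma LDP_total :
  \sum_(0 <= i < T | ~~ explore tr i) (rev i (pstar i) - rev i (tr_p tr i)) <=
  LRev pr * rT + 8 * B * D * rT + 16 * B * b * T%:R + 64 * B * K * Num.sqrt (N%:R * T%:R).
Proof.
have B0 := pB_gt0 pr; have D0 := pD_gt0 pr; have B0' := ltW B0; have D0' := ltW D0; have r0 := rT_gt0 tu.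
have TE : T%:R = rT * rT by rewrite -expr2 sqr_sqrtr.
pose f s : R := 8 * B * D / 2 ^+ s.
apply: (@le_trans _ _ (\sum_(0 <= i < T | ~~ explore tr i) (LRev pr / rT * 1 + f (tr_s tr i)))).
  rewrite big_nat_cond [leRHS]big_nat_cond; apply: ler_sum => i /andP[/andP[_ iT] ex].
  by rewrite mulr1; have [] := LDP_regret ok iT ex.
rewrite big_split /= -mulr_sumr (sum_LDP f LDP_layers).
have L1 : LRev pr / rT * (\sum_(0 <= i < T | ~~ explore tr i) 1) <= LRev pr * rT.
  apply: (@le_trans _ _ (LRev pr / rT * T%:R)).
    by rewrite ler_wpM2l ?sum_const_le// divr_ge0 ?LRev_ge0 ?(ltW r0).
  by rewrite [X in _ * X <= _]TE mulrA divfK ?gt_eqF.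
have S1 : (1 <= S)%N by rewrite /nlayers leq_max.
rewrite big_nat_recr//=.
(* The last layer certifies no width; its rounds are counted by T, and 2^S is at least the root of
   T. *)
have fS : f S * layer_count S <= 8 * B * D * rT.
  apply: (@le_trans _ _ (8 * B * D / rT * T%:R)).
    apply: ler_pM; rewrite ?layer_count_ge0 ?layer_count_le//.
      by rewrite /f divr_ge0 ?(ltW (pow2_gt0 _))// !mulr_ge0.
    rewrite /f ler_wpM2l ?lef_pV2 ?posrE ?pow2_gt0 ?pow2_nlayers//.
    by have := mulr_gt0 B0 D0; lra.
  by rewrite [X in _ * X <= _]TE mulrA divfK ?gt_eqF.
have layers : \sum_(1 <= s < S) f s * layer_count s <=
    16 * B * b * T%:R + 64 * B * K * Num.sqrt (N%:R * T%:R).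
  apply: (@le_trans _ _ (\sum_(1 <= s < S)
     (16 * B * b * layer_count s + Num.min (Acst * 2 ^+ s) (Ccst / 2 ^+ s)))).
    by rewrite big_nat [leRHS]big_nat; apply: ler_sum => s; exact: layer_regret.
  rewrite big_split /= -mulr_sumr; apply: lerD.
    rewrite ler_wpM2l//; first by have b0 := bconst_ge0; do 4?[apply: mulr_ge0 => //].
    by apply: le_trans layer_count_sum; rewrite [leRHS]big_nat_recr//= lerDl layer_count_ge0.
  rewrite -sqrt_AC.
  have A0 : 0 <= Acst by have k2 := sqr_ge0 K; apply: divr_ge0 => //; do 4?[apply: mulr_ge0 => //].
  have C0 : 0 <= Ccst by do 4?[apply: mulr_ge0 => //].
  apply: le_trans (geometric_peeling S A0 C0).
  (* The peeling sum also has a summand s = 0, which is nonnegative. *)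
  rewrite [leRHS]big_ltn// lerDr expr0 mulr1 divr1 le_min A0 C0//.
lra.
Qed.

(** An exploration round has potential above eta^2 / gamma^2, so it adds at least ln (1 + eta^2 /
    gamma^2) to the log-determinant of the pilot. *)
Lemma explore_count : \sum_(0 <= i < T | explore tr i) 1 <=
  Num.min T%:R (d%:R * ln (1 + T%:R * pCx pr ^+ 2 / d%:R) / ln (1 + teta tu ^+ 2 / gamma_T ^+ 2)).
Proof.
rewrite le_min sum_const_le /=.
have e0 := eta_gt0 tu; have g0 := gamma_gt0 ok.
have q0 : 0 < teta tu ^+ 2 / gamma_T ^+ 2 by rewrite divr_gt0// exprn_gt0.
have l0 : 0 < ln (1 + teta tu ^+ 2 / gamma_T ^+ 2) by rewrite ln_gt0// ltrDl.
rewrite ler_pdivlMr//.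
apply: le_trans (ln_det_pilot_le ok (leqnn T)); rewrite (ln_det_gram _ ltr01).
rewrite mulr_suml big_mkcond; apply: ler_sum => i _.
have p0 := pot_ge0 (pilot_dir tr) ltr01 i.
case: ifPn => [ex|_]; last by rewrite ln_ge0// lerDl.
rewrite mul1r ler_ln ?posrE ?ltr_pwDl ?(ltW q0)// lerD2l.
move: (ex); rewrite /explore /explores (pilotE tr i).1 wnormE => h.
rewrite ler_pdivrMr ?exprn_gt0// /pot {2}/pilot_dir ex mulrC.
have qq := spd_qform_ge0 (tr_x tr i) (spd_invmx (gram_seq_spd (pilot_dir tr) ltr01 i)).
rewrite -[qform _ _]sqr_sqrtr// -exprMn.
by rewrite lerXn2r ?nnegrE ?(ltW e0) ?mulr_ge0 ?sqrtr_ge0 ?(ltW g0)// ltW.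
Qed.

Lemma Kconst_le : K <= Comega pr * (D * Num.sqrt iota_T + Num.sqrt lam) * Num.sqrt iota_T.
Proof.
have D0 := pD_gt0 pr; have i1 := sqrt_iota_ge1; have c1 := Cpsi_ge1; have z0 := Cz_ge0.
have P1 := Cpsi2_ge1 pr; set si := Num.sqrt iota_T in i1 *; set sl := Num.sqrt lam.
have sl0 : 0 <= sl by exact: sqrtr_ge0.
set M := Num.max (Cpsi pr) (Cz pr).
have M1 : Cpsi pr <= M by rewrite le_max lexx.
have M2 : Cz pr <= M by rewrite le_max lexx orbT.
set s2 := Num.sqrt (2 * Num.max 1 (Cpsi2 pr)).
have s20 : 0 <= s2 by exact: sqrtr_ge0.
have sqE : sq = s2 * si.
  by rewrite /sq /s2 max_r// -sqrtrM// mulr_ge0//; lra.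
have W : 1 + M * s2 <= Comega pr by rewrite /Comega le_max lexx.
have h1 : al <= M * (D * si + sl).
  rewrite /al mulrDr -/si -/sl; apply: lerD; last by rewrite ler_wpM2r.
  by rewrite -mulrA ler_wpM2r// mulr_ge0//; lra.
have Q0 : 0 <= D * si + sl by rewrite addr_ge0// mulr_ge0//; lra.
apply: (@le_trans _ _ ((1 + M * s2) * (D * si + sl) * si)); last first.
  by rewrite ler_wpM2r ?ler_wpM2r//; lra.
rewrite /K sqE.
have h2 := ler_wpM2r (mulr_ge0 s20 (le_trans ler01 i1)) h1.
have h3 : D <= (D * si + sl) * si.
  apply: (@le_trans _ _ (D * si)); first by rewrite ler_peMr// ltW.
  apply: (@le_trans _ _ (D * si + sl)); first by rewrite lerDl.
  by rewrite ler_peMr.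
have -> : (1 + M * s2) * (D * si + sl) * si = (D * si + sl) * si + M * (D * si + sl) * (s2 * si) by ring.
lra.
Qed.

Lemma bconst_le : b <= Comega pr * bias * Num.sqrt iota_T.
Proof.
have i1 := sqrt_iota_ge1; have P1 := Cpsi2_ge1 pr; set si := Num.sqrt iota_T in i1 *.
set s2 := Num.sqrt (2 * Num.max 1 (Cpsi2 pr)).
have s20 : 0 <= s2 by exact: sqrtr_ge0.
have sqE : sq = s2 * si by rewrite /sq /s2 max_r// -sqrtrM// mulr_ge0//; lra.
have W : Cl pr * (1 + s2) <= Comega pr by rewrite /Comega le_max lexx orbT.
have b0 := bias_ge0 tu; have c0 := Cl_ge0 pr.
apply: (@le_trans _ _ (Cl pr * (1 + s2) * bias * si)); last first.
  by rewrite ler_wpM2r ?ler_wpM2r//; lra.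
have -> : Cl pr * (1 + s2) * bias * si = Cl pr * bias * (si + s2 * si) by ring.
by rewrite /b sqE ler_wpM2l ?mulr_ge0// lerD2r.
Qed.

Theorem regret_deterministic :
  \sum_(t < T) (rev t (pstar t) - rev t (tr_p tr t)) <= regret_bound d tu.
Proof.
have B0 := pB_gt0 pr; have D0 := pD_gt0 pr; have B0' := ltW B0; have D0' := ltW D0; have i0 : 0 <= iota_T by have := iota_ge1 tu d; lra.
rewrite -(big_mkord xpredT (fun t => rev t (pstar t) - rev t (tr_p tr t))) /=.
rewrite (bigID (explore tr)) /=.
have E1 : \sum_(0 <= i < T | explore tr i) (rev i (pstar i) - rev i (tr_p tr i)) <=
    B * D * \sum_(0 <= i < T | explore tr i) 1.
  rewrite mulr_sumr big_nat_cond [leRHS]big_nat_cond; apply: ler_sum => i /andP[/andP[_ iT] _].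
  by rewrite mulr1; have h := explore_regret ok iT; exact: h.
have E2 := ler_wpM2l (ltW (mulr_gt0 B0 D0)) explore_count.
have E3 := LDP_total.
have E4 : 16 * B * b * T%:R <= 16 * Comega pr * B * T%:R * bias * Num.sqrt iota_T.
  have -> : 16 * Comega pr * B * T%:R * bias * Num.sqrt iota_T =
     16 * B * (Comega pr * bias * Num.sqrt iota_T) * T%:R by ring.
  by rewrite ler_wpM2r// ler_wpM2l ?bconst_le// mulr_ge0.
have E5 : 64 * B * K * Num.sqrt (N%:R * T%:R) <=
   64 * Comega pr * B * (D * Num.sqrt iota_T + Num.sqrt lam) * Num.sqrt (N%:R * T%:R * iota_T).
  rewrite [Num.sqrt (_ * iota_T)]sqrtrM; last exact: mulr_ge0.
  set v := Num.sqrt (N%:R * T%:R).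
  have -> : 64 * Comega pr * B * (D * Num.sqrt iota_T + Num.sqrt lam) * (v * Num.sqrt iota_T) =
     64 * B * (Comega pr * (D * Num.sqrt iota_T + Num.sqrt lam) * Num.sqrt iota_T) * v by ring.
  by rewrite ler_wpM2r ?sqrtr_ge0// ler_wpM2l ?Kconst_le// mulr_ge0.
rewrite /regret_bound; lra.
Qed.

End TotalRegret.

(** * Probability of the good event *)

Section PolicyMeasurability.
Context {R : realType} (pr : primitives R) (tu : tuning pr) (d : nat).
Context {dG : measure_display} {G : measurableType dG}.
Variable tr : G -> trajectory R d (tN tu).
Local Notation m := (mord pr).
Local Notation N := (tN tu).

(** The source G is arbitrary so that it can later be [Om] with [past_cov] or [info] as its
    sigma-algebra. *)
Lemma mx_meas_pilot t :
  (forall i, (i < t)%N -> mx_meas (fun w => tr_x (tr w) i)) ->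
  (forall i, (i < t)%N -> measurable_fun setT (fun w => tr_y (tr w) i)) ->
  mx_meas (fun w => (pilot (tr w) t).1) /\ mx_meas (fun w => (pilot (tr w) t).2).
Proof.
elim: t => [|t IH] hx hy; first by split; exact: mx_meas_cst.
have [mM mb] : mx_meas (fun w => (pilot (tr w) t).1) /\
    mx_meas (fun w => (pilot (tr w) t).2).
  by apply: IH => i it; [apply: hx|apply: hy]; exact: ltn_trans it _.
have me : measurable_fun setT (fun w => explore (tr w) t).
  apply: measurable_fun_ltr => //; apply: measurable_funM => //.
  apply: measurable_wnorm; last exact: hx.
  by apply: mx_meas_invmx => // w; exact: pilot_spd.
have E w : pilot (tr w) t.+1 = if explore (tr w) t then
    ((pilot (tr w) t).1 + tr_x (tr w) t *m (tr_x (tr w) t)^T,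
     (pilot (tr w) t).2 + (pB pr * (0 < tr_y (tr w) t)%R%:R) *: tr_x (tr w) t)
    else pilot (tr w) t.
  by rewrite /= /explore; case: (pilot _ _).
split.
  rewrite (_ : (fun w => _) = (fun w => if explore (tr w) t then
    (pilot (tr w) t).1 + tr_x (tr w) t *m (tr_x (tr w) t)^T else (pilot (tr w) t).1)).
    apply: mx_meas_if => //; apply: mx_measD => //.
    by apply: mx_measM; [|apply: mx_meas_tr]; exact: hx.
  by apply/funext => w; rewrite E; case: ifP.
rewrite (_ : (fun w => _) = (fun w => if explore (tr w) t then
  (pilot (tr w) t).2 + (pB pr * (0 < tr_y (tr w) t)%R%:R) *: tr_x (tr w) t
    else (pilot (tr w) t).2)).
  apply: mx_meas_if => //; apply: mx_measD => //.
  apply: mx_measZ; last exact: hx.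
  apply: measurable_funM => //.
  rewrite (_ : (fun w => _) = (fun w => if 0 < tr_y (tr w) t then 1 else 0)); last first.
    by apply/funext => w; case: ifP.
  apply: measurable_fun_ifT => //; apply: measurable_fun_ltr => //; exact: hy.
by apply/funext => w; rewrite E; case: ifP.
Qed.

Variable t : nat.
Hypothesis hx : forall i, (i <= t)%N -> mx_meas (fun w => tr_x (tr w) i).
Hypothesis hy : forall i, (i < t)%N -> measurable_fun setT (fun w => tr_y (tr w) i).

Let mpilot : mx_meas (fun w => (pilot (tr w) t).1) /\ mx_meas (fun w => (pilot (tr w) t).2).
Proof. by apply: mx_meas_pilot => // i it; apply: hx; exact: ltnW. Qed.

Let minv : mx_meas (fun w => invmx (pilot (tr w) t).1).
Proof. by apply: mx_meas_invmx; [exact: mpilot.1|move=> w; exact: pilot_spd]. Qed.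

Lemma measurable_explore : measurable_fun setT (fun w => explore (tr w) t).
Proof.
apply: measurable_fun_ltr => //; apply: measurable_funM => //.
by apply: measurable_wnorm => //; exact: hx.
Qed.

Lemma mx_meas_pilot_dir : mx_meas (fun w => pilot_dir (tr w) t).
Proof.
apply: mx_meas_if; [exact: measurable_explore|exact: hx|exact: mx_meas_cst].
Qed.

Lemma measurable_u_hat : measurable_fun setT (fun w => u_hat (tr w) t).
Proof.
apply: measurable_minr => //; apply: measurable_maxr => //.
by apply: measurable_dotp; [exact: hx|apply: mx_measM; [|exact: mpilot.2]].
Qed.

Lemma mx_meas_layer_dir s (j : 'I_N) :
  measurable_fun setT (fun w => tr_s (tr w) t == s) ->
  measurable_fun setT (fun w => tr_j (tr w) t == j) ->
  measurable_fun setT (fun w => tr_w (tr w) t) ->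
  mx_meas (fun w => layer_dir (tr w) s j t).
Proof.
move=> ms mj mw; apply: mx_meas_if; last exact: mx_meas_cst.
  apply: measurable_and; last exact: measurable_and.
  by apply: measurable_neg; exact: measurable_explore.
have mk k : measurable_fun setT (fun w => (tr_w (tr w) t - knot tu j) ^+ k).
  by apply: measurable_funX; exact: measurable_funB.
move=> i k; rewrite (_ : (fun w => _) = (fun w => match fintype.split i with
    inl i1 => (tr_w (tr w) t - knot tu j) ^+ i1 +
      u_hat (tr w) t * (i1%:R * (tr_w (tr w) t - knot tu j) ^+ i1.-1)
  | inr i2 => - Xblocks j (tr_x (tr w) t) (tr_w (tr w) t) i2 ord0 end)); last first.
  apply/funext => w; rewrite /feat mxE; case: (fintype.split i) => a; rewrite !mxE ?(ord1 k)//.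
  by rewrite /p_hat addrK.
case: (fintype.split i) => a.
  apply: measurable_funD => //; apply: measurable_funM; first exact: measurable_u_hat.
  exact: measurable_funM.
apply: measurable_funN; case/mxvec_indexP: a => a b.
under eq_fun do rewrite mxE mxvecE mxE.
apply: measurable_funM; first exact: measurable_funM.
exact: hx.
Qed.

End PolicyMeasurability.

(** * The filtrations of the model *)

Section Filtration.
Context {R : realType} (pr : primitives R) (tu : tuning pr) (d : nat).
Context {dO : measure_display} {Om : measurableType dO} {P : probability Om R}.
Context {dU : measure_display} {UT : measurableType dU}.
Variable sys : system d (tN tu) P UT.
Local Notation T := (tT tu).
Local Notation theta := (stheta sys).
Local Notation N := (tN tu).
Local Notation x := (sx sys).
Local Notation y := (sy sys).

Lemma sigma_algebra_past t : sigma_algebra setT (past sys t).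
Proof.
case: t => [|t]; last exact: smallest_sigma_algebra.
split; first by left.
- by move=> A [->|->]; rewrite ?setD0 ?setDv; [right|left].
- move=> F HF; have [[k Fk]|nF] := pselect (exists k, F k = setT).
    by right; apply/seteqP; split=> // w _; exists k; rewrite // Fk.
  left; apply/seteqP; split=> // w [k _ Fkw].
  have [F0|FT] := HF k; first by rewrite F0 in Fkw.
  by case: nF; exists k.
Qed.

Lemma sigma_algebra_past_cov t : sigma_algebra setT (past_cov sys t).
Proof. exact: smallest_sigma_algebra. Qed.

Lemma sigma_algebra_info t : sigma_algebra setT (info sys t).
Proof. exact: smallest_sigma_algebra. Qed.

Lemma past_sub_cov t : past sys t `<=` past_cov sys t.
Proof. by move=> A pA; apply: sub_sigma_algebra; left. Qed.

Lemma past_cov_sub_info t : past_cov sys t `<=` info sys t.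
Proof. by move=> A pA; apply: sub_sigma_algebra; left. Qed.

Lemma info_sub_past t : info sys t `<=` past sys t.+1.
Proof. by move=> A pA; apply: sub_sigma_algebra; left. Qed.

Lemma past_le s t : (s <= t)%N -> past sys s `<=` past sys t.
Proof.
elim: t => [|t IH]; first by rewrite leqn0 => /eqP ->.
rewrite leq_eqVlt => /predU1P[->//|/IH h] A /h /past_sub_cov /past_cov_sub_info.
exact: info_sub_past.
Qed.

Lemma meas_wrt_x t i : meas_wrt (past_cov sys t) (fun w => x t w i ord0).
Proof.
move=> V mV; apply: sub_sigma_algebra; right; apply: sub_sigma_algebra.
by exists i => //; exists V => //; rewrite setTI.
Qed.

Lemma meas_wrt_y t : meas_wrt (past sys t.+1) (y t).
Proof.
move=> V mV; apply: sub_sigma_algebra; right.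
by exists V => //; rewrite setTI.
Qed.

Lemma meas_wrt_x_le s t i : (s <= t)%N -> meas_wrt (past_cov sys t) (fun w => x s w i ord0).
Proof.
rewrite leq_eqVlt => /predU1P[->|st]; first exact: meas_wrt_x.
apply: (meas_wrt_sub _ (@meas_wrt_x s i)) => A /past_cov_sub_info/info_sub_past.
by move=> /(past_le st)/past_sub_cov.
Qed.

Lemma meas_wrt_y_lt s t : (s < t)%N -> meas_wrt (past_cov sys t) (y s).
Proof.
by move=> st; apply: (meas_wrt_sub _ (@meas_wrt_y s)) => A /(past_le st)/past_sub_cov.
Qed.

Section OnPastCov.
Variables (t : nat) (H : set_system Om).
Hypothesis sH : sigma_algebra setT H.
Hypothesis pH : past_cov sys t `<=` H.
Let tr (w : g_sigma_algebraType H) := realized sys w.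

Lemma mx_meas_x i : (i <= t)%N -> mx_meas (fun w => tr_x (tr w) i).
Proof.
move=> it; apply/(mx_meas_wrt (x i) sH) => k j; rewrite (ord1 j).
by apply: (meas_wrt_sub pH); exact: (meas_wrt_x_le k it).
Qed.

Lemma measurable_y i : (i < t)%N -> measurable_fun setT (fun w => tr_y (tr w) i).
Proof.
move=> it; apply/(meas_wrtE (y i) sH).
by apply: (meas_wrt_sub pH); exact: (meas_wrt_y_lt it).
Qed.

End OnPastCov.

Lemma meas_wrt_pilot_dir t i :
  meas_wrt (past_cov sys t) (fun w => pilot_dir (realized sys w) t i ord0).
Proof.
have sH := sigma_algebra_past_cov t.
move: i ord0; apply/(mx_meas_wrt (fun w => pilot_dir (realized sys w) t) sH).
by apply: mx_meas_pilot_dir => k kt; [exact: (mx_meas_x sH (@subset_refl _ _))|exact: (measurable_y sH (@subset_refl _ _))].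
Qed.

(** Exploration is decided before the price is drawn, so this event can be conditioned on together
    with the past. *)
Lemma past_cov_explore t : past_cov sys t [set w | explore (realized sys w) t].
Proof.
have sH := sigma_algebra_past_cov t.
rewrite -(g_sigma_measurableE sH).
have := @measurable_explore _ _ _ _ _ (g_sigma_algebraType (past_cov sys t)) (fun w => realized sys w) t.
move=> /(_ (mx_meas_x sH (@subset_refl _ _)) (measurable_y sH (@subset_refl _ _))).
move=> /(_ measurableT [set true]); rewrite setTI; exact.
Qed.

Hypothesis mo : model_ok sys.

Lemma measurable_past t : (t <= T)%N -> forall A, past sys t A -> measurable A.
Proof.
elim: t => [|t IH] tT A; first by move=> [->|->].
apply: smallest_sub; first exact: sigma_algebra_measurable.
move=> C [|[V mV <-]]; last by rewrite setTI -[X in measurable X]setTI; exact: measurable_funP.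
apply: smallest_sub; first exact: sigma_algebra_measurable.
move=> C' [|[V mV <-]]; last by rewrite setTI -[X in measurable X]setTI; exact: measurable_funP.
apply: smallest_sub; first exact: sigma_algebra_measurable.
move=> C2 [|]; first by apply: IH; exact: ltnW.
apply: smallest_sub; first exact: sigma_algebra_measurable.
by move=> C3 [i _ [V mV <-]]; exact: (x_meas mo i tT).
Qed.

Lemma measurable_info t : (t < T)%N -> forall A, info sys t A -> measurable A.
Proof. by move=> tT A /info_sub_past; exact: measurable_past. Qed.

Lemma measurable_past_cov t : (t < T)%N -> forall A, past_cov sys t A -> measurable A.
Proof. by move=> tT A /past_cov_sub_info; exact: measurable_info. Qed.

Lemma meas_wrt_layer_dir t s (j : 'I_N) i : (t < T)%N ->
  meas_wrt (info sys t) (fun w => layer_dir (realized sys w) s j t i ord0).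
Proof.
move=> tT; have sH := sigma_algebra_info t.
move: i ord0; apply/(mx_meas_wrt (fun w => layer_dir (realized sys w) s j t) sH).
apply: mx_meas_layer_dir => [k kt|k kt|||].
- exact: (mx_meas_x sH (@past_cov_sub_info t)).
- exact: (measurable_y sH (@past_cov_sub_info t)).
- apply: (measurable_fun_bool true); rewrite setTI g_sigma_measurableE//.
  rewrite (_ : _ @^-1` _ = ss sys t @^-1` [set s]); first exact: (s_info mo s tT).
  by apply/seteqP; split=> w /= /eqP.
- apply: (measurable_fun_bool true); rewrite setTI g_sigma_measurableE//.
  rewrite (_ : _ @^-1` _ = sj sys t @^-1` [set j]); first exact: (j_info mo j tT).
  by apply/seteqP; split=> w /= /eqP.
- apply/(meas_wrtE _ sH); exact: (w_info mo tT).
Qed.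

Lemma meas_wrt_value t : meas_wrt (past_cov sys t) (fun w => dotp (x t w) theta).
Proof.
have sH := sigma_algebra_past_cov t; apply/(meas_wrtE _ sH).
have mx := mx_meas_x sH (@subset_refl _ _) (leqnn t).
exact: (measurable_dotp mx (@mx_meas_cst _ _ _ _ _ theta)).
Qed.

End Filtration.

Section UnionBound.
Context {dO : measure_display} {Om : measurableType dO} {R : realType}.
Variable P : probability Om R.

Lemma probability_bigcap_ge (I : Type) (r : seq I) (E : I -> set Om) (c : I -> R) :
  (forall i, measurable (E i)) -> (forall i, ((1 - c i)%:E <= P (E i))%E) ->
  ((1 - \sum_(i <- r) c i)%:E <= P (\big[setI/setT]_(i <- r) E i))%E.
Proof.
move=> mE cE; elim: r => [|i r IH].
  by rewrite !big_nil subr0 probability_setT.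
have mr : measurable (\big[setI/setT]_(i <- r) E i) by exact: bigsetI_measurable.
rewrite !big_cons; move: mr IH; set A := \big[_/_]_(_ <- _) _ => mA IH.
have fA (X : set Om) : measurable X -> P X = (mean P \1_X)%:E.
  by move=> mX; rewrite mean_indic// fineK// fin_num_measure.
have mEA : measurable (E i `&` A) by exact: measurableI.
move: IH (cE i); rewrite !fA// !lee_fin => IH Ei.
(* The union bound for the complements, integrated from a pointwise inequality between
   indicators. *)
have h : mean P \1_(E i) + mean P \1_A <= mean P \1_(E i `&` A) + 1.
  rewrite -[X in _ <= _ + X](mean_cst P) -!meanD; try exact: bmeas_indic; try exact: bmeas_cst.
  apply: le_mean; try (by apply: bmeasD; try exact: bmeas_indic; exact: bmeas_cst).
  move=> w; rewrite [\1_(E i `&` A)]indicI /= !indicE.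
  by case: (_ \in _); case: (_ \in _); rewrite ?mulr1 ?mulr0 ?addr0 ?add0r.
lra.
Qed.

End UnionBound.

(** * Centered noises and the probability of the confidence events *)

Section Confidence.
Context {R : realType} (pr : primitives R) (tu : tuning pr) (d : nat).
Context {dO : measure_display} {Om : measurableType dO} {P : probability Om R}.
Context {dU : measure_display} {UT : measurableType dU}.
Variable sys : system d (tN tu) P UT.
Local Notation B := (pB pr).
Local Notation D := (pD pr).
Local Notation T := (tT tu).
Local Notation N := (tN tu).
Local Notation S := (nlayers tu).
Local Notation x := (sx sys).
Local Notation y := (sy sys).
Local Notation p := (sp sys).
Local Notation theta := (stheta sys).
Local Notation delta := (tdelta tu).
Local Notation tr := (realized sys).
Local Notation past_sub_cov_ t := (@past_sub_cov _ _ _ _ _ _ _ _ _ sys t).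
Local Notation past_cov_sub_info_ t := (@past_cov_sub_info _ _ _ _ _ _ _ _ _ sys t).
Local Notation info_sub_past_ t := (@info_sub_past _ _ _ _ _ _ _ _ _ sys t).
Local Notation past_cov_explore_ t := (@past_cov_explore _ _ _ _ _ _ _ _ _ sys t).
Local Notation meas_wrt_value_ t := (@meas_wrt_value _ _ _ _ _ _ _ _ _ sys t).
Local Notation meas_wrt_y_ t := (@meas_wrt_y _ _ _ _ _ _ _ _ _ sys t).
Local Notation meas_wrt_pilot_dir_ t := (@meas_wrt_pilot_dir _ _ _ _ _ _ _ _ _ sys t).
Hypothesis mo : model_ok sys.

Let B0 : 0 < B := pB_gt0 pr.
Let D0 : 0 < D := pD_gt0 pr.
Let Beps0 : 0 < pBeps pr. Proof. by case/andP: (pBeps_itv pr). Qed.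

Lemma link_in u : 0 <= link sys u <= D.
Proof. exact: (expected_demand_in (seps sys 0%N) (q_meas mo) (q_in mo)). Qed.

Lemma measurable_link : measurable_fun setT (link sys).
Proof. exact: (measurable_expected_demand (seps sys 0%N) (q_meas mo) (q_in mo)). Qed.

Lemma measurable_value t : (t < T)%N -> measurable_fun setT (fun w => dotp (x t w) theta).
Proof.
move=> tT; apply: (meas_wrt_measurable (measurable_past_cov mo tT)); exact: meas_wrt_value.
Qed.

Lemma value_itv t w : (t < T)%N -> pBeps pr <= dotp (x t w) theta <= B - pBeps pr.
Proof. by move=> tT; apply: (value_bounded mo); exact: x_in. Qed.

Lemma meas_wrt_surplus t : (t < T)%N ->
  meas_wrt (info sys t) (fun w => p t w - dotp (x t w) theta).
Proof.
move=> tT; have sH := sigma_algebra_info sys t.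
apply/(meas_wrtE _ sH); apply: measurable_funB; apply/(meas_wrtE _ sH).
  exact: (p_info mo tT).
exact: (meas_wrt_sub (past_cov_sub_info_ t) (meas_wrt_value_ t)).
Qed.

Lemma measurable_surplus t : (t < T)%N ->
  measurable_fun setT (fun w => p t w - dotp (x t w) theta).
Proof.
move=> tT; apply: (meas_wrt_measurable (measurable_info mo tT)); exact: meas_wrt_surplus.
Qed.

Lemma bmeas_demand t : (t < T)%N -> bmeas (sy sys t).
Proof.
move=> tT; split=> //; exists D => w; have /andP[y0 yD] := y_in mo w tT.
by rewrite ger0_norm.
Qed.

Lemma bmeas_link t : (t < T)%N -> bmeas (fun w => link sys (p t w - dotp (x t w) theta)).
Proof.
move=> tT; split.
  by apply: measurableT_comp; [exact: measurable_link|exact: measurable_surplus].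
exists D => w; have /andP[g0 gD] := link_in (p t w - dotp (x t w) theta).
by rewrite ger0_norm.
Qed.

Lemma bmeas_layer_noise t : (t < T)%N ->
  bmeas (fun w => layer_noise (link sys) theta (tr w) t).
Proof.
move=> tT; apply: bmeasM; last exact: bmeas_cst.
by apply: bmeasB; [exact: bmeas_demand|exact: bmeas_link].
Qed.

Lemma layer_noise_le1 t w : (t < T)%N -> `|layer_noise (link sys) theta (tr w) t| <= 1.
Proof.
move=> tT; rewrite /layer_noise normrM normfV (gtr0_norm D0) ler_pdivrMr// mul1r.
have /andP[g0 gD] := link_in (p t w - dotp (x t w) theta).
have /andP[y0 yD] := y_in mo w tT.
by rewrite /= ler_norml; apply/andP; split; lra.
Qed.

(** On the sets of [info], [demand] replaces y by q(v - p), and averaging the independent shock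
    replaces that by the link. *)
Lemma centered_layer_noise t : (t < T)%N ->
  centered P (info sys t) (fun w => layer_noise (link sys) theta (tr w) t).
Proof.
move=> tT A HA; have mA := measurable_info mo tT HA.
have bA : bmeas (\1_A : Om -> R) by exact: bmeas_indic.
have by_ := bmeas_demand tT; have bl := bmeas_link tT.
rewrite (_ : (fun w => _) = (fun w => D^-1 * (y t w * \1_A w -
  link sys (p t w - dotp (x t w) theta) * \1_A w))); last first.
  by apply/funext => w; rewrite /layer_noise /= -mulrBl mulrCA mulrA.
rewrite meanZ; last by apply: bmeasB; exact: bmeasM.
rewrite meanB; [|exact: bmeasM|exact: bmeasM].
suff -> : mean P (fun w => y t w * \1_A w) =
    mean P (fun w => link sys (p t w - dotp (x t w) theta) * \1_A w).
  by rewrite subrr mulr0.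
rewrite /mean /Rintegral; congr fine.
have T0 : (0 < T)%N := tT_gt0 tu.
(* The link is defined with the shock of period 0; equal cdfs transfer it to period t. *)
have dist (C : set R) : measurable C ->
    distribution P (seps sys t) C = distribution P (seps sys 0%N) C.
  by apply: distribution_eq => r; rewrite !(eps_cdf mo).
have sH := sigma_algebra_info sys t.
have h := integral_demand (q_meas mo) (q_in mo) sH (measurable_info mo tT)
  (fun E V => eps_indep mo tT) dist (meas_wrt_surplus tT) HA.
apply: (eq_trans _ h).
have [_ _ /(_ A) hd] := demand mo tT.
have e (f : Om -> R) : (\int[P]_(w in A) (f w)%:E = \int[P]_w (f w * \1_A w)%:E)%E.
  by rewrite integral_mkcond epatch_indic.
rewrite -(e (y t)) hd; last by apply: sub_sigma_algebra; left.
rewrite e; apply: eq_integral => w _; congr ((_ * _)%:E); congr (sq _ _).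
by rewrite /valuation opprB addrCA addrA.
Qed.

Lemma bmeas_bool (b : Om -> bool) : measurable_fun setT b -> bmeas (fun w => (b w)%:R : R).
Proof.
move=> mb; split; last by exists 1 => w; case: (b w); rewrite ?normr1 ?normr0.
rewrite (_ : (fun w => _) = (fun w => if b w then 1 else 0)); last first.
  by apply/funext => w; case: ifP.
exact: measurable_fun_ifT.
Qed.

Let pnoise t w : R := (explore (tr w) t)%:R * pilot_noise theta (tr w) t.

Let exploreE t w : (explore (tr w) t)%:R = \1_[set w | explore (tr w) t] w :> R.
Proof.
rewrite indicE; congr ((nat_of_bool _)%:R).
by apply/idP/idP => [h|/set_mem//]; exact/mem_set.
Qed.

Lemma bmeas_sale t : bmeas (fun w => (0 < y t w)%R%:R : R).
Proof. by apply: bmeas_bool; exact: measurable_fun_ltr. Qed.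

Lemma bmeas_value t : (t < T)%N -> bmeas (fun w => dotp (x t w) theta).
Proof.
move=> tT; split; first exact: measurable_value.
exists B => w; have /andP[h1 h2] := value_itv w tT.
by have b0 := Beps0; rewrite ger0_norm; lra.
Qed.

Lemma measurable_explore_set t : (t < T)%N -> measurable [set w | explore (tr w) t].
Proof. by move=> tT; exact: (measurable_past_cov mo tT (past_cov_explore_ t)). Qed.

Lemma bmeas_pilot_noise t : (t < T)%N -> bmeas (pnoise t).
Proof.
move=> tT; apply: bmeasM.
  rewrite (_ : (fun w => _) = \1_[set w | explore (tr w) t]); last exact/funext/exploreE.
  by apply: bmeas_indic; exact: measurable_explore_set.
apply: bmeasB; first exact: bmeas_sale.
by apply: bmeasM; [exact: bmeas_value|exact: bmeas_cst].
Qed.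

Lemma pilot_noise_le1 t w : (t < T)%N -> `|pnoise t w| <= 1.
Proof.
move=> tT; rewrite /pnoise normrM; apply: mulr_ile1 => //.
  by case: (explore _ _); rewrite ?normr1 ?normr0.
rewrite /pilot_noise /=; have /andP[h1 h2] := value_itv w tT.
have b0 := Beps0; have b1 := B0.
have v0 : 0 <= dotp (x t w) theta / B by apply: divr_ge0; lra.
have v1 : dotp (x t w) theta / B <= 1 by rewrite ler_pdivrMr//; lra.
by rewrite ler_norml; case: (_ < _) => /=; apply/andP; split; lra.
Qed.

Lemma centered_pilot_noise t : (t < T)%N -> centered P (past_cov sys t) (pnoise t).
Proof.
move=> tT A HA; pose X := [set w | explore (tr w) t] `&` A.
have sH := sigma_algebra_past_cov sys t.
have HX : past_cov sys t X by exact: (sigma_algebra_setI sH (past_cov_explore_ t) HA).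
have mX := measurable_past_cov mo tT HX.
have bX : bmeas (\1_X : Om -> R) by exact: bmeas_indic.
have bv := bmeas_value tT; have bs := bmeas_sale t.
have my : measurable_fun setT (y t) by [].
have := @pilot_sale_mean _ _ _ P (info sys t) (past_cov sys t) (seps sys t)
  (sigma_algebra_info sys t) sH (past_cov_sub_info_ t)
  (measurable_info mo tT) (fun E V => eps_indep mo tT) B (pBeps pr) B0 (ltW Beps0)
  (p t) (fun w => dotp (x t w) theta) (y t) X (eps_bounded mo tT) (eps_mean mo tT)
  (p_info mo tT) (meas_wrt_value_ t) (fun w => value_itv w tT)
  my (sale mo tT) HX.
have unif E V : past_cov sys t E -> measurable V ->
    P (X `&` E `&` p t @^-1` V) = (P (X `&` E) * uniform_prob B0 V)%E.
  move=> HE mV; have HAE : past_cov sys t (A `&` E) by exact: (sigma_algebra_setI sH HA HE).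
  by have := pilot_price mo tT HAE mV; rewrite -/tr /= [_ `&` [set w | _]]setIC setIA; exact.
move=> /(_ unif) h.
rewrite (_ : (fun w => _) = (fun w => \1_X w * (0 < y t w)%R%:R -
    B^-1 * (\1_X w * dotp (x t w) theta))); last first.
  apply/funext => w; rewrite /pnoise exploreE /X indicI /=.
  rewrite /pilot_noise /= mulrAC; ring.
rewrite meanB; [|exact: bmeasM|by apply: bmeasM; [exact: bmeas_cst|exact: bmeasM]].
rewrite meanZ; last exact: bmeasM.
by rewrite h [B^-1 * _]mulrC subrr.
Qed.

Let cov_sub_past t : past_cov sys t `<=` past sys t.+1.
Proof. exact: (subset_trans (past_cov_sub_info_ t) (info_sub_past_ t)). Qed.

Lemma meas_wrt_pilot_noise t : meas_wrt (past sys t.+1) (pnoise t).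
Proof.
have sH := sigma_algebra_past sys t.+1.
have mX : measurable ([set w | explore (tr w) t] : set (g_sigma_algebraType (past sys t.+1))).
  rewrite g_sigma_measurableE//.
  exact: cov_sub_past (past_cov_explore_ t).
have mv : measurable_fun (setT : set (g_sigma_algebraType (past sys t.+1))) (fun w => dotp (x t w) theta).
  by apply/(meas_wrtE _ sH); exact: (meas_wrt_sub (@cov_sub_past t) (meas_wrt_value_ t)).
have my : measurable_fun (setT : set (g_sigma_algebraType (past sys t.+1))) (y t).
  by apply/(meas_wrtE _ sH); exact: (meas_wrt_y_ t).
apply/(meas_wrtE _ sH); apply: measurable_funM.
  rewrite (_ : (fun w => _) = \1_[set w | explore (tr w) t]); last exact/funext/exploreE.
  exact: measurable_indic.
apply: measurable_funB; last exact: measurable_funM.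
rewrite (_ : (fun w => _) = (fun w => if 0 < y t w then 1 else 0)); last first.
  by apply/funext => w; rewrite /=; case: ifP.
by apply: measurable_fun_ifT => //; exact: measurable_fun_ltr.
Qed.

Lemma meas_wrt_layer_noise t : (t < T)%N ->
  meas_wrt (past sys t.+1) (fun w => layer_noise (link sys) theta (tr w) t).
Proof.
move=> tT; have sH := sigma_algebra_past sys t.+1.
have ms : measurable_fun (setT : set (g_sigma_algebraType (past sys t.+1))) (fun w => p t w - dotp (x t w) theta).
  apply/(meas_wrtE _ sH).
  exact: (meas_wrt_sub (info_sub_past_ t) (meas_wrt_surplus tT)).
have my : measurable_fun (setT : set (g_sigma_algebraType (past sys t.+1))) (y t).
  by apply/(meas_wrtE _ sH); exact: (meas_wrt_y_ t).
apply/(meas_wrtE _ sH); apply: measurable_funM => //; apply: measurable_funB => //.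
by apply: (measurableT_comp measurable_link).
Qed.

Lemma pilot_event_prob : exists E, [/\ measurable E, ((1 - delta / 4)%:E <= P E)%E &
  forall w, E w -> pilot_event theta (tr w)].
Proof.
have d0 := delta_gt0 tu; have d1 := delta_lt1 tu.
have c1 : 1 <= 4 / delta by rewrite ler_pdivlMr// mul1r; lra.
have [E [mE PE EH]] := @self_normalized_bound _ _ _ P T d (past_cov sys)
  (fun t w => pilot_dir (tr w) t) pnoise 1 (4 / delta) ltr01 c1
  (fun t _ => sigma_algebra_past_cov sys t) (fun t tT => measurable_past_cov mo tT)
  (fun t _ => subset_trans (past_cov_sub_info_ t)
    (subset_trans (info_sub_past_ t) (past_sub_cov_ t.+1)))
  (fun t i _ => meas_wrt_pilot_dir_ t i)
  (fun t _ => meas_wrt_sub (past_sub_cov_ t.+1) (@meas_wrt_pilot_noise t))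
  (fun t tT => (bmeas_pilot_noise tT).1) (fun t w tT => pilot_noise_le1 w tT)
  (fun t tT => centered_pilot_noise tT).
exists E; split=> //; first by rewrite invf_div in PE.
move=> w Ew t tT; have := EH w Ew t tT.
rewrite /sn_sum /pnoise (eq_bigr (fun i => pilot_noise theta (tr w) i *: pilot_dir (tr w) i)) => [|i _].
  exact.
by rewrite /pilot_dir; case: ifP => _; rewrite ?scaler0// mul1r.
Qed.

Lemma layer_event_prob s (j : 'I_N) : exists E, [/\ measurable E,
  ((1 - delta / (4 * S%:R * N%:R))%:E <= P E)%E &
  forall w, E w -> layer_event (link sys) theta (tr w) s j].
Proof.
have c1 : 1 <= 4 * S%:R * N%:R / delta.
  by apply: le_trans (confidence_ge4 tu); rewrite ler1n.
have [E [mE PE EH]] := @self_normalized_bound _ _ _ P T _ (info sys)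
  (fun t w => layer_dir (tr w) s j t) (fun t w => layer_noise (link sys) theta (tr w) t)
  (tlambda tu) (4 * S%:R * N%:R / delta) (lam_gt0 tu) c1
  (fun t _ => sigma_algebra_info sys t) (fun t tT => measurable_info mo tT)
  (fun t _ => subset_trans (info_sub_past_ t)
    (subset_trans (past_sub_cov_ t.+1) (past_cov_sub_info_ t.+1)))
  (fun t i tT => meas_wrt_layer_dir mo s j i tT)
  (fun t tT => meas_wrt_sub (subset_trans (past_sub_cov_ t.+1) (past_cov_sub_info_ t.+1))
    (meas_wrt_layer_noise (ltnW tT)))
  (fun t tT => (bmeas_layer_noise tT).1) (fun t w tT => layer_noise_le1 w tT)
  (fun t tT => centered_layer_noise tT).
by exists E; split=> //; rewrite invf_div in PE.
Qed.

(** The pilot fails with probability at most delta / 4, and the S N layer regressions share another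
    delta / 4. *)
Lemma run_ok_prob : with_prob_ge P (1 - delta)
  (fun w => run_ok (link sys) theta (tr w) (spstar sys ^~ w)).
Proof.
have [E0 [mE0 PE0 E0H]] := pilot_event_prob.
have /choice[EL ELH] : forall sj : 'I_S * 'I_N, exists E, [/\ measurable E,
  ((1 - delta / (4 * S%:R * N%:R))%:E <= P E)%E &
  forall w, E w -> layer_event (link sys) theta (tr w) sj.1.+1 sj.2].
  by move=> sj; exact: layer_event_prob.
pose F := \big[setI/setT]_(sj : 'I_S * 'I_N) EL sj.
have mF : measurable F by apply: bigsetI_measurable => sj _; have [] := ELH sj.
have FE w sj : F w -> EL sj w by rewrite /F (bigD1 sj)//= => -[].
have PF : ((1 - delta / 4)%:E <= P F)%E.
  apply: le_trans (probability_bigcap_ge (c := fun=> delta / (4 * S%:R * N%:R)) _ _ _); last first.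
  - by move=> sj; have [] := ELH sj.
  - by move=> sj; have [] := ELH sj.
  rewrite sumr_const card_prod !card_ord -(mulr_natr _ (S * N)) natrM.
  have s1 := nlayers_ge1 tu; have n1 : 1 <= N%:R :> R by rewrite ler1n tN_gt0.
  have -> : delta / (4 * S%:R * N%:R) * (S%:R * N%:R) = delta / 4.
    by field; rewrite !gt_eqF//; lra.
  exact: lexx.
pose E (b : bool) := if b then E0 else F.
have U : ((1 - \sum_(b : bool) delta / 4)%:E <= P (\big[setI/setT]_(b : bool) E b))%E.
  by apply: probability_bigcap_ge => -[].
have EI w : (\big[setI/setT]_(b : bool) E b) w -> E0 w /\ F w by rewrite big_bool.
exists (\big[setI/setT]_(b : bool) E b); split.
- by apply: bigsetI_measurable => -[].
- apply: le_trans U; rewrite lee_fin big_bool /=.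
  by have := delta_gt0 tu; lra.
move=> w /EI[E0w Fw]; split.
- exact: (dim_gt0 mo).
- split; [exact: link_in|exact: (link_holder mo)|exact: (link_ext_bound mo)].
- exact: (theta_in mo).
- by move=> t tT; apply: (X_bounded mo); exact: x_in.
- by move=> t tT; exact: value_itv.
- by move=> t tT; exact: (p_in mo).
- exact: (policy mo).
- by move=> t tT; exact: (pstar_max mo).
- exact: E0H E0w.
move=> s j /andP[s0 sS].
(* Layers run from 1 to S, whereas the union bound is indexed by ordinals from 0. *)
have sS' : (s.-1 < S)%N by rewrite prednK.
by have [_ _ /(_ w (FE w (Ordinal sS', j) Fw))] := ELH (Ordinal sS', j); rewrite /= prednK.
Qed.

Lemma regret_bound_prob : with_prob_ge P (1 - delta) (fun w => Reg sys w <= regret_bound d tu).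
Proof.
have [E [mE PE EH]] := run_ok_prob; exists E; split=> // w /EH ok.
exact: (regret_deterministic ok).
Qed.

End Confidence.

(** * The rate *)

(** This is ln (1 + x) >= x / (1 + x); it turns the exploration count into a multiple of 1 + gamma^2
    / eta^2. *)
Lemma inv_ln_le (R : realType) (x : R) : 0 < x -> (ln (1 + x))^-1 <= 1 + x^-1.
Proof.
move=> x0; have x1 : 0 < 1 + x by rewrite addr_gt0.
have := @ln_le_subr1 R (1 + x)^-1 _; rewrite invr_gt0 => /(_ x1).
rewrite lnV ?posrE// => h.
have lx : 0 < ln (1 + x) by rewrite ln_gt0// ltrDl.
have k0 : 0 < 1 + x^-1 by rewrite addr_gt0 ?invr_gt0.
rewrite -[leRHS]invrK lef_pV2 ?posrE ?invr_gt0//.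
have -> : (1 + x^-1)^-1 = 1 - (1 + x)^-1 by field; rewrite !gt_eqF//= addrC.
lra.
Qed.

Lemma mulr_powR (R : realType) (x a : R) : 0 < x -> x * x `^ a = x `^ (1 + a).
Proof. by move=> x0; rewrite powRD ?(gt_eqF x0) ?implybT// powRr1// ltW. Qed.

Section RateConstant.
Context {R : realType} (pr : primitives R).
Local Notation B := (pB pr).
Local Notation D := (pD pr).
Local Notation beta := (pbeta pr).

(** One summand for each term of the regret bound, with the coefficients of the four lemmas below;
    the leading 1 makes positivity immediate. *)
Definition rate_constant : R :=
  1 + B * D * (1 + (B ^+ 2)^-1 + (B `^ beta)^-1)
  + 128 * Comega pr * B * (D + 1)
  + 32 * Comega pr * B * (2 * B) `^ beta
  + (8 * B * D + LRev pr).

Lemma Comega_ge1 : 1 <= Comega pr.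
Proof.
rewrite /Comega le_max lerDl mulr_ge0 ?sqrtr_ge0//.
by rewrite le_max /Cpsi sqrtr_ge0.
Qed.

Let B0 : 0 < B := pB_gt0 pr.
Let D0 : 0 < D := pD_gt0 pr.
Let b1 : 1 <= beta := pbeta_ge1 pr.

Lemma rate_constant_gt0 : 0 < rate_constant.
Proof.
have c1 := Comega_ge1; have := LRev_ge0 pr; have b0 := B0; have d0 := D0.
have p1 : 0 <= (2 * B) `^ beta := powR_ge0 _ _.
have p2 : 0 <= (B ^+ 2)^-1 by rewrite invr_ge0 exprn_ge0 ?ltW.
have p3 : 0 <= (B `^ beta)^-1 by rewrite invr_ge0 powR_ge0.
have c0 : 0 <= Comega pr by lra.
rewrite /rate_constant => l0.
have q1 : 0 <= B * D * (1 + (B ^+ 2)^-1 + (B `^ beta)^-1).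
  by rewrite mulr_ge0// ?addr_ge0// mulr_ge0 ?ltW.
have q2 : 0 <= 128 * Comega pr * B * (D + 1).
  by do 3?[apply: mulr_ge0 => //]; lra.
have q3 : 0 <= 32 * Comega pr * B * (2 * B) `^ beta.
  by do 3?[apply: mulr_ge0 => //]; lra.
have q4 : 0 <= B * D by rewrite mulr_ge0 ?ltW.
lra.
Qed.

Variables (d : nat) (tu : tuning pr).
Hypothesis rt : rate_tuning tu.
Local Notation N := ((tN tu)%:R : R).
Local Notation T := ((tT tu)%:R : R).
Local Notation h := (hbin tu).
Local Notation eta := (teta tu).
Local Notation lam := (tlambda tu).
Local Notation iota_T := (iotaT d tu).
Local Notation gamma_T := (gammaT d tu).

(** Every quantity is compared with a power of tau: T = tau^(2 beta + 1), rho = tau^(beta + 1), N is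
    between tau and 2 tau, and h is of order 1 / tau. *)
Let tau : R := T `^ (2 * beta + 1)^-1.
Let rho : R := T `^ ((beta + 1) / (2 * beta + 1)).

Let T1 : 1 <= T. Proof. by rewrite ler1n tT_gt0. Qed.
Let e0 : 0 < 2 * beta + 1. Proof. by have := b1; lra. Qed.

Let tau1 : 1 <= tau.
Proof. by rewrite /tau -[leLHS](powRr0 T) ler_powR// invr_ge0 ltW. Qed.
Let tau0 : 0 < tau. Proof. exact: lt_le_trans tau1. Qed.

Let rhoE : rho = tau `^ (beta + 1).
Proof. by rewrite /rho /tau -powRrM mulrC. Qed.
Let TE : T = tau `^ (2 * beta + 1).
Proof. by rewrite /tau -powRrM mulVf ?powRr1 ?gt_eqF. Qed.

Let rho1 : 1 <= rho.
Proof. by rewrite rhoE -[leLHS](powRr0 tau) ler_powR//; have := b1; lra. Qed.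

Let N_le : tau <= N <= 2 * tau.
Proof.
rewrite rt.1 -/tau; have /andP[h1 h2] := ceil_itv tau.
have : 0 < Num.ceil tau by rewrite ceil_gt0.
move: h1 h2; case: (Num.ceil tau) => // n h1 h2 _ /=.
have t1 := tau1; rewrite -pmulrn in h2; rewrite h2 /=.
by move: h1; rewrite -[X in _ - X]/(1%:Z) intrB -!pmulrn; lra.
Qed.

Let N0 : 0 < N. Proof. exact: N_gt0. Qed.

Let h_ge : B / tau <= h.
Proof.
have /andP[_ n2] := N_le; have b0 := B0; have t0 := tau0; have n0 := N0.
rewrite /hbin ler_pdivlMr// mulrAC ler_pdivrMr//.
by have := ler_wpM2l (ltW b0) n2; lra.
Qed.

Let h_le : h <= 2 * B / tau.
Proof.
have /andP[n1 _] := N_le; have b0 := B0; have t0 := tau0; have n0 := N0.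
by rewrite /hbin ler_wpM2l// ?lef_pV2 ?posrE//; lra.
Qed.

Let ell : R := d%:R * ln (1 + T * pCx pr ^+ 2 / d%:R).

Let ell0 : 0 <= ell.
Proof.
by rewrite mulr_ge0// ln_ge0// lerDl divr_ge0// mulr_ge0 ?sqr_ge0 ?(le_trans _ T1).
Qed.

Let h0 : 0 < h. Proof. exact: hbin_gt0. Qed.

Let Vh : h^-1 <= tau / B.
Proof.
have q : 0 < B / tau by rewrite divr_gt0.
by rewrite -[tau / B]invf_div lef_pV2 ?posrE.
Qed.

(** The inverse of the minimum is h^-2 or h^-beta, hence of order tau^2 or tau^beta; both are at
    most tau^(beta + 1), because beta >= 1. *)
Lemma inv_eta2_le : (eta ^+ 2)^-1 <= ((B ^+ 2)^-1 + (B `^ beta)^-1) * rho.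
Proof.
have t0 := tau0; have b0 := B0; have t1 := tau1; have bb := b1.
have v0 : 0 <= h^-1 by rewrite invr_ge0 ltW.
have r0 : 0 <= rho := le_trans ler01 rho1.
have hb : (h `^ beta)^-1 <= (B `^ beta)^-1 * rho.
  apply: (@le_trans _ _ ((B / tau) `^ beta)^-1).
    have q : 0 < B / tau by rewrite divr_gt0.
    rewrite lef_pV2 ?posrE ?powR_gt0//.
    by apply: ge0_ler_powR => //; rewrite ?nnegrE ?(ltW q) ?(ltW h0)//; lra.
  have ti : 0 <= tau^-1 by rewrite invr_ge0 ltW.
  rewrite (powRM _ (ltW b0) ti) invfM; apply: ler_wpM2l; first by rewrite invr_ge0 powR_ge0.
  by rewrite -(powR_inv1 (ltW t0)) -powRrM -powRN rhoE mulN1r opprK ler_powR//; lra.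
have h2 : (h ^+ 2)^-1 <= (B ^+ 2)^-1 * rho.
  apply: (@le_trans _ _ ((tau / B) ^+ 2)).
    have q : 0 <= tau / B by rewrite divr_ge0 ?ltW.
    by rewrite -exprVn lerXn2r.
  rewrite expr_div_n mulrC; apply: ler_wpM2l; first by rewrite invr_ge0 exprn_ge0 ?ltW.
  by rewrite -(powR_mulrn _ (ltW t0)) rhoE ler_powR//; lra.
have x1 : 0 <= (B ^+ 2)^-1 by rewrite invr_ge0 exprn_ge0 ?ltW.
have x2 : 0 <= (B `^ beta)^-1 by rewrite invr_ge0 powR_ge0.
have {}x1 := mulr_ge0 x1 r0; have {}x2 := mulr_ge0 x2 r0.
by rewrite rt.2 mulrDl; case: (leP (h ^+ 2)) => _; lra.
Qed.

Let Kl : R := d%:R * (1 + gamma_T ^+ 2) * ln (1 + T * pCx pr ^+ 2 / d%:R).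

Lemma explore_rate : B * D * Num.min T (ell / ln (1 + eta ^+ 2 / gamma_T ^+ 2)) <=
  B * D * (1 + (B ^+ 2)^-1 + (B `^ beta)^-1) * (Kl * rho).
Proof.
have KE : Kl = ell * (1 + gamma_T ^+ 2) by rewrite /Kl /ell mulrAC.
rewrite -[leRHS]mulrA; apply: ler_wpM2l; first by rewrite mulr_ge0 ?ltW.
apply: (@le_trans _ _ (ell / ln (1 + eta ^+ 2 / gamma_T ^+ 2))).
  by rewrite ge_min lexx orbT.
have b20 : 0 <= (B ^+ 2)^-1 by rewrite invr_ge0 exprn_ge0 ?ltW.
have bb0 : 0 <= (B `^ beta)^-1 by rewrite invr_ge0 powR_ge0.
have r1 := rho1; have r0 : 0 <= rho by lra.
(* No model hypothesis is available here to exclude gamma = 0. In that case division by zero makes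
   the exploration term 0. *)
have [g0|g0] := eqVneq gamma_T 0.
  rewrite g0 expr0n invr0 mulr0 addr0 ln1 invr0 mulr0.
  by rewrite KE g0 expr0n addr0 mulr1; do 3?[apply: mulr_ge0 => //]; lra.
have g2 : 0 < gamma_T ^+ 2 by rewrite exprn_even_gt0.
have e2 : 0 < eta ^+ 2 by rewrite exprn_gt0// eta_gt0.
have L := inv_ln_le (divr_gt0 e2 g2).
have E := inv_eta2_le.
have c0 : 0 <= (eta ^+ 2)^-1 by rewrite invr_ge0 ltW.
rewrite KE [leRHS](_ : _ = ell * ((1 + gamma_T ^+ 2) * ((1 + (B ^+ 2)^-1 + (B `^ beta)^-1) * rho))); last by ring.
rewrite ler_wpM2l// (le_trans L)// invf_div.
have : (1 + gamma_T ^+ 2) * (1 + (eta ^+ 2)^-1) <=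
    (1 + gamma_T ^+ 2) * ((1 + (B ^+ 2)^-1 + (B `^ beta)^-1) * rho).
  apply: ler_wpM2l; first lra.
  by rewrite -addrA mulrDl mul1r; lra.
apply: le_trans; rewrite mulrDl mul1r mulrDr mulr1.
by have := ltW g2; lra.
Qed.

Let i1 : 1 <= iota_T. Proof. exact: iota_ge1. Qed.
Let i0 : 0 <= iota_T. Proof. exact: le_trans ler01 i1. Qed.
Let sq_le : Num.sqrt iota_T <= iota_T.
Proof.
rewrite -[leRHS]sqr_sqrtr// expr2 ler_peMl ?sqrtr_ge0//.
by rewrite -[leLHS]sqrtr1 ler_wsqrtr.
Qed.
Let Kr : R := (1 + Num.sqrt lam) * iota_T.
Let i_le : iota_T <= Kr.
Proof. by rewrite /Kr ler_peMl// lerDl sqrtr_ge0. Qed.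

Lemma width_rate : 64 * Comega pr * B * (D * Num.sqrt iota_T + Num.sqrt lam)
      * Num.sqrt (N * T * iota_T) <=
  128 * Comega pr * B * (D + 1) * (Kr * rho).
Proof.
have c1 := Comega_ge1; have c0 : 0 <= Comega pr := le_trans ler01 c1.
have b0 := B0; have d0 := D0; have r1 := rho1; have r0 : 0 <= rho by lra.
have /andP[n1 n2] := N_le; have t0 := tau0; have t1 := T1.
(* The exponents balance, 1 + (2 beta + 1) = 2 (beta + 1); with N <= 2 tau this bounds the root of N
   T by 2 rho. *)
have TT : tau * T = rho ^+ 2.
  apply: etrans (congr1 (fun z => tau * z) TE) _.
  have e : rho ^+ 2 = rho `^ 2%:R by rewrite (powR_mulrn 2 r0).
  rewrite e rhoE -powRrM.
  rewrite (mulr_powR _ t0).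
  by congr (_ `^ _); ring.
have NT : Num.sqrt (N * T) <= 2 * rho.
  rewrite -[leRHS]ger0_norm ?mulr_ge0// -sqrtr_sqr ler_wsqrtr// exprMn -TT.
  apply: (@le_trans _ _ (2 * tau * T)); first by rewrite ler_wpM2r.
  have : 0 <= tau * T by rewrite mulr_ge0 ?(ltW t0)//; lra.
  by rewrite -mulrA -natrX; lra.
have s0 := sqrtr_ge0 iota_T; have l0 := sqrtr_ge0 lam; have sl := sq_le.
have ss : Num.sqrt iota_T * Num.sqrt iota_T = iota_T by rewrite -expr2 sqr_sqrtr.
rewrite sqrtrM; last by rewrite mulr_ge0.
have Ks : (D * Num.sqrt iota_T + Num.sqrt lam) * Num.sqrt iota_T <= (D + 1) * Kr.
  rewrite mulrDl -mulrA ss mulrDl mul1r lerD//.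
    by apply: ler_wpM2l; [exact: ltW|exact: i_le].
  rewrite /Kr mulrDl mul1r.
  have : Num.sqrt lam * Num.sqrt iota_T <= Num.sqrt lam * iota_T by rewrite ler_wpM2l.
  by have := i0; lra.
rewrite [leLHS](_ : _ = (64 * Comega pr * B) *
   (Num.sqrt (N * T) * ((D * Num.sqrt iota_T + Num.sqrt lam) * Num.sqrt iota_T))); last by ring.
rewrite [leRHS](_ : _ = (64 * Comega pr * B) * ((2 * rho) * ((D + 1) * Kr))); last by ring.
apply: ler_wpM2l; first by do 2?[apply: mulr_ge0 => //]; lra.
apply: ler_pM => //.
by rewrite mulr_ge0// addr_ge0// mulr_ge0// ltW.
Qed.

Lemma bias_rate : 16 * Comega pr * B * T * (h `^ beta + eta ^+ 2) * Num.sqrt iota_T <=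
  32 * Comega pr * B * (2 * B) `^ beta * (Kr * rho).
Proof.
have c1 := Comega_ge1; have c0 : 0 <= Comega pr := le_trans ler01 c1.
have b0 := B0; have t0 := tau0; have t1 := T1; have bb := b1.
have e2 : eta ^+ 2 <= h `^ beta by rewrite rt.2 ge_min lexx orbT.
have Th : T * h `^ beta <= (2 * B) `^ beta * rho.
  (* Since h <= 2 B / tau, the product has order tau^(2 beta + 1 - beta) = rho. *)
  apply: (@le_trans _ _ (T * ((2 * B) / tau) `^ beta)).
    apply: ler_wpM2l; first lra.
    have q : 0 <= 2 * B / tau by rewrite divr_ge0 ?mulr_ge0 ?ltW.
    by apply: ge0_ler_powR => //; rewrite ?nnegrE ?q ?(ltW h0)//; lra.
  have ti : 0 <= tau^-1 by rewrite invr_ge0 ltW.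
  have bb2 : 0 <= 2 * B by lra.
  rewrite (powRM _ bb2 ti) mulrCA; apply: ler_wpM2l; first exact: powR_ge0.
  rewrite -(powR_inv1 (ltW t0)) -powRrM mulN1r [X in X * _]TE -powRD; last by rewrite (gt_eqF t0) implybT.
  by rewrite rhoE ler_powR//; lra.
have s0 := sqrtr_ge0 iota_T; have sl := sq_le; have il := i_le.
have p0 : 0 <= h `^ beta := powR_ge0 _ _.
rewrite [leLHS](_ : _ = (16 * Comega pr * B) * ((T * (h `^ beta + eta ^+ 2)) * Num.sqrt iota_T)); last by ring.
rewrite [leRHS](_ : _ = (16 * Comega pr * B) * ((2 * ((2 * B) `^ beta * rho)) * Kr)); last by ring.
apply: ler_wpM2l; first by do 2?[apply: mulr_ge0 => //]; lra.
apply: ler_pM => //; [|rewrite mulrDr|lra].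
  by rewrite mulr_ge0 ?addr_ge0 ?sqr_ge0//; lra.
have : T * eta ^+ 2 <= T * h `^ beta by rewrite ler_wpM2l//; lra.
lra.
Qed.

Lemma sqrtT_rate : (8 * B * D + LRev pr) * Num.sqrt T <= (8 * B * D + LRev pr) * (Kr * rho).
Proof.
have b0 := B0; have d0 := D0; have r1 := rho1; have il := i_le; have ii := i1.
apply: ler_wpM2l.
  by rewrite addr_ge0 ?LRev_ge0//; do 2?[apply: mulr_ge0 => //]; lra.
have T12 : Num.sqrt T <= rho.
  rewrite -powR12_sqrt// /rho ler_powR// ler_pdivlMr//.
  by have := b1; lra.
by rewrite (le_trans T12)// ler_peMl//; lra.
Qed.

Lemma regret_bound_rate : regret_bound d tu <= rate_constant * regret_rate d tu.
Proof.
have c1 := Comega_ge1; have c0 : 0 <= Comega pr := le_trans ler01 c1.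
have b0 := B0; have d0 := D0; have r1 := rho1; have r0 : 0 <= rho by lra.
have l0 := LRev_ge0 pr; have il := i_le; have ii := i1.
have KL0 : 0 <= Kl.
  by rewrite /Kl mulrAC mulr_ge0// addr_ge0// sqr_ge0.
have KR0 : 0 <= Kr by lra.
have q1 : 0 <= B * D * (1 + (B ^+ 2)^-1 + (B `^ beta)^-1).
  by rewrite mulr_ge0 ?addr_ge0 ?invr_ge0 ?exprn_ge0 ?powR_ge0 ?mulr_ge0 ?ltW.
have q2 : 0 <= 128 * Comega pr * B * (D + 1).
  by do 3?[apply: mulr_ge0 => //]; lra.
have q3 : 0 <= 32 * Comega pr * B * (2 * B) `^ beta.
  by do 3?[apply: mulr_ge0 => //]; [lra|exact: powR_ge0].
have q4 : 0 <= 8 * B * D + LRev pr.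
  by rewrite addr_ge0//; do 2?[apply: mulr_ge0 => //]; lra.
have e1 := explore_rate; have e2 := width_rate; have e3 := bias_rate; have e4 := sqrtT_rate.
rewrite /regret_bound -/ell.
have -> : regret_rate d tu = Kl * rho + Kr * rho by rewrite /regret_rate mulrDl.
have x0 : 0 <= Kl * rho by rewrite mulr_ge0.
have y0 : 0 <= Kr * rho by rewrite mulr_ge0.
move: e1 e2 e3 e4 x0 y0; rewrite /rate_constant.
move: (Kl * rho) (Kr * rho) q1 q2 q3 q4 => X Y.
move: (B * D * (1 + _ + _)) (128 * _ * _ * _) (32 * _ * _ * _) (8 * B * D + _) => a1 a2 a3 a4.
move=> q1 q2 q3 q4 e1 e2 e3 e4 x0 y0.
have := mulr_ge0 q1 y0; have := mulr_ge0 q2 x0; have := mulr_ge0 q3 x0; have := mulr_ge0 q4 x0.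
by move: e1 e2 e3 e4; lra.
Qed.

End RateConstant.

Theorem theorem5p4 (R : realType) (pr : primitives R) :
  (forall (d : nat) (tu : tuning pr)
          (dO : measure_display) (Om : measurableType dO) (P : probability Om R)
          (dU : measure_display) (UT : measurableType dU)
          (sys : system d (tN tu) P UT),
     model_ok sys ->
     with_prob_ge P (1 - tdelta tu) (fun w => Reg sys w <= regret_bound d tu))
  /\
  (exists2 C : R, 0 < C &
     forall (d : nat) (tu : tuning pr)
            (dO : measure_display) (Om : measurableType dO) (P : probability Om R)
            (dU : measure_display) (UT : measurableType dU)
            (sys : system d (tN tu) P UT),
       rate_tuning tu -> model_ok sys ->
       with_prob_ge P (1 - tdelta tu) (fun w => Reg sys w <= C * regret_rate d tu)).
Proof.
split=> [d tu dO Om P dU UT sys mo|]; first exact: regret_bound_prob.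
exists (rate_constant pr) => [|d tu dO Om P dU UT sys rt mo].
  exact: rate_constant_gt0.
have [E [mE PE EH]] := regret_bound_prob mo.
by exists E; split=> // w /EH/le_trans; apply; exact: regret_bound_rate.
Qed.
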